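(* Let $N\in\mathbb{N}$. The following growth and decay estimates hold as $i,j,k\to+\infty$. (a) Each of $$\overline{\mathbb{I}}_{jki},\ \frac{\mathbb{I}_{jki}}{\omega_i},\ \overline{\mathbb{J}}_{jki},\ \frac{\mathbb{J}_{jki}}{\omega_i},\ \overline{\mathbb{P}}_{ajki},\ \frac{\mathbb{P}_{ajki}}{\omega_i},\ \overline{\mathbb{Q}}_{ajki},\ \frac{\mathbb{Q}_{ajki}}{\omega_i}\ (a=1,2,3,4),\ \overline{\mathbb{S}}_{0jki},\ \frac{\mathbb{S}_{0jki}}{\omega_i}$$ is $\mathcal{O}(\omega_i^{-1})$ if at least one of the four combinations $\omega_i\pm\omega_j\pm\omega_k$ does not tend to $\infty$, and is $$\frac{1}{\omega_i}\sum_\pm\mathcal{O}\left(\frac{1}{(\omega_i\pm\omega_j\pm\omega_k)^p}\right)$$ if all four combinations $\omega_i\pm\omega_j\pm\omega_k\to\infty$, where: $p=3$ for $\overline{\mathbb{I}}_{jki},\mathbb{I}_{jki},\overline{\mathbb{J}}_{jki},\mathbb{J}_{jki}$ and for $\overline{\mathbb{P}}_{ajki},\mathbb{P}_{ajki},\overline{\mathbb{Q}}_{ajki},\mathbb{Q}_{ajki}$ with $a\in\{3,4\}$; $p=9$ for $\overline{\mathbb{P}}_{1jki},\mathbb{P}_{1jki},\overline{\mathbb{Q}}_{1jki},\mathbb{Q}_{1jki}$; $p=11$ for $\overline{\mathbb{P}}_{2jki},\mathbb{P}_{2jki},\overline{\mathbb{Q}}_{2jki},\mathbb{Q}_{2jki}$;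 and $p=N$ for $\overline{\mathbb{S}}_{0jki},\mathbb{S}_{0jki}$. (b) $\omega_0\omega_i\overline{\mathbb{H}}_{0jki}=\mathcal{O}(\omega_i\omega_k)$ if at least one of the four combinations $\omega_i\pm\omega_j\pm\omega_k$ does not tend to $\infty$, and $$\omega_0\omega_i\overline{\mathbb{H}}_{0jki}=\sum_\pm\mathcal{O}\left(\frac{\omega_i}{(\omega_i\pm\omega_j\pm\omega_k)^N}\right)$$ if all four combinations $\omega_i\pm\omega_j\pm\omega_k\to\infty$. (c) The following functions $F$ (the weights associated with the Fourier constants named in parentheses after the functions) have the following first non-vanishing derivative $F^{(n)}(\pi/2)\neq0$: $n=2$ for $F=\cos^2$ (constants $\mathbb{I}_{jki},\overline{\mathbb{I}}_{jki},\mathbb{J}_{jki},\overline{\mathbb{J}}_{jki}$), $n=8$ for $F=\Gamma_1\cos^2$, $n=10$ for $F=\Gamma_2\cos^2$, $n=2$ for $F=\Gamma_3\cos^2$ and for $F=\Gamma_4\cos^2$ (constants $\mathbb{P}_{ajki},\overline{\mathbb{P}}_{ajki},\mathbb{Q}_{ajki},\overline{\mathbb{Q}}_{ajki}$ with $a=1,2,3,4$ respectively), and none for $F=e_0\cos^2$ (constants $\mathbb{S}_{0jki},\overline{\mathbb{S}}_{0jki}$) and for $F=e_0'/\tan$ (constant $\overline{\mathbb{H}}_{0jki}$).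
   Context: For integers $i\ge 0$ and $x\in[0,\pi/2]$ set $\omega_i:=3+2i$ and $$e_i(x):=2\frac{\sqrt{i!\,(i+2)!}}{\Gamma(i+\frac32)}\cos^3(x)\,P_i^{(\frac12,\frac32)}(\cos(2x)),$$ where $P_i^{(\alpha,\beta)}$ are the Jacobi polynomials (Szegő's normalization); $e_i'$ is the derivative of $e_i$. Let $$\Gamma_1(x):=\frac{\cos^3(x)}{\sin(x)}\int_0^x(e_0'(y))^2\tan^2(y)\,dy,\qquad \Gamma_2(x):=\omega_0^2\frac{\cos^3(x)}{\sin(x)}\int_0^x(e_0(y))^2\tan^2(y)\,dy,$$ $$\Gamma_3(x):=\int_0^x(e_0'(y))^2\sin(y)\cos(y)\,dy,\qquad \Gamma_4(x):=\omega_0^2\int_0^x(e_0(y))^2\sin(y)\cos(y)\,dy.$$ Write $g_i(x):=\int_x^{\pi/2}e_i(y)\sin(y)\cos(y)\,dy$. The Fourier constants are (for $a\in\{1,2,3,4\}$) $$\mathbb{I}_{jki}:=\int_0^{\pi/2}e_je_k\frac{e_i'}{\omega_i}\frac{\sin^3}{\cos}dx,\qquad \overline{\mathbb{I}}_{jki}:=\int_0^{\pi/2}e_je_k\,g_i\tan^2dx,$$ $$\mathbb{J}_{jki}:=\int_0^{\pi/2}\frac{e_j'}{\omega_j}\frac{e_k'}{\omega_k}\frac{e_i'}{\omega_i}\frac{\sin^3}{\cos}dx,\qquad \overline{\mathbb{J}}_{jki}:=\int_0^{\pi/2}\frac{e_j'}{\omega_j}\frac{e_k'}{\omega_k}\,g_i\tan^2dx,$$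 $$\mathbb{P}_{ajki}:=\int_0^{\pi/2}\Gamma_a\frac{e_j'}{\omega_j}\frac{e_k'}{\omega_k}\frac{e_i'}{\omega_i}\frac{\sin^3}{\cos}dx,\qquad \overline{\mathbb{P}}_{ajki}:=\int_0^{\pi/2}\Gamma_a\frac{e_j'}{\omega_j}\frac{e_k'}{\omega_k}\,g_i\tan^2dx,$$ $$\mathbb{Q}_{ajki}:=\int_0^{\pi/2}\Gamma_ae_je_k\frac{e_i'}{\omega_i}\frac{\sin^3}{\cos}dx,\qquad \overline{\mathbb{Q}}_{ajki}:=\int_0^{\pi/2}\Gamma_ae_je_k\,g_i\tan^2dx,$$ $$\mathbb{S}_{0jki}:=\int_0^{\pi/2}e_0e_je_k\frac{e_i'}{\omega_i}\frac{\sin^3}{\cos}dx,\qquad \overline{\mathbb{S}}_{0jki}:=\int_0^{\pi/2}e_0e_je_k\,g_i\tan^2dx,$$ $$\overline{\mathbb{H}}_{0jki}:=\int_0^{\pi/2}e_je_k\frac{e_i'}{\omega_i}\frac{e_0'}{\omega_0}\tan^2dx.$$ Conventions. $\omega_i\pm\omega_j\pm\omega_k$ stands for all four combinations of signs (with $\omega_i$ having sign $+$) and $\sum_\pm$ is the sum over all of them. The estimates are understood along arbitrary sequences of triples $(i,j,k)$ with all indices tending to $+\infty$; ''$\to\infty$'' for a combination means that it tends to $+\infty$ along the sequence. $\sum_\pm\mathcal{O}(f_\pm)$ denotes a quantity bounded in absolute value, for all sufficiently large indices along the sequence, by a constant (possibly depending on $N$) times $\sum_\pm|f_\pm|$. ''First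 non-vanishing derivative $F^{(n)}(\pi/2)\ne0$'' with $n=2r$ means: $F^{(2l)}(\pi/2)=F^{(2l+1)}(0)=0$ for all integers $0\le l<r$, and $F^{(n)}(\pi/2)\neq0$; ''none'' means that $F^{(2l)}(\pi/2)=F^{(2l+1)}(0)=0$ for all $l\ge0$. Values at endpoints are understood by continuous extension. *)

(* Defs.v *)
From Stdlib Require Import Reals Arith.
From Coquelicot Require Import Coquelicot.
Open Scope R_scope.

(** * Eigenmodes *)

Definition omega (i : nat) : R := 3 + 2 * INR i.

(** Euler's integral. *)
Definition EulerGamma (s : R) : R :=
  RInt_gen (fun t => Rpower t (s - 1) * exp (- t))
           (at_right 0) (Rbar_locally p_infty).

(** [a (a-1) ... (a-m+1) / m!] *)
Fixpoint gbinom (a : R) (m : nat) : R :=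
  match m with
  | O => 1
  | S m' => gbinom a m' * ((a - INR m') / INR (S m'))
  end.

(** Szegő, Orthogonal Polynomials, (4.3.2); in particular
    [jacobi n a b 1 = gbinom (n + a) n]. *)
Definition jacobi (n : nat) (a b x : R) : R :=
  sum_f_R0 (fun s => gbinom (INR n + a) (n - s) * gbinom (INR n + b) s
                     * ((x - 1) / 2) ^ s * ((x + 1) / 2) ^ (n - s)) n.

Definition e (i : nat) (x : R) : R :=
  2 * (sqrt (INR (fact i) * INR (fact (i + 2))) / EulerGamma (INR i + 3 / 2))
  * cos x ^ 3 * jacobi i (1 / 2) (3 / 2) (cos (2 * x)).

Definition e' (i : nat) : R -> R := Derive (e i).

Definition g (i : nat) (x : R) : R :=
  RInt (fun y => e i y * sin y * cos y) x (PI / 2).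

(** * The weights

    Division by zero gives zero in [R].  At [x = 0] this is also the value of
    the continuous extension of [Gamma1] and [Gamma2], and at [PI / 2] it is
    the value of the continuous extension of all the integrands below. *)

Definition Gamma1 (x : R) : R :=
  cos x ^ 3 / sin x * RInt (fun y => e' 0 y ^ 2 * tan y ^ 2) 0 x.

Definition Gamma2 (x : R) : R :=
  omega 0 ^ 2 * (cos x ^ 3 / sin x)
  * RInt (fun y => e 0 y ^ 2 * tan y ^ 2) 0 x.

Definition Gamma3 (x : R) : R :=
  RInt (fun y => e' 0 y ^ 2 * sin y * cos y) 0 x.

Definition Gamma4 (x : R) : R :=
  omega 0 ^ 2 * RInt (fun y => e 0 y ^ 2 * sin y * cos y) 0 x.

(** * Fourier constants

    The indices are in the order [j k i].  In [FP], [FPbar], [FQ], [FQbar] the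
    index [a] is replaced by the weight [G], one of [Gamma1], ..., [Gamma4]. *)

Definition FI (j k i : nat) : R :=
  RInt (fun x => e j x * e k x * (e' i x / omega i) * (sin x ^ 3 / cos x))
       0 (PI / 2).

Definition FIbar (j k i : nat) : R :=
  RInt (fun x => e j x * e k x * g i x * tan x ^ 2) 0 (PI / 2).

Definition FJ (j k i : nat) : R :=
  RInt (fun x => e' j x / omega j * (e' k x / omega k) * (e' i x / omega i)
                 * (sin x ^ 3 / cos x))
       0 (PI / 2).

Definition FJbar (j k i : nat) : R :=
  RInt (fun x => e' j x / omega j * (e' k x / omega k) * g i x * tan x ^ 2)
       0 (PI / 2).

Definition FP (G : R -> R) (j k i : nat) : R :=
  RInt (fun x => G x * (e' j x / omega j) * (e' k x / omega k)
                 * (e' i x / omega i) * (sin x ^ 3 / cos x))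
       0 (PI / 2).

Definition FPbar (G : R -> R) (j k i : nat) : R :=
  RInt (fun x => G x * (e' j x / omega j) * (e' k x / omega k) * g i x
                 * tan x ^ 2)
       0 (PI / 2).

Definition FQ (G : R -> R) (j k i : nat) : R :=
  RInt (fun x => G x * e j x * e k x * (e' i x / omega i)
                 * (sin x ^ 3 / cos x))
       0 (PI / 2).

Definition FQbar (G : R -> R) (j k i : nat) : R :=
  RInt (fun x => G x * e j x * e k x * g i x * tan x ^ 2) 0 (PI / 2).

Definition FS0 (j k i : nat) : R :=
  RInt (fun x => e 0 x * e j x * e k x * (e' i x / omega i)
                 * (sin x ^ 3 / cos x))
       0 (PI / 2).

Definition FS0bar (j k i : nat) : R :=
  RInt (fun x => e 0 x * e j x * e k x * g i x * tan x ^ 2) 0 (PI / 2).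

Definition FH0bar (j k i : nat) : R :=
  RInt (fun x => e j x * e k x * (e' i x / omega i) * (e' 0 x / omega 0)
                 * tan x ^ 2)
       0 (PI / 2).

(** * Asymptotic estimates *)

Definition pm (s : bool) (x : R) : R := if s then x else - x.

Definition comb (s t : bool) (j k i : nat) : R :=
  omega i + pm s (omega j) + pm t (omega k).

Definition sum_pm (f : R -> R) (j k i : nat) : R :=
  f (comb true true j k i) + f (comb true false j k i)
  + f (comb false true j k i) + f (comb false false j k i).

Definition tends_to_infty (u : nat -> nat) : Prop :=
  filterlim u eventually eventually.

Definition comb_diverges (s t : bool) (j k i : nat -> nat) : Prop :=
  is_lim_seq (fun n => comb s t (j n) (k n) (i n)) p_infty.

(** [X = O(B)] along every sequence of triples with indices tending to infinity
    that belongs to the class [A]; the constant does not depend on the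
    sequence. *)
Definition bigO_along (A : (nat -> nat) -> (nat -> nat) -> (nat -> nat) -> Prop)
    (X B : nat -> nat -> nat -> R) : Prop :=
  exists C : R, forall j k i : nat -> nat,
    tends_to_infty j -> tends_to_infty k -> tends_to_infty i -> A j k i ->
    eventually (fun n =>
      Rabs (X (j n) (k n) (i n)) <= C * B (j n) (k n) (i n)).

(** [X] is [O(B)] if some combination does not tend to [+oo], and is
    [O(B')] if all four combinations do. *)
Definition two_regime_estimate (X B B' : nat -> nat -> nat -> R) : Prop :=
  bigO_along (fun j k i => exists s t, ~ comb_diverges s t j k i) X B /\
  bigO_along (fun j k i => forall s t, comb_diverges s t j k i) X B'.

Definition decay (p : nat) (X : nat -> nat -> nat -> R) : Prop :=
  two_regime_estimate X
    (fun _ _ i => / omega i)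
    (fun j k i => / omega i * sum_pm (fun W => Rabs (1 / W ^ p)) j k i).

Definition div_omega (X : nat -> nat -> nat -> R) (j k i : nat) : R :=
  X j k i / omega i.

(** * Derivatives at the end points of [[0, PI / 2]]

    A function on the interval may be given by a formula that is singular at an
    end point, so its derivatives there are the one-sided limits of the
    derivatives on the open interval. *)

Definition smooth_inside (F : R -> R) : Prop :=
  forall (m : nat) (x : R), 0 < x < PI / 2 -> ex_derive_n F m x.

Definition derive_n_at_0 (F : R -> R) (n : nat) (v : R) : Prop :=
  filterlim (Derive_n F n) (at_right 0) (locally v).

Definition derive_n_at_half_PI (F : R -> R) (n : nat) (v : R) : Prop :=
  filterlim (Derive_n F n) (at_left (PI / 2)) (locally v).

Definition vanishing_at_order (F : R -> R) (l : nat) : Prop :=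
  derive_n_at_half_PI F (2 * l) 0 /\ derive_n_at_0 F (2 * l + 1) 0.

Definition first_nonvanishing_derivative (F : R -> R) (n : nat) : Prop :=
  smooth_inside F /\
  exists r : nat, n = (2 * r)%nat /\
    (forall l : nat, (l < r)%nat -> vanishing_at_order F l) /\
    exists v : R, v <> 0 /\ derive_n_at_half_PI F n v.

Definition no_nonvanishing_derivative (F : R -> R) : Prop :=
  smooth_inside F /\ forall l : nat, vanishing_at_order F l.

(* Main.v *)
Require Import Defs.
From Stdlib Require Import Reals Arith Lra Lia ZArith.
From Coquelicot Require Import Coquelicot.
Open Scope R_scope.

(** On [(0, PI / 2)], with [w = omega i], the eigenmodes are elementary:
    - [e i = amp i * (w cot x sin (w x) - cos (w x))],
    - [e' i / w = amp i * cot x * (w cos (w x) - cot x sin (w x))],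
    - [g i = amp i * (cos x ^ 2 cos (w x) + O(1 / w))],
    where [amp i = O(1 / w)] and the remainder in [g i] consists of cosines of frequency
    [w + 2] and [w - 2]. In the constants that contain [g i] the factor [amp i] accounts
    for the [1 / omega i] of the estimate.

    After multiplication by [tan x] both [e j] and [e' j / omega j] become trigonometric
    polynomials of degree [omega j]. Their low frequencies come from Dirichlet kernels:
    about [omega j] terms, each with a coefficient of order [1 / omega j]. Hence the sums
    of the absolute values of the coefficients are bounded independently of [j]
    ([bcomb_tan_e], [bcomb_tan_e']), and the product [h] of two modes is a combination,
    with bounded coefficients, of [cos (2 n x)] with [2 |n| <= omega j + omega k]. An
    estimate for one frequency [n], uniform in [n], therefore gives the estimate for
    [h], whatever the relative size of [j], [k] and [i].

    For one frequency all integrals reduce to the integrals of [F x cos (A x + phi)],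
    with a fixed smooth [F] and an integer frequency [A] not below
    [omega i - omega j - omega k], the least of the four combinations. Repeated
    integration by parts bounds them by [1 / A ^ p] ([osc_decay]). The boundary terms at
    [0] vanish by parity. At [PI / 2] the derivatives of one parity are paired with a
    sine that vanishes, and those of the other parity vanish up to the order determined
    by the weight: if the part of the weight [G] that is not odd about [PI / 2] vanishes
    there to order [q], the exponent is [p = q + 3] ([triple_product_g],
    [triple_product_e']), and the first non-vanishing derivative of [G cos ^ 2] has
    order [q + 2] ([exact_weight_first_nonvanishing]).

    It remains to find [q]. It is [0] for the constant weight, [Gamma3] and [Gamma4],
    which are positive at [PI / 2]. For [Gamma1] and [Gamma2], the integral from [0] to
    [x] is a constant minus the integral from [x] to [PI / 2]; the constant times
    [cos ^ 3 / sin] is odd about [PI / 2], and the other part vanishes to order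
    [3 + 3 = 6] and [3 + 5 = 8] respectively ([exact_weight_primitive]). The weights
    [e 0] and [cos], the latter arising from [e' 0] in [FH0bar], are odd about [PI / 2],
    so for them [q] is arbitrary. *)

(** * Euler's integral at half-integers *)

Lemma filter_prod_positive (P : R * R -> Prop) :
  (forall a b, 0 < a -> 0 < b -> P (a, b)) ->
  filter_prod (at_right 0) (Rbar_locally p_infty) P.
Proof.
  intros HP. exists (fun a => 0 < a) (fun b => 0 < b).
  - exists (mkposreal 1 Rlt_0_1). intros y _ Hy. exact Hy.
  - exists 0. intros x Hx. exact Hx.
  - exact HP.
Qed.

Lemma is_RInt_gen_half_line (f F : R -> R) (la lb : R) :
  (forall t, 0 < t -> is_derive F t (f t)) ->
  (forall t, 0 < t -> continuous f t) ->
  filterlim F (at_right 0) (locally la) ->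
  filterlim F (Rbar_locally p_infty) (locally lb) ->
  is_RInt_gen f (at_right 0) (Rbar_locally p_infty) (lb - la).
Proof.
  intros HF Hf Ha Hb.
  assert (HD : forall t, 0 < t -> Derive F t = f t).
  { intros t Ht. apply is_derive_unique, HF, Ht. }
  apply (is_RInt_gen_ext (Derive F) f).
  - apply filter_prod_positive. intros a b pa pb x [Hx _]. simpl in Hx.
    apply HD. apply Rlt_trans with (2 := Hx). apply Rmin_glb_lt; assumption.
  - apply is_RInt_gen_Derive; try assumption.
    + apply filter_prod_positive. intros a b pa pb x [Hx _]. simpl in Hx.
      exists (f x). apply HF. apply Rlt_le_trans with (2 := Hx).
      apply Rmin_glb_lt; assumption.
    + apply filter_prod_positive. intros a b pa pb x [Hx _]. simpl in Hx.
      assert (px : 0 < x).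
      { apply Rlt_le_trans with (2 := Hx). apply Rmin_glb_lt; assumption. }
      apply continuous_ext_loc with (2 := Hf x px).
      exists (mkposreal x px). intros y Hy. symmetry. apply HD.
      apply Rabs_lt_between' in Hy. simpl in Hy. lra.
Qed.

Definition euler_integrand (s t : R) : R := Rpower t (s - 1) * exp (- t).

Lemma euler_boundary_at_0 (s : R) : 0 < s ->
  filterlim (fun t => Rpower t s * exp (- t)) (at_right 0) (locally 0).
Proof.
  intros Hs.
  assert (H0 : filterlim (fun t => exp (s * ln t - t)) (at_right 0) (locally 0)).
  { apply (filterlim_comp _ _ _ (fun t => s * ln t - t) exp
             (at_right 0) (Rbar_locally m_infty) (locally 0)).
    - intros P [M HM].
      assert (Hln := is_lim_ln_0).
      assert (HQ : Rbar_locally m_infty (fun y => y < M / s)).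
      { exists (M / s). intros y Hy. exact Hy. }
      specialize (Hln _ HQ). destruct Hln as [d Hd]. exists d.
      intros y Hy Hy0. apply HM. specialize (Hd y Hy Hy0). simpl in Hd.
      apply (Rmult_lt_compat_l s) in Hd; [|exact Hs].
      replace (s * (M / s)) with M in Hd by (field; lra). lra.
    - exact is_lim_exp_m. }
  apply filterlim_ext with (2 := H0).
  intros t. unfold Rpower. rewrite <- exp_plus. f_equal; ring.
Qed.

Lemma euler_boundary_at_infty (s : R) : 0 < s ->
  filterlim (fun t => Rpower t s * exp (- t)) (Rbar_locally p_infty) (locally 0).
Proof.
  intros Hs.
  assert (H0 : filterlim (fun t => exp (s * ln t - t)) (Rbar_locally p_infty) (locally 0)).
  { apply (filterlim_comp _ _ _ (fun t => s * ln t - t) exp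
             (Rbar_locally p_infty) (Rbar_locally m_infty) (locally 0)).
    - intros P [M HM].
      exists (Rmax 0 (2 * (s * ln (2 * s) - M))). intros t Ht. apply HM.
      assert (H1 := Rmax_l 0 (2 * (s * ln (2 * s) - M))).
      assert (H2 := Rmax_r 0 (2 * (s * ln (2 * s) - M))).
      assert (pt : 0 < t / (2 * s)).
      { apply Rdiv_lt_0_compat; lra. }
      (* the tangent of [ln] at [2 s] makes [s ln t] at most [t / 2 + O(1)] *)
      assert (Hln : ln (t / (2 * s)) <= t / (2 * s) - 1).
      { assert (He := exp_ineq1_le (ln (t / (2 * s)))).
        rewrite exp_ln in He by exact pt. lra. }
      unfold Rdiv in Hln. rewrite ln_mult in Hln; [|lra|apply Rinv_0_lt_compat; lra].
      rewrite ln_Rinv in Hln by lra.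
      apply (Rmult_le_compat_l s) in Hln; [|lra].
      replace (s * (t * / (2 * s) - 1)) with (t / 2 - s) in Hln by (field; lra).
      lra.
    - exact is_lim_exp_m. }
  apply filterlim_ext with (2 := H0).
  intros t. unfold Rpower. rewrite <- exp_plus. f_equal; ring.
Qed.

Lemma continuous_euler_integrand (s t : R) : 0 < t ->
  continuous (euler_integrand s) t.
Proof.
  intros Ht. apply (ex_derive_continuous (euler_integrand s)).
  unfold euler_integrand, Rpower. auto_derive. exact Ht.
Qed.

(** Integration by parts: the boundary term [- t ^ s exp (- t)] vanishes at both
    ends as soon as [0 < s]. *)
Lemma euler_integral_succ (s l : R) : 0 < s ->
  is_RInt_gen (euler_integrand s) (at_right 0) (Rbar_locally p_infty) l ->
  is_RInt_gen (euler_integrand (s + 1)) (at_right 0) (Rbar_locally p_infty) (s * l).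
Proof.
  intros Hs Hl.
  assert (HB : is_RInt_gen (fun t => s * euler_integrand s t - euler_integrand (s + 1) t)
                 (at_right 0) (Rbar_locally p_infty) (0 - 0)).
  { apply is_RInt_gen_half_line with (F := fun t => Rpower t s * exp (- t)).
    - intros t Ht. unfold euler_integrand, Rpower.
      replace (s + 1 - 1) with s by ring.
      auto_derive; [exact Ht|].
            replace ((s - 1) * ln t) with (s * ln t + - ln t) by ring.
      rewrite exp_plus, (exp_Ropp (ln t)), exp_ln by exact Ht. field. lra.
    - intros t Ht.
      apply (continuous_minus (fun t => s * euler_integrand s t)).
      + apply (continuous_scal_r s (euler_integrand s)).
        apply continuous_euler_integrand, Ht.
      + apply continuous_euler_integrand, Ht.
    - apply euler_boundary_at_0, Hs.
    - apply euler_boundary_at_infty, Hs. }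
  apply (is_RInt_gen_scal _ s) in Hl.
  assert (H := is_RInt_gen_minus _ _ _ _ Hl HB).
  replace (s * l) with (minus (scal s l) (0 - 0)).
  - apply is_RInt_gen_ext with (2 := H).
    apply filter_prod_positive. intros a b _ _ x _.
    unfold minus, plus, opp, scal; simpl; unfold mult; simpl. ring.
  - unfold minus, plus, opp, scal; simpl; unfold mult; simpl. ring.
Qed.

Lemma exists_close_to_sup (H : R -> R) (L : R) (eps : posreal) :
  (forall y, (forall b, H b <= y) -> L <= y) -> exists b, L - eps < H b.
Proof.
  intros HL.
  destruct (Classical_Prop.classic (exists b, L - eps < H b)) as [Hb|Hn]; [exact Hb|].
  exfalso. assert (L <= L - eps).
  { apply HL. intros b. apply Rnot_lt_le. intros Hb. apply Hn. exists b. exact Hb. }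
  assert (He := cond_pos eps). lra.
Qed.

(** The integrand is [sqrt t exp (- t)], which is at most [(1 + t) exp (- t)],
    so its primitive is increasing and bounded by [2]. *)
Lemma euler_integral_three_halves :
  exists G, 0 < G /\
    is_RInt_gen (euler_integrand (3 / 2)) (at_right 0) (Rbar_locally p_infty) G.
Proof.
  set (f := fun t => sqrt t * exp (- t)).
  assert (Hc : forall t, continuous f t).
  { intros t. apply (continuous_mult sqrt).
    - apply continuous_sqrt.
    - apply (ex_derive_continuous (fun t => exp (- t))). auto_derive; auto. }
  assert (Hi : forall a b, ex_RInt f a b).
  { intros a b. apply (ex_RInt_continuous f). intros z _. apply Hc. }
  assert (f0 : forall t, 0 <= f t).
  { intros t. apply Rmult_le_pos; [apply sqrt_pos|left; apply exp_pos]. }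
  set (H := RInt f 0).
  assert (HD : forall t, is_derive H t (f t)).
  { intros t. apply is_derive_RInt with (a := 0).
    - apply filter_forall. intros b. apply (RInt_correct f), Hi.
    - apply Hc. }
  assert (Hmono : forall a b, a <= b -> H a <= H b).
  { intros a b Hab. unfold H.
    rewrite <- (RInt_Chasles f 0 a b) by apply Hi.
    assert (0 <= RInt f a b).
    { apply RInt_ge_0; auto. }
    unfold plus; simpl. lra. }
  assert (Hbd : forall b, H b <= 2).
  { intros b. destruct (Rle_lt_dec b 0) as [Hb|Hb].
    - assert (Hb0 := Hmono b 0 Hb). unfold H in Hb0 at 2.
      rewrite RInt_point in Hb0. unfold zero in Hb0; simpl in Hb0. lra.
    - assert (HP : is_RInt (fun t => (1 + t) * exp (- t)) 0 b
                     (minus (- (2 + b) * exp (- b)) (- (2 + 0) * exp (- 0)))).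
      { apply (is_RInt_derive (fun t => - (2 + t) * exp (- t))).
        - intros x _. auto_derive; auto. ring.
        - intros x _. apply (ex_derive_continuous (fun t => (1 + t) * exp (- t))).
          auto_derive; auto. }
      apply Rle_trans with (RInt (fun t => (1 + t) * exp (- t)) 0 b).
      + apply RInt_le; [lra|apply Hi|eexists; exact HP|].
        intros x Hx. unfold f. apply Rmult_le_compat_r; [left; apply exp_pos|].
        assert (S0 := sqrt_sqrt x ltac:(lra)). assert (S1 := sqrt_pos x). nra.
      + rewrite (is_RInt_unique _ _ _ _ HP).
        unfold minus, plus, opp; simpl. rewrite Ropp_0, exp_0.
        assert (0 < exp (- b)) by apply exp_pos. nra. }
  destruct (completeness (fun y => exists b, y = H b)) as [L [HL1 HL2]].
  { exists 2. intros y [b ->]. apply Hbd. }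
  { exists (H 0), 0. reflexivity. }
  assert (H00 : H 0 = 0).
  { unfold H. rewrite RInt_point. reflexivity. }
  exists (L - 0). split.
  - assert (Hpos : 0 < H 1).
    { apply RInt_gt_0; [lra| |intros; apply Hc].
      intros x Hx. apply Rmult_lt_0_compat; [apply sqrt_lt_R0; lra|apply exp_pos]. }
    assert (H 1 <= L) by (apply HL1; exists 1; reflexivity). lra.
  - apply is_RInt_gen_half_line with (F := H).
    + intros t Ht. replace (euler_integrand (3 / 2) t) with (f t); [apply HD|].
      unfold euler_integrand, f. replace (3 / 2 - 1) with (/ 2) by field.
      rewrite Rpower_sqrt by exact Ht. reflexivity.
    + intros t Ht. apply continuous_euler_integrand, Ht.
    + replace (locally 0) with (locally (H 0)) by (rewrite H00; reflexivity).
      intros P HP.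
      destruct (ex_derive_continuous H 0 (ex_intro _ _ (HD 0)) P HP) as [d Hd].
      exists d. intros y Hy _. exact (Hd y Hy).
    + intros P [eps HP].
      destruct (exists_close_to_sup H L eps) as [b Hb].
      { intros y Hy. apply HL2. intros z [b ->]. apply Hy. }
      exists b. intros x Hx. apply HP. apply Rabs_lt_between'.
      assert (Hx1 := Hmono b x ltac:(lra)).
      assert (H x <= L) by (apply HL1; exists x; reflexivity).
      assert (He := cond_pos eps). lra.
Qed.

(** [Gamma (m + 3 / 2) / Gamma (3 / 2)]. *)
Fixpoint half_rising (m : nat) : R :=
  match m with
  | O => 1
  | S m' => half_rising m' * (INR m' + 3 / 2)
  end.

Lemma half_rising_pos (m : nat) : 0 < half_rising m.
Proof.
  induction m as [|m IH]; simpl; [lra|].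
  assert (Hm := pos_INR m). apply Rmult_lt_0_compat; lra.
Qed.

Lemma EulerGamma_half_integers :
  0 < EulerGamma (3 / 2) /\
  forall m, EulerGamma (INR m + 3 / 2) = half_rising m * EulerGamma (3 / 2).
Proof.
  destruct euler_integral_three_halves as [G [G0 HG]].
  assert (Hm : forall m, is_RInt_gen (euler_integrand (INR m + 3 / 2))
                 (at_right 0) (Rbar_locally p_infty) (half_rising m * G)).
  { induction m as [|m IH].
    - simpl. rewrite Rplus_0_l, Rmult_1_l. exact HG.
    - assert (Hm := pos_INR m). rewrite S_INR.
      replace (INR m + 1 + 3 / 2) with (INR m + 3 / 2 + 1) by ring.
      replace (half_rising (S m) * G) with ((INR m + 3 / 2) * (half_rising m * G))
        by (simpl; ring).
      apply euler_integral_succ; [lra|exact IH]. }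
  assert (HE : forall m, EulerGamma (INR m + 3 / 2) = half_rising m * G).
  { intros m. unfold EulerGamma.
    apply (is_RInt_gen_unique (V := R_CompleteNormedModule)
             (euler_integrand (INR m + 3 / 2))). apply Hm. }
  assert (HE0 : EulerGamma (3 / 2) = G).
  { assert (H0 := HE 0%nat). simpl in H0. rewrite Rplus_0_l, Rmult_1_l in H0. exact H0. }
  rewrite HE0. split; assumption.
Qed.

(** * Closed form of the eigenmodes *)

(** Pascal's triangle, continued by [0] for [k > m], so that binomial sums can be
    cut at any upper limit beyond [m]. *)
Fixpoint bin (m k : nat) : R :=
  match m, k with
  | _, O => 1
  | O, S _ => 0
  | S m', S k' => bin m' k' + bin m' (S k')
  end.

Lemma bin_gt (m k : nat) : (m < k)%nat -> bin m k = 0.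
Proof.
  revert k; induction m as [|m IH]; intros [|k] H; try lia; simpl; [reflexivity|].
  rewrite !IH by lia. ring.
Qed.

Lemma bin_fact (m k : nat) : (k <= m)%nat ->
  bin m k * (INR (fact k) * INR (fact (m - k))) = INR (fact m).
Proof.
  revert k; induction m as [|m IH]; intros k H.
  - replace k with 0%nat by lia. simpl. ring.
  - destruct k as [|k].
    + simpl bin. rewrite Nat.sub_0_r. simpl (fact 0). simpl (INR 1). ring.
    + assert (Hkm : (k <= m)%nat) by lia. assert (H1 := IH k Hkm).
      simpl bin. replace (S m - S k)%nat with (m - k)%nat by lia.
      rewrite (fact_simpl k), (fact_simpl m), !mult_INR.
      destruct (Nat.eq_dec k m) as [->|Hk].
      * rewrite (bin_gt m (S m)) by lia.
        transitivity (INR (S m) * (bin m m * (INR (fact m) * INR (fact (m - m)))));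
          [ring|rewrite H1; ring].
      * assert (H2 := IH (S k) ltac:(lia)).
        replace (m - k)%nat with (S (m - S k)) in H1 |- * by lia.
        rewrite (fact_simpl (m - S k)), mult_INR in H1 |- *.
        rewrite (fact_simpl k), mult_INR in H2.
        assert (Hm : INR (S m) = INR (S k) + INR (S (m - S k))).
        { rewrite <- plus_INR. f_equal. lia. }
        rewrite Hm, (Rmult_plus_distr_r (INR (S k))).
        rewrite <- H2 at 2. rewrite <- H1 at 1. ring.
Qed.

(** De Moivre's formula [(cos x + i sin x) ^ m = exp (i m x)] expanded by the
    binomial theorem, in real form: multiplication by [i] is a shift of the phase
    by [PI / 2]. *)
Lemma cos_multiple (m N : nat) (x phi : R) : (m <= N)%nat ->
  cos (INR m * x + phi) =
  sum_f_R0 (fun k => bin m k * cos x ^ (m - k) * sin x ^ k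
                     * cos (phi + INR k * (PI / 2))) N.
Proof.
  revert N phi; induction m as [|m IH]; intros N phi H.
  - rewrite Rmult_0_l, Rplus_0_l.
    induction N as [|N IHN].
    + simpl. rewrite Rmult_0_l, Rplus_0_r. ring.
    + rewrite tech5, <- IHN by lia. change (bin 0 (S N)) with 0. ring.
  - destruct N as [|N]; [lia|].
    replace (INR (S m) * x + phi) with (x + (INR m * x + phi))
      by (rewrite S_INR; ring).
    rewrite cos_plus.
    replace (- sin (INR m * x + phi)) with (cos (INR m * x + (phi + PI / 2))).
    2: { rewrite <- Rplus_assoc, cos_plus, cos_PI2, sin_PI2. ring. }
    replace (cos x * cos (INR m * x + phi) - sin x * sin (INR m * x + phi))
      with (cos x * cos (INR m * x + phi)
            + sin x * cos (INR m * x + (phi + PI / 2))).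
    2: { rewrite <- (Rplus_assoc _ phi), (cos_plus (INR m * x + phi) (PI / 2)), cos_PI2, sin_PI2. ring. }
    rewrite (IH (S N) phi), (IH N (phi + PI / 2)) by lia.
    rewrite !(decomp_sum _ (S N)) by lia. simpl pred.
    rewrite Rmult_plus_distr_l, !scal_sum, Rplus_assoc, <- sum_plus.
    f_equal.
    + rewrite !Nat.sub_0_r. destruct m; simpl; ring.
    + apply sum_eq. intros k Hk. simpl bin.
      replace (phi + PI / 2 + INR k * (PI / 2)) with (phi + INR (S k) * (PI / 2))
        by (rewrite S_INR; ring).
      replace (S m - S k)%nat with (m - k)%nat by lia.
      destruct (Nat.lt_ge_cases m (S k)) as [Hm|Hm].
      * rewrite (bin_gt m (S k)) by lia. simpl pow. ring.
      * replace (m - k)%nat with (S (m - S k)) by lia. simpl pow. ring.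
Qed.

Lemma sum_even_odd (f : nat -> R) (N : nat) :
  sum_f_R0 f (2 * N + 1) = sum_f_R0 (fun s => f (2 * s)%nat + f (2 * s + 1)%nat) N.
Proof.
  induction N as [|N IH]; [reflexivity|].
  replace (2 * S N + 1)%nat with (S (S (2 * N + 1))) by lia.
  rewrite !tech5, IH.
  replace (S (2 * N + 1)) with (2 * S N)%nat by lia.
  replace (S (2 * S N)) with (2 * S N + 1)%nat by lia. ring.
Qed.

Lemma cos_PI_INR (s : nat) : cos (INR s * PI) = (-1) ^ s.
Proof.
  induction s as [|s IH]; [simpl; rewrite Rmult_0_l; apply cos_0|].
  rewrite S_INR, Rmult_plus_distr_r, Rmult_1_l, neg_cos, IH. simpl. ring.
Qed.

Lemma sin_PI_INR (s : nat) : sin (INR s * PI) = 0.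
Proof.
  induction s as [|s IH]; [simpl; rewrite Rmult_0_l; apply sin_0|].
  rewrite S_INR, Rmult_plus_distr_r, Rmult_1_l, neg_sin, IH. ring.
Qed.

(** [C d/dC - 1] applied to the imaginary part of [(C + i S) ^ (2 n + 4)]; the
    weight [2 n + 2 - 2 s] is what distinguishes the parameters [(1/2, 3/2)] from
    the Chebyshev case [(1/2, 1/2)]. *)
Lemma weighted_odd_binomial_sum (n : nat) (x : R) :
  sum_f_R0 (fun s => (2 * INR n + 2 - 2 * INR s) * bin (2 * n + 4) (2 * s + 1)
      * cos x ^ (2 * n + 3 - 2 * s) * sin x ^ (2 * s + 1) * (-1) ^ s) n
  = omega n * cos x * sin (omega n * x) - sin x * cos (omega n * x).
Proof.
  set (m := (2 * n + 4)%nat).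
  assert (Hm : INR m = omega n + 1).
  { unfold m, omega. rewrite plus_INR, mult_INR. simpl. ring. }
  assert (Hm1 : INR (m - 1) = omega n).
  { rewrite minus_INR by (unfold m; lia). rewrite Hm. simpl. ring. }
  (* [k]-th coefficient, phase [- PI / 2] turning cosines into sines *)
  set (t := fun k => bin m k * cos x ^ (m - k) * sin x ^ k
                     * cos (- (PI / 2) + INR k * (PI / 2))).
  assert (H1 : sin (INR m * x) = sum_f_R0 t m).
  { unfold t. rewrite <- cos_multiple by lia.
    rewrite <- cos_shift. rewrite <- cos_neg. f_equal. ring. }
  assert (H2 : INR m * cos x * sin (INR (m - 1) * x)
               = sum_f_R0 (fun k => (INR m - INR k) * t k) m).
  { assert (HSm : S (m - 1) = m) by (unfold m; lia).
    assert (Htop : forall f, sum_f_R0 f m = sum_f_R0 f (m - 1) + f m).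
    { intros f. rewrite <- HSm at 1. rewrite tech5, HSm. reflexivity. }
    rewrite Htop, Rminus_diag, Rmult_0_l, Rplus_0_r.
    replace (sin (INR (m - 1) * x)) with (cos (INR (m - 1) * x + - (PI / 2))).
    2: { rewrite <- cos_shift. rewrite <- cos_neg. f_equal. ring. }
    rewrite (cos_multiple (m - 1) (m - 1)) by lia.
    rewrite scal_sum. apply sum_eq. intros k Hk. unfold t.
    assert (Hb : (INR m - INR k) * bin m k = INR m * bin (m - 1) k).
    { assert (B1 := bin_fact m k ltac:(lia)).
      assert (B2 := bin_fact (m - 1) k ltac:(lia)).
      replace (fact m) with (fact (S (m - 1))) in B1 by (f_equal; unfold m; lia).
      replace (m - k)%nat with (S (m - 1 - k)) in B1 by lia.
      rewrite !fact_simpl, !mult_INR in B1.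
      replace (S (m - 1)) with m in B1 by (unfold m; lia).
      rewrite <- B2 in B1.
      replace (INR (S (m - 1 - k))) with (INR m - INR k) in B1.
      2: { rewrite <- minus_INR by lia. f_equal. lia. }
      assert (F1 := INR_fact_neq_0 k). assert (F2 := INR_fact_neq_0 (m - 1 - k)).
      apply Rmult_eq_reg_r with (INR (fact k) * INR (fact (m - 1 - k))).
      - rewrite Rmult_assoc. rewrite Rmult_assoc. rewrite <- B1. ring.
      - apply Rmult_integral_contrapositive; split; assumption. }
    replace (m - k)%nat with (S (m - 1 - k)) by lia. simpl pow.
    rewrite <- !Rmult_assoc, Hb. ring. }
  assert (H3 : omega n * cos x * sin (omega n * x) - sin x * cos (omega n * x)
               = sum_f_R0 (fun k => (INR m - INR k - 1) * t k) m).
  { transitivity (INR m * cos x * sin (INR (m - 1) * x) - sin (INR m * x)).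
    - rewrite Hm1, Hm, (Rmult_plus_distr_r (omega n) 1 x), (Rmult_1_l x), sin_plus. ring.
    - rewrite H1, H2, <- minus_sum. apply sum_eq. intros k _. ring. }
  rewrite H3.
  assert (HSm : S (2 * S n + 1) = m) by (unfold m; lia).
  assert (Htop : forall f, sum_f_R0 f m = sum_f_R0 f (2 * S n + 1) + f m).
  { intros f. rewrite <- HSm at 1. rewrite tech5, HSm. reflexivity. }
  rewrite Htop, sum_even_odd, tech5.
  assert (Heven : forall s, t (2 * s)%nat = 0).
  { intros s. unfold t.
    replace (- (PI / 2) + INR (2 * s) * (PI / 2)) with (INR s * PI - PI / 2)
      by (rewrite mult_INR; simpl; field).
    rewrite cos_minus, cos_PI2, sin_PI2, sin_PI_INR. ring. }
  replace (t m) with (t (2 * (n + 2))%nat) by (f_equal; unfold m; lia).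
  rewrite !Heven.
  replace (INR m - INR (2 * S n + 1) - 1) with 0.
  2: { rewrite Hm. unfold omega. rewrite plus_INR, mult_INR, (S_INR n). simpl. ring. }
  rewrite !Rmult_0_r, Rmult_0_l, !Rplus_0_r.
  apply sum_eq. intros s Hs. rewrite Heven. unfold t.
  replace (- (PI / 2) + INR (2 * s + 1) * (PI / 2)) with (INR s * PI)
    by (rewrite plus_INR, mult_INR; simpl; field).
  rewrite cos_PI_INR, Hm.
  replace (m - (2 * s + 1))%nat with (2 * n + 3 - 2 * s)%nat by (unfold m; lia).
  unfold omega. rewrite plus_INR, mult_INR. simpl INR. ring.
Qed.

Lemma half_rising_fact (s : nat) :
  half_rising s * INR (fact s) * 4 ^ s = INR (fact (2 * s + 1)).
Proof.
  induction s as [|s IH]; [simpl; ring|].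
  replace (2 * S s + 1)%nat with (S (S (2 * s + 1))) by lia.
  rewrite (fact_simpl (S _)), (fact_simpl (2 * s + 1)), (fact_simpl s), !mult_INR, <- IH.
  rewrite !S_INR, plus_INR, mult_INR. simpl. ring_simplify.
  field.
Qed.

Lemma gbinom_half (N m : nat) : (m <= N)%nat ->
  gbinom (INR N + 1 / 2) m * (half_rising (N - m) * INR (fact m)) = half_rising N.
Proof.
  induction m as [|m IH]; intros H.
  - rewrite Nat.sub_0_r. simpl. ring.
  - rewrite <- IH by lia.
    change (gbinom (INR N + 1 / 2) (S m))
      with (gbinom (INR N + 1 / 2) m * ((INR N + 1 / 2 - INR m) / INR (S m))).
    replace (N - m)%nat with (S (N - S m)) by lia.
    change (half_rising (S (N - S m)))
      with (half_rising (N - S m) * (INR (N - S m) + 3 / 2)).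
    rewrite fact_simpl, mult_INR.
    assert (HS : INR (S m) <> 0) by (apply not_0_INR; lia).
    replace (INR (N - S m)) with (INR N - INR m - 1)
      by (rewrite minus_INR, S_INR by lia; ring).
    replace (INR (S m)) with (INR m + 1) in * by (rewrite S_INR; ring).
    field. exact HS.
Qed.

(** This is [1 / (Gamma (3 / 2) * sqrt (omega i ^ 2 - 1))], because
    [omega i ^ 2 - 1 = 4 (i + 1) (i + 2)]. *)
Definition amp (i : nat) : R :=
  sqrt ((INR i + 1) * (INR i + 2))
  / (2 * (INR i + 1) * (INR i + 2) * EulerGamma (3 / 2)).

(** With [(cos (2 x) - 1) / 2 = - sin x ^ 2] and [(cos (2 x) + 1) / 2 = cos x ^ 2] the
    sum defining the Jacobi polynomial becomes homogeneous in [cos x] and [sin x]; up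
    to a constant, its half-integral binomial coefficients multiply to
    [(n + 1 - s)] times the binomial coefficient of [2 n + 4] over [2 s + 1]. *)
Lemma jacobi_closed_form (n : nat) (x : R) :
  sin x * (cos x ^ 3 * jacobi n (1 / 2) (3 / 2) (cos (2 * x)))
  = half_rising n * half_rising (S n) * 4 ^ S n / (2 * INR (fact (2 * n + 4)))
    * (omega n * cos x * sin (omega n * x) - sin x * cos (omega n * x)).
Proof.
  rewrite <- weighted_odd_binomial_sum. unfold jacobi.
  rewrite <- Rmult_assoc, !scal_sum. apply sum_eq. intros s Hs.
  replace ((cos (2 * x) - 1) / 2) with (- 1 * sin x ^ 2)
    by (rewrite cos_2a_sin; simpl; field).
  replace ((cos (2 * x) + 1) / 2) with (cos x ^ 2)
    by (rewrite cos_2a_cos; simpl; field).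
  rewrite Rpow_mult_distr, <- !pow_mult.
  replace (2 * n + 3 - 2 * s)%nat with (3 + 2 * (n - s))%nat by lia.
  rewrite !pow_add, pow_1.
  replace (INR n + 3 / 2) with (INR (S n) + 1 / 2) by (rewrite S_INR; field).
  assert (G1 := gbinom_half n (n - s) ltac:(lia)).
  assert (G2 := gbinom_half (S n) s ltac:(lia)).
  replace (n - (n - s))%nat with s in G1 by lia.
  assert (F1 := half_rising_fact s).
  assert (F2 := half_rising_fact (S n - s)).
  assert (B := bin_fact (2 * n + 4) (2 * s + 1) ltac:(lia)).
  replace (2 * n + 4 - (2 * s + 1))%nat with (2 * (S n - s) + 1)%nat in B by lia.
  replace (4 ^ S n) with (4 ^ s * 4 ^ (S n - s))
    by (rewrite <- pow_add; f_equal; lia).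
  rewrite <- F1, <- F2 in B.
  replace (S n - s)%nat with (S (n - s)) in * by lia.
  rewrite (fact_simpl (n - s)), mult_INR in B, F2.
  assert (P1 := half_rising_pos s). assert (P2 := half_rising_pos (S (n - s))).
  assert (Q1 := INR_fact_lt_0 s). assert (Q2 := INR_fact_lt_0 (n - s)).
  assert (Q3 := INR_fact_lt_0 (2 * n + 4)).
  assert (Hk : (INR (S (n - s))) = INR n - INR s + 1)
    by (rewrite S_INR, minus_INR by lia; ring).
  assert (Hk0 : 0 < INR (S (n - s))) by (apply lt_0_INR; lia).
  assert (W1 : 0 < 4 ^ s) by (apply pow_lt; lra).
  assert (W2 : 0 < 4 ^ S (n - s)) by (apply pow_lt; lra).
  rewrite <- G1, <- G2.
  set (a1 := gbinom (INR n + 1 / 2) (n - s)) in *.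
  set (a2 := gbinom (INR (S n) + 1 / 2) s) in *.
  rewrite <- B at 1.
  replace (2 * INR n + 2 - 2 * INR s) with (2 * INR (S (n - s))) by (rewrite Hk; ring).
  set (b := bin (2 * n + 4) (2 * s + 1)) in *.
  assert (b <> 0).
  { intros Hb. rewrite Hb in B. lra. }
  field. repeat split; lra.
Qed.

(** The normalising constant in the definition of [e] combines with that of the
    Jacobi polynomials to [amp i = O(1 / omega i)]. *)
Lemma e_closed_form (i : nat) (x : R) : 0 < x < PI ->
  e i x = amp i * (omega i * (cos x / sin x) * sin (omega i * x) - cos (omega i * x)).
Proof.
  intros Hx. assert (Sx : 0 < sin x) by (apply sin_gt_0; lra).
  destruct EulerGamma_half_integers as [G0 HG].
  assert (J := jacobi_closed_form i x).
  unfold e. rewrite HG.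
  assert (P0 := half_rising_pos i).
  set (K := EulerGamma (3 / 2)) in *.
  apply Rmult_eq_reg_l with (sin x); [|lra].
  rewrite !Rmult_assoc.
  transitivity (2 * (sqrt (INR (fact i) * INR (fact (i + 2))) / (half_rising i * K))
                * (sin x * (cos x ^ 3 * jacobi i (1 / 2) (3 / 2) (cos (2 * x))))); [ring|].
  rewrite J.
  transitivity (amp i * (omega i * cos x * sin (omega i * x) - sin x * cos (omega i * x)));
    [|field; lra].
  rewrite <- Rmult_assoc. f_equal.
  assert (F := half_rising_fact (S i)).
  replace (2 * S i + 1)%nat with (2 * i + 3)%nat in F by lia.
  replace (2 * i + 4)%nat with (S (2 * i + 3)) by lia.
  rewrite (fact_simpl (2 * i + 3)), mult_INR, <- F.
  replace (i + 2)%nat with (S (S i)) by lia.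
  rewrite !fact_simpl, !mult_INR.
  assert (Q := INR_fact_lt_0 i). assert (Hi := pos_INR i).
  replace (INR (S i)) with (INR i + 1) by (rewrite S_INR; ring).
  replace (INR (S (S i))) with (INR i + 2) by (rewrite !S_INR; ring).
  replace (INR (S (2 * i + 3))) with (2 * INR i + 4)
    by (rewrite S_INR, plus_INR, mult_INR; simpl; ring).
  assert (P1 := half_rising_pos (S i)).
  assert (W : 0 < 4 ^ S i) by (apply pow_lt; lra).
  replace (INR (fact i) * ((INR i + 2) * ((INR i + 1) * INR (fact i))))
    with (INR (fact i) ^ 2 * ((INR i + 1) * (INR i + 2))) by ring.
  rewrite sqrt_mult by nra. rewrite sqrt_pow2 by lra.
  unfold amp. fold K.
  field. repeat split; lra.
Qed.

Lemma amp_bounds (i : nat) :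
  0 < amp i /\ amp i * omega i <= 3 / (2 * EulerGamma (3 / 2)).
Proof.
  destruct EulerGamma_half_integers as [G0 _].
  assert (Hi := pos_INR i). unfold amp, omega.
  set (K := EulerGamma (3 / 2)) in *. set (a := INR i) in *.
  assert (S0 : 0 < sqrt ((a + 1) * (a + 2))) by (apply sqrt_lt_R0; nra).
  assert (D0 : 0 < 2 * (a + 1) * (a + 2) * K).
  { repeat apply Rmult_lt_0_compat; lra. }
  split.
  - apply Rdiv_lt_0_compat; assumption.
  - assert (S1 : sqrt ((a + 1) * (a + 2)) <= a + 2).
    { rewrite <- (sqrt_pow2 (a + 2)) at 2 by lra. apply sqrt_le_1_alt. nra. }
    apply Rle_trans with ((a + 2) / (2 * (a + 1) * (a + 2) * K) * (3 * (a + 1))).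
    + apply Rmult_le_compat; [left; apply Rdiv_lt_0_compat; assumption|lra| |lra].
      apply Rmult_le_compat_r; [left; apply Rinv_0_lt_compat; exact D0|exact S1].
    + right. field. repeat split; lra.
Qed.

(** * Smooth functions on an open interval *)

(** The derivative is existentially quantified rather than given by [Derive], so that
    it may be any formula correct on the interval; this keeps the closure properties
    below to one induction each. *)
Fixpoint differentiable_n (a b : R) (n : nat) (f : R -> R) : Prop :=
  match n with
  | O => True
  | S m => exists f', (forall x, a < x < b -> is_derive f x (f' x)) /\
                      differentiable_n a b m f'
  end.

Definition smooth (a b : R) (f : R -> R) : Prop :=
  forall n, differentiable_n a b n f.

Lemma locally_of_interval (a b x : R) (P : R -> Prop) :
  a < x < b -> (forall y, a < y < b -> P y) -> locally x P.
Proof.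
  intros Hx HP.
  apply (locally_interval P x a b); simpl; [apply Hx|apply Hx|].
  intros y H1 H2. apply HP. split; assumption.
Qed.

Lemma differentiable_n_ext (a b : R) (n : nat) (f g : R -> R) :
  (forall x, a < x < b -> f x = g x) ->
  differentiable_n a b n f -> differentiable_n a b n g.
Proof.
  intros H. destruct n as [|n]; [trivial|].
  intros [f' [Hf Hn]]. exists f'. split; [|exact Hn].
  intros x Hx. apply is_derive_ext_loc with f; [|apply Hf, Hx].
  apply (locally_of_interval a b); assumption.
Qed.

Lemma differentiable_n_pred (a b : R) (n : nat) (f : R -> R) :
  differentiable_n a b (S n) f -> differentiable_n a b n f.
Proof.
  revert f; induction n as [|n IH]; intros f [f' [Hf Hn]]; [exact I|].
  exists f'. split; [exact Hf|]. apply IH, Hn.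
Qed.

Lemma smooth_ext (a b : R) (f g : R -> R) :
  (forall x, a < x < b -> f x = g x) -> smooth a b f -> smooth a b g.
Proof. intros H Hf n. apply (differentiable_n_ext a b n f g H), Hf. Qed.

Lemma smooth_sub (a b a' b' : R) (f : R -> R) :
  a <= a' -> b' <= b -> smooth a b f -> smooth a' b' f.
Proof.
  intros Ha Hb Hf n. specialize (Hf n). revert f Hf.
  induction n as [|n IH]; [trivial|]. intros f [f' [Hf Hn]].
  exists f'. split; [|apply IH, Hn].
  intros x Hx. apply Hf. lra.
Qed.

Lemma smooth_is_derive (a b : R) (f : R -> R) (x : R) :
  smooth a b f -> a < x < b -> is_derive f x (Derive f x).
Proof.
  intros Hf Hx. destruct (Hf 1%nat) as [f' [H _]].
  apply Derive_correct. exists (f' x). apply H, Hx.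
Qed.

Lemma smooth_Derive (a b : R) (f : R -> R) : smooth a b f -> smooth a b (Derive f).
Proof.
  intros Hf n. destruct (Hf (S n)) as [f' [H Hn]].
  apply differentiable_n_ext with f'; [|exact Hn].
  intros x Hx. symmetry. apply is_derive_unique, H, Hx.
Qed.

(** Meant for families stable under differentiation, such as the shifted sines and the
    entire power series. *)
Lemma smooth_coind (a b : R) (P : (R -> R) -> Prop) :
  (forall f, P f -> exists f', P f' /\ forall x, a < x < b -> is_derive f x (f' x)) ->
  forall f, P f -> smooth a b f.
Proof.
  intros H f Pf n. revert f Pf. induction n as [|n IH]; intros f Pf; [exact I|].
  destruct (H f Pf) as [f' [Pf' Hd]]. exists f'. split; [exact Hd|apply IH, Pf'].
Qed.

Lemma smooth_continuous (a b : R) (f : R -> R) (x : R) :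
  smooth a b f -> a < x < b -> continuous f x.
Proof.
  intros Hf Hx. apply (ex_derive_continuous f).
  eexists. apply (smooth_is_derive a b); assumption.
Qed.

Lemma smooth_const (a b c : R) : smooth a b (fun _ => c).
Proof.
  apply (smooth_coind a b (fun f => exists c, f = fun _ => c)); [|eexists; reflexivity].
  intros f [d ->]. exists (fun _ => 0). split; [eexists; reflexivity|].
  intros x _. apply (is_derive_const d).
Qed.

Lemma smooth_id (a b : R) : smooth a b (fun x => x).
Proof.
  intros [|n]; [exact I|]. exists (fun _ => 1). split.
  - intros x _. apply (is_derive_id x).
  - apply smooth_const.
Qed.

Lemma differentiable_n_plus (a b : R) (n : nat) (f g : R -> R) :
  differentiable_n a b n f -> differentiable_n a b n g ->
  differentiable_n a b n (fun x => f x + g x).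
Proof.
  revert f g. induction n as [|n IH]; [trivial|].
  intros f g [f' [Hf Hnf]] [g' [Hg Hng]].
  exists (fun x => f' x + g' x). split; [|apply IH; assumption].
  intros x Hx. apply (is_derive_plus f g); [apply Hf|apply Hg]; exact Hx.
Qed.

Lemma differentiable_n_mult (a b : R) (n : nat) (f g : R -> R) :
  differentiable_n a b n f -> differentiable_n a b n g ->
  differentiable_n a b n (fun x => f x * g x).
Proof.
  revert f g. induction n as [|n IH]; [trivial|].
  intros f g Hf Hg. assert (Hf1 := differentiable_n_pred _ _ _ _ Hf).
  assert (Hg1 := differentiable_n_pred _ _ _ _ Hg).
  destruct Hf as [f' [Hf Hnf]]. destruct Hg as [g' [Hg Hng]].
  exists (fun x => f' x * g x + f x * g' x). split.
  - intros x Hx. apply (is_derive_mult f g); [apply Hf, Hx|apply Hg, Hx|].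
    intros; apply Rmult_comm.
  - apply differentiable_n_plus; apply IH; assumption.
Qed.

Lemma smooth_plus (a b : R) (f g : R -> R) :
  smooth a b f -> smooth a b g -> smooth a b (fun x => f x + g x).
Proof. intros Hf Hg n. apply differentiable_n_plus; [apply Hf|apply Hg]. Qed.

Lemma smooth_mult (a b : R) (f g : R -> R) :
  smooth a b f -> smooth a b g -> smooth a b (fun x => f x * g x).
Proof. intros Hf Hg n. apply differentiable_n_mult; [apply Hf|apply Hg]. Qed.

Lemma smooth_scal (a b c : R) (f : R -> R) :
  smooth a b f -> smooth a b (fun x => c * f x).
Proof. apply (smooth_mult a b (fun _ => c)), smooth_const. Qed.

Lemma smooth_opp (a b : R) (f : R -> R) : smooth a b f -> smooth a b (fun x => - f x).
Proof.
  intros Hf. apply smooth_ext with (fun x => -1 * f x); [intros; ring|].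
  apply smooth_scal, Hf.
Qed.

Lemma smooth_minus (a b : R) (f g : R -> R) :
  smooth a b f -> smooth a b g -> smooth a b (fun x => f x - g x).
Proof. intros Hf Hg. apply (smooth_plus a b f), smooth_opp; assumption. Qed.

Lemma smooth_pow (a b : R) (f : R -> R) (m : nat) :
  smooth a b f -> smooth a b (fun x => f x ^ m).
Proof.
  intros Hf. induction m as [|m IH]; [apply (smooth_const a b 1)|].
  apply (smooth_mult a b f); assumption.
Qed.

(** [1 / f] has the derivative [- f' (1 / f) (1 / f)], whose last two factors fall under
    the induction hypothesis. *)
Lemma smooth_inv (a b : R) (f : R -> R) :
  (forall x, a < x < b -> f x <> 0) -> smooth a b f -> smooth a b (fun x => / f x).
Proof.
  intros H0 Hf. intros n. induction n as [|n IH]; [exact I|].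
  exists (fun x => - Derive f x * (/ f x * / f x)). split.
  - intros x Hx. assert (Hfx := H0 x Hx). evar_last.
    + apply is_derive_inv; [apply (smooth_is_derive a b); assumption|exact Hfx].
    + simpl. field. exact Hfx.
  - apply differentiable_n_mult; [|apply differentiable_n_mult; exact IH].
    apply smooth_opp, smooth_Derive, Hf.
Qed.

Lemma smooth_div (a b : R) (f g : R -> R) :
  (forall x, a < x < b -> g x <> 0) ->
  smooth a b f -> smooth a b g -> smooth a b (fun x => f x / g x).
Proof.
  intros H Hf Hg. apply (smooth_mult a b f (fun x => / g x)); [exact Hf|].
  apply smooth_inv; assumption.
Qed.

Lemma smooth_comp (a b c d : R) (f g : R -> R) :
  (forall x, a < x < b -> c < g x < d) ->
  smooth c d f -> smooth a b g -> smooth a b (fun x => f (g x)).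
Proof.
  intros H Hf Hg n. revert f Hf. induction n as [|n IH]; [intros; exact I|].
  intros f Hf. exists (fun x => Derive g x * Derive f (g x)). split.
  - intros x Hx. apply (is_derive_comp f g).
    + apply (smooth_is_derive c d); [exact Hf|apply H, Hx].
    + apply (smooth_is_derive a b); assumption.
  - apply differentiable_n_mult; [apply smooth_Derive, Hg|].
    apply IH, smooth_Derive, Hf.
Qed.

Lemma smooth_sin_phase (a b phi : R) : smooth a b (fun x => sin (x + phi)).
Proof.
  apply (smooth_coind a b (fun f => exists phi, f = fun x => sin (x + phi)));
    [|eexists; reflexivity].
  intros f [psi ->]. exists (fun x => sin (x + (psi + PI / 2))).
  split; [eexists; reflexivity|]. intros x _.
  rewrite <- Rplus_assoc, sin_plus, cos_PI2, sin_PI2. auto_derive; auto. ring.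
Qed.

Lemma smooth_sin (a b : R) : smooth a b sin.
Proof.
  apply smooth_ext with (2 := smooth_sin_phase a b 0).
  intros x _. rewrite Rplus_0_r. reflexivity.
Qed.

Lemma smooth_cos (a b : R) : smooth a b cos.
Proof.
  apply smooth_ext with (2 := smooth_sin_phase a b (PI / 2)).
  intros x _. rewrite sin_plus, cos_PI2, sin_PI2. ring.
Qed.

Lemma smooth_PSeries (a b : R) (u : nat -> R) :
  CV_radius u = p_infty -> smooth a b (PSeries u).
Proof.
  intros Hu.
  apply (smooth_coind a b (fun f => exists u, CV_radius u = p_infty /\ f = PSeries u));
    [|exists u; auto].
  intros f [v [Hv ->]]. exists (PSeries (PS_derive v)). split.
  - exists (PS_derive v). rewrite CV_radius_derive. auto.
  - intros x _. apply is_derive_PSeries. rewrite Hv. exact I.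
Qed.

(** ** Higher derivatives *)

Lemma Derive_n_Derive (f : R -> R) (n : nat) (x : R) :
  Derive_n f (S n) x = Derive_n (Derive f) n x.
Proof.
  revert x. induction n as [|n IH]; intros x; [reflexivity|].
  simpl. apply Derive_ext. intros y. exact (IH y).
Qed.

Lemma smooth_Derive_n (a b : R) (f : R -> R) (n : nat) :
  smooth a b f -> smooth a b (Derive_n f n).
Proof.
  intros Hf. induction n as [|n IH]; [exact Hf|]. apply smooth_Derive, IH.
Qed.

Lemma smooth_ex_derive_n (a b : R) (f : R -> R) (n : nat) (x : R) :
  smooth a b f -> a < x < b -> ex_derive_n f n x.
Proof.
  intros Hf Hx. destruct n as [|n]; [exact I|]. simpl.
  eexists. apply (smooth_is_derive a b); [apply smooth_Derive_n, Hf|exact Hx].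
Qed.

Lemma Derive_n_ext_interval (a b : R) (f g : R -> R) (n : nat) (x : R) :
  (forall y, a < y < b -> f y = g y) -> a < x < b -> Derive_n f n x = Derive_n g n x.
Proof.
  intros H Hx. apply Derive_n_ext_loc. apply (locally_of_interval a b); assumption.
Qed.

Lemma Derive_n_plus_smooth (a b : R) (f g : R -> R) (n : nat) (x : R) :
  smooth a b f -> smooth a b g -> a < x < b ->
  Derive_n (fun x => f x + g x) n x = Derive_n f n x + Derive_n g n x.
Proof.
  intros Hf Hg Hx.
  apply Derive_n_plus; apply (locally_of_interval a b); auto;
    intros y Hy k _; apply (smooth_ex_derive_n a b); assumption.
Qed.

(** A function that is even ([sigma = 1]) or odd ([sigma = -1]) about [c] has
    a derivative of the opposite parity, so every second derivative vanishes. *)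
Lemma Derive_n_parity (c d sigma : R) (f : R -> R) (n : nat) :
  0 < d -> smooth (c - d) (c + d) f ->
  (forall x, c - d < x < c + d -> f (2 * c - x) = sigma * f x) ->
  sigma * (-1) ^ n = -1 -> Derive_n f n c = 0.
Proof.
  intros Hd. revert sigma f. induction n as [|n IH]; intros sigma f Hf Hp Hs.
  - simpl in *. assert (H := Hp c ltac:(lra)).
    replace (2 * c - c) with c in H by ring.
    replace sigma with (-1) in H by lra. lra.
  - rewrite Derive_n_Derive. apply (IH (- sigma)).
    + apply smooth_Derive, Hf.
    + intros x Hx.
      assert (H : is_derive (fun y => f (2 * c - y)) x (- Derive f (2 * c - x))).
      { evar_last.
        - apply (is_derive_comp f (fun y => 2 * c - y)).
          + apply (smooth_is_derive (c - d) (c + d)); [exact Hf|lra].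
          + instantiate (1 := -1). auto_derive; auto; ring.
        - unfold scal; simpl. unfold mult; simpl. ring. }
      assert (H' : is_derive (fun y => f (2 * c - y)) x (sigma * Derive f x)).
      { apply is_derive_ext_loc with (fun y => sigma * f y).
        - apply (locally_of_interval (c - d) (c + d)); [exact Hx|].
          intros y Hy. symmetry. apply Hp, Hy.
        - apply is_derive_scal. apply (smooth_is_derive (c - d) (c + d)); assumption. }
      apply is_derive_unique in H. apply is_derive_unique in H'. lra.
    + simpl in Hs. lra.
Qed.

(** ** Order of vanishing *)

Fixpoint vanish (n : nat) (f : R -> R) (c : R) : Prop :=
  match n with
  | O => True
  | S m => f c = 0 /\ vanish m (Derive f) c
  end.

(** Vanishing to the exact order [n], with [(-1) ^ n] times the [n]-th derivative
    positive, which is what a function positive to the left of [c] satisfies. *)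
Fixpoint lead (n : nat) (f : R -> R) (c : R) : Prop :=
  match n with
  | O => 0 < f c
  | S m => f c = 0 /\ lead m (fun x => - Derive f x) c
  end.

Lemma vanish_ext (a b c : R) (n : nat) (f g : R -> R) :
  a < c < b -> (forall x, a < x < b -> f x = g x) -> vanish n f c -> vanish n g c.
Proof.
  intros Hc. revert f g. induction n as [|n IH]; intros f g H; [trivial|].
  intros [H0 Hn]. split; [rewrite <- H by exact Hc; exact H0|].
  apply IH with (Derive f); [|exact Hn].
  intros x Hx. apply Derive_ext_loc. apply (locally_of_interval a b); assumption.
Qed.

Lemma lead_ext (a b c : R) (n : nat) (f g : R -> R) :
  a < c < b -> (forall x, a < x < b -> f x = g x) -> lead n f c -> lead n g c.
Proof.
  intros Hc. revert f g. induction n as [|n IH]; intros f g H.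
  { simpl. rewrite H by exact Hc. trivial. }
  intros [H0 Hn]. split; [rewrite <- H by exact Hc; exact H0|].
  apply IH with (2 := Hn).
  intros x Hx. f_equal. apply Derive_ext_loc. apply (locally_of_interval a b); assumption.
Qed.

Lemma vanish_Derive_n (n l : nat) (f : R -> R) (c : R) :
  vanish n f c -> (l < n)%nat -> Derive_n f l c = 0.
Proof.
  revert f l; induction n as [|n IH]; intros f l H Hl; [lia|].
  destruct H as [H0 Hn]. destruct l as [|l]; [exact H0|].
  rewrite Derive_n_Derive. apply IH; [exact Hn|lia].
Qed.

Lemma vanish_pred (n : nat) (f : R -> R) (c : R) : vanish (S n) f c -> vanish n f c.
Proof.
  revert f; induction n as [|n IH]; intros f [H0 Hn]; [exact I|].
  split; [exact H0|]. apply IH, Hn.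
Qed.

Lemma vanish_zero (n : nat) (c : R) : vanish n (fun _ => 0) c.
Proof.
  induction n as [|n IH]; [exact I|]. split; [reflexivity|].
  apply (vanish_ext (c - 1) (c + 1)) with (fun _ => 0); [lra| |exact IH].
  intros x _. rewrite Derive_const. reflexivity.
Qed.

Section Order_at_point.

Context (a b c : R) (Hc : a < c < b).

Lemma Derive_plus_smooth (f g : R -> R) (x : R) :
  smooth a b f -> smooth a b g -> a < x < b ->
  Derive (fun x => f x + g x) x = Derive f x + Derive g x.
Proof.
  intros Hf Hg Hx.
  apply Derive_plus; eexists; apply (smooth_is_derive a b); assumption.
Qed.

Lemma Derive_mult_smooth (f g : R -> R) (x : R) :
  smooth a b f -> smooth a b g -> a < x < b ->
  Derive (fun x => f x * g x) x = Derive f x * g x + f x * Derive g x.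
Proof.
  intros Hf Hg Hx.
  apply Derive_mult; eexists; apply (smooth_is_derive a b); assumption.
Qed.

Lemma vanish_plus (n : nat) (f g : R -> R) :
  smooth a b f -> smooth a b g ->
  vanish n f c -> vanish n g c -> vanish n (fun x => f x + g x) c.
Proof.
  revert f g; induction n as [|n IH]; intros f g Hf Hg; [trivial|].
  intros [Hf0 Hfn] [Hg0 Hgn]. split; [lra|].
  apply (vanish_ext a b) with (fun x => Derive f x + Derive g x); [exact Hc| |].
  - intros x Hx. symmetry. apply Derive_plus_smooth; assumption.
  - apply IH; try apply smooth_Derive; assumption.
Qed.

(** Orders of vanishing add, by induction along the Leibniz rule. *)
Lemma vanish_mult (m n : nat) (f g : R -> R) :
  smooth a b f -> smooth a b g ->
  vanish m f c -> vanish n g c -> vanish (m + n) (fun x => f x * g x) c.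
Proof.
  remember (m + n)%nat as k eqn:Hk.
  revert m n f g Hk; induction k as [|k IH]; intros m n f g Hk Hf Hg Vf Vg; [exact I|].
  assert (Hf' := smooth_Derive _ _ _ Hf). assert (Hg' := smooth_Derive _ _ _ Hg).
  split.
  - destruct m as [|m].
    + destruct n as [|n]; [lia|]. destruct Vg as [-> _]. ring.
    + destruct Vf as [-> _]. ring.
  - apply (vanish_ext a b) with (fun x => Derive f x * g x + f x * Derive g x);
      [exact Hc| |].
    { intros x Hx. symmetry. apply Derive_mult_smooth; assumption. }
    apply vanish_plus; try (apply smooth_mult; assumption).
    + destruct m as [|m].
      * destruct n as [|n]; [lia|]. apply (IH 0%nat n); try assumption; try lia; try exact I.
        apply vanish_pred, Vg.
      * apply (IH m n); try assumption; try lia; apply Vf.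
    + destruct n as [|n].
      * destruct m as [|m]; [lia|]. apply (IH m 0%nat); try assumption; try lia; try exact I.
        apply vanish_pred, Vf.
      * apply (IH m n); try assumption; try lia; apply Vg.
Qed.

Lemma lead_plus_vanish (n : nat) (f g : R -> R) :
  smooth a b f -> smooth a b g ->
  lead n f c -> vanish (S n) g c -> lead n (fun x => f x + g x) c.
Proof.
  revert f g; induction n as [|n IH]; intros f g Hf Hg.
  - simpl. intros H [-> _]. lra.
  - intros [Hf0 Hfn] [Hg0 Hgn]. split; [lra|].
    apply (lead_ext a b) with (fun x => - Derive f x + -1 * Derive g x); [exact Hc| |].
    + intros x Hx. rewrite Derive_plus_smooth by assumption. ring.
    + apply IH.
      * apply smooth_opp, smooth_Derive, Hf.
      * apply smooth_scal, smooth_Derive, Hg.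
      * exact Hfn.
      * apply (vanish_mult 0 (S n) (fun _ => -1));
          [apply smooth_const|apply smooth_Derive, Hg|exact I|exact Hgn].
Qed.

Lemma lead_plus (n : nat) (f g : R -> R) :
  smooth a b f -> smooth a b g ->
  lead n f c -> lead n g c -> lead n (fun x => f x + g x) c.
Proof.
  revert f g; induction n as [|n IH]; intros f g Hf Hg.
  - simpl. lra.
  - intros [Hf0 Hfn] [Hg0 Hgn]. split; [lra|].
    apply (lead_ext a b) with (fun x => - Derive f x + - Derive g x); [exact Hc| |].
    + intros x Hx. rewrite Derive_plus_smooth by assumption. ring.
    + apply IH; try apply smooth_opp, smooth_Derive; assumption.
Qed.

Lemma lead_vanish (n : nat) (f : R -> R) : smooth a b f -> lead n f c -> vanish n f c.
Proof.
  revert f; induction n as [|n IH]; intros f Hf; [intros; exact I|].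
  intros [H0 Hn]. split; [exact H0|].
  assert (H : vanish n (fun x => -1 * - Derive f x) c).
  { apply (vanish_mult 0 n (fun _ => -1)); [apply smooth_const| |exact I|].
    - apply smooth_opp, smooth_Derive, Hf.
    - apply IH; [apply smooth_opp, smooth_Derive, Hf|exact Hn]. }
  apply (vanish_ext a b) with (3 := H); [exact Hc|]. intros x _. ring.
Qed.

Lemma lead_mult (m n : nat) (f g : R -> R) :
  smooth a b f -> smooth a b g ->
  lead m f c -> lead n g c -> lead (m + n) (fun x => f x * g x) c.
Proof.
  remember (m + n)%nat as k eqn:Hk.
  revert m n f g Hk; induction k as [|k IH]; intros m n f g Hk Hf Hg Vf Vg.
  { replace m with 0%nat in * by lia. replace n with 0%nat in * by lia.
    simpl in *. apply Rmult_lt_0_compat; assumption. }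
  assert (Hf' := smooth_opp _ _ _ (smooth_Derive _ _ _ Hf)).
  assert (Hg' := smooth_opp _ _ _ (smooth_Derive _ _ _ Hg)).
  split.
  - destruct m as [|m].
    + destruct n as [|n]; [lia|]. destruct Vg as [-> _]. ring.
    + destruct Vf as [-> _]. ring.
  - (* Leibniz: both terms have order [k] with the same sign, except that a factor
       not vanishing at [c] gives a term of higher order *)
    assert (Hs1 := smooth_mult _ _ _ _ Hf' Hg). assert (Hs2 := smooth_mult _ _ _ _ Hf Hg').
    destruct m as [|m]; destruct n as [|n]; try lia.
    + apply (lead_ext a b) with (fun x => f x * - Derive g x + - Derive f x * g x); [exact Hc| |].
      { intros x Hx. rewrite Derive_mult_smooth by assumption. ring. }
      apply lead_plus_vanish; try assumption.
      * apply (IH 0%nat n); try assumption; try lia; apply Vg.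
      * replace (S k) with (0 + S n)%nat by lia.
        apply vanish_mult; [exact Hf'|exact Hg|exact I|apply lead_vanish; assumption].
    + apply (lead_ext a b) with (fun x => - Derive f x * g x + f x * - Derive g x); [exact Hc| |].
      { intros x Hx. rewrite Derive_mult_smooth by assumption. ring. }
      apply lead_plus_vanish; try assumption.
      * apply (IH m 0%nat); try assumption; try lia; apply Vf.
      * replace (S k) with (S m + 0)%nat by lia.
        apply vanish_mult; [exact Hf|exact Hg'|apply lead_vanish; assumption|exact I].
    + apply (lead_ext a b) with (fun x => - Derive f x * g x + f x * - Derive g x); [exact Hc| |].
      { intros x Hx. rewrite Derive_mult_smooth by assumption. ring. }
      apply lead_plus; try assumption.
      * apply (IH m (S n)); try assumption; try lia; apply Vf.
      * apply (IH (S m) n); try assumption; try lia; apply Vg.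
Qed.

End Order_at_point.

Lemma lead_Derive_n (n : nat) (f : R -> R) (c : R) :
  lead n f c -> Derive_n f n c <> 0.
Proof.
  revert f; induction n as [|n IH]; intros f H.
  - simpl in *. lra.
  - destruct H as [_ H]. specialize (IH _ H).
    rewrite Derive_n_opp in IH. rewrite Derive_n_Derive. lra.
Qed.

Lemma lead_pow (a b c : R) (n k : nat) (f : R -> R) :
  a < c < b -> smooth a b f -> lead n f c -> lead (k * n) (fun x => f x ^ k) c.
Proof.
  intros Hc Hf H. induction k as [|k IH]; [simpl; lra|].
  apply (lead_mult a b c Hc n (k * n) f); [exact Hf|apply smooth_pow, Hf|exact H|exact IH].
Qed.

Lemma lead_cos : lead 1 cos (PI / 2).
Proof.
  split; [apply cos_PI2|]. simpl.
  rewrite (is_derive_unique _ _ _ (is_derive_cos (PI / 2))), sin_PI2. lra.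
Qed.

(** ** The quotient [sin x / x] *)

(** As a power series in [x ^ 2] this is smooth at [0] too, and so is its inverse: it
    resolves the singularity of [1 / sin] in the weights [Gamma1] and [Gamma2]. *)
Definition sinc (x : R) : R := PSeries sin_n (x * x).

Lemma sin_sinc (x : R) : sin x = x * sinc x.
Proof.
  unfold sin, sinc. destruct (exist_sin (Rsqr x)) as [l Hl]. f_equal.
  symmetry. apply is_series_unique. apply is_series_Reals. exact Hl.
Qed.

Lemma CV_radius_sin_n : CV_radius sin_n = p_infty.
Proof.
  apply CV_radius_infinite_DAlembert; [exact sin_no_R0|].
  apply is_lim_seq_Reals. exact Alembert_sin.
Qed.

Lemma sinc_neq_0 (x : R) : - PI < x < PI -> sinc x <> 0.
Proof.
  intros Hx H. destruct (Req_dec x 0) as [->|Hx0].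
  - unfold sinc in H. rewrite Rmult_0_l, PSeries_0 in H.
    revert H. unfold sin_n. simpl. lra.
  - assert (Hs := sin_sinc x). rewrite H, Rmult_0_r in Hs.
    destruct (Rtotal_order x 0) as [Hn|[Hn|Hn]]; [|lra|].
    + assert (0 < sin (- x)) by (apply sin_gt_0; lra). rewrite sin_neg in *. lra.
    + assert (0 < sin x) by (apply sin_gt_0; lra). lra.
Qed.

Lemma smooth_sinc (a b : R) : smooth a b sinc.
Proof.
  intros n.
  set (c := Rmax (Rabs a) (Rabs b)).
  apply (smooth_comp a b (-1) (c * c + 1) (PSeries sin_n) (fun x => x * x)).
  - intros x Hx.
    assert (Hc : Rabs x <= c).
    { unfold c. apply Rabs_le. assert (H1 := Rle_abs b). assert (H2 := Rle_abs (- a)).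
      rewrite Rabs_Ropp in H2.
      assert (H3 := Rmax_l (Rabs a) (Rabs b)). assert (H4 := Rmax_r (Rabs a) (Rabs b)).
      lra. }
    assert (H0 := Rabs_pos x). assert (Hx2 : x * x = Rabs x * Rabs x)
      by (rewrite <- Rabs_mult; symmetry; apply Rabs_pos_eq; nra).
    nra.
  - apply smooth_PSeries, CV_radius_sin_n.
  - apply smooth_mult; apply smooth_id.
Qed.

(** * Oscillatory integrals *)

Lemma PI2_pos : 0 < PI / 2.
Proof. assert (H := PI_RGT_0). lra. Qed.

Lemma RInt_ext_quarter (f g : R -> R) :
  (forall x, 0 < x < PI / 2 -> f x = g x) -> RInt f 0 (PI / 2) = RInt g 0 (PI / 2).
Proof.
  intros H. assert (Hpi := PI2_pos). apply RInt_ext.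
  rewrite Rmin_left, Rmax_right by lra. exact H.
Qed.

Lemma abs_RInt_le_sup (f : R -> R) (M : R) :
  (forall x, 0 <= x <= PI / 2 -> continuous f x) ->
  (forall x, 0 <= x <= PI / 2 -> Rabs (f x) <= M) ->
  Rabs (RInt f 0 (PI / 2)) <= 2 * M.
Proof.
  intros Hc HM. assert (H := PI2_pos). assert (H4 := PI_4).
  assert (HM0 : 0 <= M).
  { apply Rle_trans with (2 := HM 0 ltac:(lra)). apply Rabs_pos. }
  apply Rle_trans with ((PI / 2 - 0) * M); [|nra].
  apply abs_RInt_le_const; [lra| |exact HM].
  apply (ex_RInt_continuous f). intros z. rewrite Rmin_left, Rmax_right by lra. apply Hc.
Qed.

Lemma bounded_on_quarter_period (f : R -> R) :
  (forall x, 0 <= x <= PI / 2 -> continuous f x) ->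
  exists M, 0 <= M /\ forall x, 0 <= x <= PI / 2 -> Rabs (f x) <= M.
Proof.
  intros Hc. assert (H := PI2_pos).
  destruct (continuity_ab_maj (fun x => Rabs (f x)) 0 (PI / 2)) as [m [Hm _]]; [lra| |].
  - intros x Hx. apply continuity_pt_filterlim.
    apply (continuous_comp f Rabs); [apply Hc, Hx|apply continuous_Rabs].
  - exists (Rabs (f m)). split; [apply Rabs_pos|exact Hm].
Qed.

(** With a free phase the sine integrals are included, and integration by parts only
    shifts the phase by [PI / 2]. *)
Definition osc (F : R -> R) (A phi : R) : R :=
  RInt (fun x => F x * cos (A * x + phi)) 0 (PI / 2).

Lemma continuous_cos_affine (A phi x : R) : continuous (fun x => cos (A * x + phi)) x.
Proof. apply (ex_derive_continuous (fun x => cos (A * x + phi))). auto_derive; auto. Qed.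

Section Integration_by_parts.

Context (a b : R) (Ha : a < 0) (Hb : PI / 2 < b).

Lemma osc_integrable (F : R -> R) (A phi : R) :
  smooth a b F -> ex_RInt (fun x => F x * cos (A * x + phi)) 0 (PI / 2).
Proof.
  intros HF. assert (H := PI2_pos).
  apply (ex_RInt_continuous (fun x => F x * cos (A * x + phi))).
  intros z. rewrite Rmin_left, Rmax_right by lra. intros Hz.
  apply (continuous_mult F); [apply (smooth_continuous a b); [exact HF|lra]|].
  apply continuous_cos_affine.
Qed.

Lemma osc_by_parts (F : R -> R) (A phi : R) : smooth a b F -> A <> 0 ->
  osc F A phi =
  (F (PI / 2) * sin (A * (PI / 2) + phi) - F 0 * sin phi
   + osc (Derive F) A (phi + PI / 2)) / A.
Proof.
  intros HF HA. assert (H := PI2_pos).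
  assert (HF' := smooth_Derive _ _ _ HF).
  assert (HI : is_RInt (fun x => F x * cos (A * x + phi)
        + - / A * (Derive F x * cos (A * x + (phi + PI / 2)))) 0 (PI / 2)
        (minus (F (PI / 2) * (sin (A * (PI / 2) + phi) / A))
               (F 0 * (sin (A * 0 + phi) / A)))).
  { apply (is_RInt_derive (fun x => F x * (sin (A * x + phi) / A))).
    - intros x. rewrite Rmin_left, Rmax_right by lra. intros Hx.
      assert (Hd := smooth_is_derive a b F x HF ltac:(lra)).
      evar_last.
      { apply (is_derive_mult F (fun x => sin (A * x + phi) / A)); [exact Hd| |intros; apply Rmult_comm].
        instantiate (1 := cos (A * x + phi)). auto_derive; auto. field. exact HA. }
      unfold plus, mult; simpl.
      rewrite <- Rplus_assoc, (cos_plus (A * x + phi)), cos_PI2, sin_PI2.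
      field. exact HA.
    - intros x. rewrite Rmin_left, Rmax_right by lra. intros Hx.
      apply (continuous_plus (fun x => F x * cos (A * x + phi))).
      + apply (continuous_mult F); [apply (smooth_continuous a b); [exact HF|lra]|].
        apply continuous_cos_affine.
      + apply (continuous_scal_r (- / A) (fun x => Derive F x * cos (A * x + (phi + PI / 2)))).
        apply (continuous_mult (Derive F)); [apply (smooth_continuous a b); [exact HF'|lra]|].
        apply continuous_cos_affine. }
  apply (is_RInt_unique (V := R_CompleteNormedModule)) in HI.
  assert (HS : RInt (fun x => F x * cos (A * x + phi)
        + - / A * (Derive F x * cos (A * x + (phi + PI / 2)))) 0 (PI / 2)
        = osc F A phi + - / A * osc (Derive F) A (phi + PI / 2)).
  { unfold osc.
    rewrite <- (RInt_scal (fun x => Derive F x * cos (A * x + (phi + PI / 2))))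
      by (apply osc_integrable, HF').
    apply (RInt_plus (fun x => F x * cos (A * x + phi))).
    - apply osc_integrable, HF.
    - apply (ex_RInt_scal (fun x => Derive F x * cos (A * x + (phi + PI / 2)))).
      apply osc_integrable, HF'. }
  rewrite HS in HI. unfold minus, plus, opp in HI; simpl in HI.
  rewrite Rmult_0_r, Rplus_0_l in HI.
  replace (osc F A phi) with (osc F A phi
     + - / A * osc (Derive F) A (phi + PI / 2) + / A * osc (Derive F) A (phi + PI / 2))
    by ring.
  rewrite HI. field. exact HA.
Qed.

Lemma osc_bounded (F : R -> R) : smooth a b F ->
  exists C, 0 <= C /\ forall A phi, Rabs (osc F A phi) <= C.
Proof.
  intros HF. assert (H := PI2_pos).
  destruct (bounded_on_quarter_period F) as [M [HM0 HM]].
  { intros x Hx. apply (smooth_continuous a b); [exact HF|lra]. }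
  exists (2 * M). split; [lra|]. intros A phi. unfold osc.
  apply abs_RInt_le_sup with (f := fun x => F x * cos (A * x + phi)).
  - intros x Hx. apply (continuous_mult F); [apply (smooth_continuous a b); [exact HF|lra]|].
    apply continuous_cos_affine.
  - intros x Hx. rewrite Rabs_mult.
    assert (H1 : Rabs (cos (A * x + phi)) <= 1) by apply Rabs_le, COS_bound.
    assert (H2 := HM x Hx). assert (H3 := Rabs_pos (F x)).
    assert (H4 := Rabs_pos (cos (A * x + phi))). nra.
Qed.

(** Each integration by parts gains a factor [1 / A]; the gain stops at the first
    boundary term that survives. *)
Lemma osc_decay (r : nat) (F : R -> R) : smooth a b F ->
  exists C, 0 <= C /\ forall A phi, 1 <= A ->
    (forall l, (l < r)%nat ->
       Derive_n F l (PI / 2) * sin (A * (PI / 2) + phi + INR l * (PI / 2)) = 0 /\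
       Derive_n F l 0 * sin (phi + INR l * (PI / 2)) = 0) ->
    Rabs (osc F A phi) <= C / A ^ S r.
Proof.
  revert F; induction r as [|r IH]; intros F HF;
    assert (HF' := smooth_Derive _ _ _ HF).
  - destruct (osc_bounded (Derive F) HF') as [C [HC0 HC]].
    assert (HB0 := Rabs_pos (F (PI / 2))). assert (HB1 := Rabs_pos (F 0)).
    exists (Rabs (F (PI / 2)) + Rabs (F 0) + C). split; [lra|].
    intros A phi HA _. rewrite osc_by_parts by (assumption || lra).
    rewrite pow_1. unfold Rdiv. rewrite Rabs_mult, (Rabs_pos_eq (/ A))
      by (left; apply Rinv_0_lt_compat; lra).
    apply Rmult_le_compat_r; [left; apply Rinv_0_lt_compat; lra|].
    apply Rle_trans with (1 := Rabs_triang _ _).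
    apply Rplus_le_compat; [|apply HC].
    apply Rle_trans with (1 := Rabs_triang _ _). rewrite Rabs_Ropp, !Rabs_mult.
    assert (S1 : Rabs (sin (A * (PI / 2) + phi)) <= 1) by apply Rabs_le, SIN_bound.
    assert (S2 : Rabs (sin phi) <= 1) by apply Rabs_le, SIN_bound.
    nra.
  - destruct (IH (Derive F) HF') as [C [HC0 HC]].
    exists C. split; [exact HC0|]. intros A phi HA Hl.
    rewrite osc_by_parts by (assumption || lra).
    destruct (Hl 0%nat ltac:(lia)) as [H1 H2].
    simpl in H1, H2. rewrite Rmult_0_l, Rplus_0_r in H1, H2.
    rewrite H1, H2, Rminus_0_r, Rplus_0_l.
    unfold Rdiv. rewrite Rabs_mult, (Rabs_pos_eq (/ A))
      by (left; apply Rinv_0_lt_compat; lra).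
    assert (HA' : 0 < A ^ S r) by (apply pow_lt; lra).
    replace (C * / A ^ S (S r)) with (C / A ^ S r * / A)
      by (simpl pow in *; field; split; [apply pow_nonzero|]; lra).
    apply Rmult_le_compat_r; [left; apply Rinv_0_lt_compat; lra|].
    apply HC; [exact HA|]. intros l Hlr.
    destruct (Hl (S l) ltac:(lia)) as [H3 H4].
    rewrite Derive_n_Derive, S_INR in H3, H4. split.
    + etransitivity; [|exact H3]. f_equal. f_equal. field.
    + etransitivity; [|exact H4]. f_equal. f_equal. field.
Qed.

End Integration_by_parts.

(** * Combinations of trigonometric functions with bounded coefficients *)

(** An atomic norm, kept as a relation so that the terms of [f] need not be listed: an
    estimate uniform over the generators [P] passes to [f] at the cost of the factor
    [B], whatever the number of terms. *)
Inductive bounded_comb (P : (R -> R) -> Prop) : R -> (R -> R) -> Prop :=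
  | bcomb_atom c p : P p -> bounded_comb P (Rabs c) (fun x => c * p x)
  | bcomb_plus B B' f g : bounded_comb P B f -> bounded_comb P B' g -> bounded_comb P (B + B') (fun x => f x + g x)
  | bcomb_weaken B B' f g : bounded_comb P B f -> B <= B' -> (forall x, f x = g x) -> bounded_comb P B' g.

Lemma bcomb_gen (P : (R -> R) -> Prop) (p f : R -> R) :
  P p -> (forall x, f x = p x) -> bounded_comb P 1 f.
Proof.
  intros Hp H. apply bcomb_weaken with (Rabs 1) (fun x => 1 * p x).
  - apply bcomb_atom, Hp.
  - rewrite Rabs_R1. lra.
  - intros x. rewrite H. ring.
Qed.

Lemma bcomb_nonneg P B f : bounded_comb P B f -> 0 <= B.
Proof. induction 1; [apply Rabs_pos|lra|lra]. Qed.

Lemma bcomb_mono (P Q : (R -> R) -> Prop) B f :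
  (forall p, P p -> Q p) -> bounded_comb P B f -> bounded_comb Q B f.
Proof.
  intros H. induction 1; [apply bcomb_atom; auto|apply bcomb_plus; auto|].
  eapply bcomb_weaken; eassumption.
Qed.

Lemma bcomb_scal P B c f : bounded_comb P B f -> bounded_comb P (Rabs c * B) (fun x => c * f x).
Proof.
  induction 1 as [d p Hp|B B' f g Hf IHf Hg IHg|B B' f g Hf IHf Hle Heq].
  - apply bcomb_weaken with (Rabs (c * d)) (fun x => c * d * p x).
    + apply bcomb_atom, Hp.
    + rewrite Rabs_mult. lra.
    + intros x. ring.
  - apply bcomb_weaken with (Rabs c * B + Rabs c * B') (fun x => c * f x + c * g x).
    + apply bcomb_plus; assumption.
    + lra.
    + intros x. ring.
  - apply bcomb_weaken with (1 := IHf).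
    + apply Rmult_le_compat_l; [apply Rabs_pos|exact Hle].
    + intros x. rewrite Heq. reflexivity.
Qed.

Lemma bcomb_linear P Q B f (L : (R -> R) -> R -> R) :
  (forall c p x, L (fun x => c * p x) x = c * L p x) ->
  (forall p q x, L (fun x => p x + q x) x = L p x + L q x) ->
  (forall p q x, (forall y, p y = q y) -> L p x = L q x) ->
  (forall p, P p -> bounded_comb Q 1 (L p)) ->
  bounded_comb P B f -> bounded_comb Q B (L f).
Proof.
  intros Hs Hp He HP.
  induction 1 as [d p Hp'|B B' f g Hf IHf Hg IHg|B B' f g Hf IHf Hle Heq].
  - apply bcomb_weaken with (Rabs d * 1) (fun x => d * L p x).
    + apply bcomb_scal, HP, Hp'.
    + lra.
    + intros x. symmetry. apply Hs.
  - apply bcomb_weaken with (B + B') (fun x => L f x + L g x).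
    + apply bcomb_plus; assumption.
    + lra.
    + intros x. symmetry. apply Hp.
  - apply bcomb_weaken with (1 := IHf); [exact Hle|].
    intros x. apply He, Heq.
Qed.

Lemma bcomb_mult_fun P Q B f w :
  (forall p, P p -> bounded_comb Q 1 (fun x => w x * p x)) ->
  bounded_comb P B f -> bounded_comb Q B (fun x => w x * f x).
Proof.
  apply (bcomb_linear P Q B f (fun p x => w x * p x)).
  - intros. ring.
  - intros. ring.
  - intros p q x H. rewrite H. reflexivity.
Qed.

Lemma bcomb_mult P Q T B B' f g :
  (forall p q, P p -> Q q -> bounded_comb T 1 (fun x => p x * q x)) ->
  bounded_comb P B f -> bounded_comb Q B' g -> bounded_comb T (B * B') (fun x => f x * g x).
Proof.
  intros H Hf Hg.
  assert (Hpg : forall p, P p -> bounded_comb T B' (fun x => p x * g x)).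
  { intros p Hp. apply (bcomb_mult_fun Q T B' g p); [|exact Hg].
    intros q Hq. apply H; assumption. }
  induction Hf as [d p Hp|B1 B2 f1 f2 Hf IHf Hf2 IHg|B1 B2 f1 f2 Hf IHf Hle Heq].
  - apply bcomb_weaken with (Rabs d * B') (fun x => d * (p x * g x)).
    + apply bcomb_scal, Hpg, Hp.
    + lra.
    + intros x. ring.
  - apply bcomb_weaken with (B1 * B' + B2 * B') (fun x => f1 x * g x + f2 x * g x).
    + apply bcomb_plus; assumption.
    + lra.
    + intros x. ring.
  - apply bcomb_weaken with (1 := IHf).
    + apply Rmult_le_compat_r; [apply bcomb_nonneg with (1 := Hg)|exact Hle].
    + intros x. rewrite Heq. reflexivity.
Qed.

Lemma bcomb_abs_le P B f :
  (forall p, P p -> forall x, Rabs (p x) <= 1) ->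
  bounded_comb P B f -> forall x, Rabs (f x) <= B.
Proof.
  intros HP. induction 1 as [d p Hp|B B' f g Hf IHf Hg IHg|B B' f g Hf IHf Hle Heq];
    intros x.
  - rewrite Rabs_mult. assert (H := HP p Hp x). assert (H0 := Rabs_pos d). nra.
  - apply Rle_trans with (1 := Rabs_triang _ _). apply Rplus_le_compat; auto.
  - rewrite <- Heq. apply Rle_trans with B; auto.
Qed.

Lemma bcomb_continuous P B f :
  (forall p, P p -> forall x, continuous p x) ->
  bounded_comb P B f -> forall x, continuous f x.
Proof.
  intros HP. induction 1 as [d p Hp|B B' f g Hf IHf Hg IHg|B B' f g Hf IHf Hle Heq];
    intros x.
  - apply (continuous_scal_r d p), HP, Hp.
  - apply (continuous_plus f g); auto.
  - apply continuous_ext with f; auto.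
Qed.

Lemma bcomb_RInt_le P B f w b :
  (forall p, P p -> forall x, continuous p x) ->
  (forall x, 0 <= x <= PI / 2 -> continuous w x) ->
  (forall p, P p -> Rabs (RInt (fun x => w x * p x) 0 (PI / 2)) <= b) ->
  bounded_comb P B f -> Rabs (RInt (fun x => w x * f x) 0 (PI / 2)) <= B * b.
Proof.
  intros HP Hw Hb Hf. assert (Hpi := PI2_pos).
  assert (HI : forall B f, bounded_comb P B f -> ex_RInt (fun x => w x * f x) 0 (PI / 2)).
  { intros B' g Hg. apply (ex_RInt_continuous (fun x => w x * g x)).
    intros z. rewrite Rmin_left, Rmax_right by lra. intros Hz.
    apply (continuous_mult w); [apply Hw, Hz|].
    apply (bcomb_continuous P B'); assumption. }
  induction Hf as [d p Hp|B1 B2 f1 f2 Hf IHf Hf2 IHg|B1 B2 f1 f2 Hf IHf Hle Heq].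
  - rewrite (RInt_ext _ (fun x => scal d (w x * p x)))
      by (intros; unfold scal; simpl; unfold mult; simpl; ring).
    rewrite (RInt_scal (fun x => w x * p x)).
    + unfold scal; simpl. unfold mult; simpl. rewrite Rabs_mult.
      apply Rmult_le_compat_l; [apply Rabs_pos|apply Hb, Hp].
    + apply (HI 1). apply bcomb_gen with p; auto.
  - rewrite (RInt_ext _ (fun x => plus (w x * f1 x) (w x * f2 x)))
      by (intros; unfold plus; simpl; ring).
    rewrite (RInt_plus (fun x => w x * f1 x)) by (eapply HI; eassumption).
    unfold plus; simpl. apply Rle_trans with (1 := Rabs_triang _ _). lra.
  - rewrite (RInt_ext _ (fun x => w x * f1 x)) by (intros; rewrite Heq; reflexivity).
    assert (H0 : 0 <= b).
    { clear - Hb Hf. induction Hf; auto. apply Rle_trans with (2 := Hb p H). apply Rabs_pos. }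
    apply Rle_trans with (1 := IHf). apply Rmult_le_compat_r; assumption.
Qed.

(** ** Frequencies of fixed parity *)

Definition cos_even (M : nat) (p : R -> R) : Prop :=
  exists n : Z, (Z.abs (2 * n) <= Z.of_nat M)%Z /\ forall x, p x = cos (IZR (2 * n) * x).

Definition cos_odd (M : nat) (p : R -> R) : Prop :=
  exists n : Z, (Z.abs (2 * n + 1) <= Z.of_nat M)%Z /\
                forall x, p x = cos (IZR (2 * n + 1) * x).

Definition sin_odd (M : nat) (p : R -> R) : Prop :=
  exists n : Z, (Z.abs (2 * n + 1) <= Z.of_nat M)%Z /\
                forall x, p x = sin (IZR (2 * n + 1) * x).

Lemma cos_even_abs_le M p : cos_even M p -> forall x, Rabs (p x) <= 1.
Proof. intros [n [_ H]] x. rewrite H. apply Rabs_le, COS_bound. Qed.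

Lemma cos_odd_abs_le M p : cos_odd M p -> forall x, Rabs (p x) <= 1.
Proof. intros [n [_ H]] x. rewrite H. apply Rabs_le, COS_bound. Qed.

Lemma cos_even_continuous M p : cos_even M p -> forall x, continuous p x.
Proof.
  intros [n [_ H]] x. apply continuous_ext with (fun x => cos (IZR (2 * n) * x)).
  - intros y. symmetry. apply H.
  - apply (ex_derive_continuous (fun x => cos (IZR (2 * n) * x))). auto_derive; auto.
Qed.

Lemma sin_odd_continuous M p : sin_odd M p -> forall x, continuous p x.
Proof.
  intros [n [_ H]] x. apply continuous_ext with (fun x => sin (IZR (2 * n + 1) * x)).
  - intros y. symmetry. apply H.
  - apply (ex_derive_continuous (fun x => sin (IZR (2 * n + 1) * x))). auto_derive; auto.
Qed.

Lemma cos_odd_continuous M p : cos_odd M p -> forall x, continuous p x.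
Proof.
  intros [n [_ H]] x. apply continuous_ext with (fun x => cos (IZR (2 * n + 1) * x)).
  - intros y. symmetry. apply H.
  - apply (ex_derive_continuous (fun x => cos (IZR (2 * n + 1) * x))). auto_derive; auto.
Qed.

Lemma bcomb_half_sum (P : (R -> R) -> Prop) (p q f : R -> R) (s t : R) :
  P p -> P q -> Rabs s <= 1 / 2 -> Rabs t <= 1 / 2 ->
  (forall x, f x = s * p x + t * q x) -> bounded_comb P 1 f.
Proof.
  intros Hp Hq Hs Ht H.
  apply bcomb_weaken with (Rabs s + Rabs t) (fun x => s * p x + t * q x).
  - apply bcomb_plus; apply bcomb_atom; assumption.
  - lra.
  - intros x. symmetry. apply H.
Qed.

Ltac half_abs := unfold Rabs; destruct Rcase_abs; lra.

Lemma sin_odd_mult M M' p q :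
  sin_odd M p -> sin_odd M' q -> bounded_comb (cos_even (M + M')) 1 (fun x => p x * q x).
Proof.
  intros [n [Hn Hp]] [m [Hm Hq]].
  apply bcomb_half_sum with (p := fun x => cos (IZR (2 * (n - m)) * x))
    (q := fun x => cos (IZR (2 * (n + m + 1)) * x)) (s := 1 / 2) (t := - (1 / 2)).
  - exists (n - m)%Z. split; [lia|reflexivity].
  - exists (n + m + 1)%Z. split; [lia|reflexivity].
  - half_abs.
  - half_abs.
  - intros x. rewrite Hp, Hq.
    replace (IZR (2 * (n - m)) * x) with (IZR (2 * n + 1) * x - IZR (2 * m + 1) * x).
    2: { replace (2 * (n - m))%Z with (2 * n + 1 - (2 * m + 1))%Z by lia.
         rewrite minus_IZR. ring. }
    replace (IZR (2 * (n + m + 1)) * x) with (IZR (2 * n + 1) * x + IZR (2 * m + 1) * x).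
    2: { replace (2 * (n + m + 1))%Z with (2 * n + 1 + (2 * m + 1))%Z by lia.
         rewrite (plus_IZR (2 * n + 1)). ring. }
    rewrite cos_plus, cos_minus. field.
Qed.

Lemma cos_odd_mult M M' p q :
  cos_odd M p -> cos_odd M' q -> bounded_comb (cos_even (M + M')) 1 (fun x => p x * q x).
Proof.
  intros [n [Hn Hp]] [m [Hm Hq]].
  apply bcomb_half_sum with (p := fun x => cos (IZR (2 * (n - m)) * x))
    (q := fun x => cos (IZR (2 * (n + m + 1)) * x)) (s := 1 / 2) (t := 1 / 2).
  - exists (n - m)%Z. split; [lia|reflexivity].
  - exists (n + m + 1)%Z. split; [lia|reflexivity].
  - half_abs.
  - half_abs.
  - intros x. rewrite Hp, Hq.
    replace (IZR (2 * (n - m)) * x) with (IZR (2 * n + 1) * x - IZR (2 * m + 1) * x).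
    2: { replace (2 * (n - m))%Z with (2 * n + 1 - (2 * m + 1))%Z by lia.
         rewrite minus_IZR. ring. }
    replace (IZR (2 * (n + m + 1)) * x) with (IZR (2 * n + 1) * x + IZR (2 * m + 1) * x).
    2: { replace (2 * (n + m + 1))%Z with (2 * n + 1 + (2 * m + 1))%Z by lia.
         rewrite (plus_IZR (2 * n + 1)). ring. }
    rewrite cos_plus, cos_minus. field.
Qed.

Lemma sin_mult_cos_even M p :
  cos_even M p -> bounded_comb (sin_odd (S M)) 1 (fun x => sin x * p x).
Proof.
  intros [n [Hn Hp]].
  apply bcomb_half_sum with (p := fun x => sin (IZR (2 * n + 1) * x))
    (q := fun x => sin (IZR (2 * (n - 1) + 1) * x)) (s := 1 / 2) (t := - (1 / 2)).
  - exists n. split; [lia|reflexivity].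
  - exists (n - 1)%Z. split; [lia|reflexivity].
  - half_abs.
  - half_abs.
  - intros x. rewrite Hp.
    replace (IZR (2 * n + 1) * x) with (IZR (2 * n) * x + x) by (rewrite plus_IZR; ring).
    replace (IZR (2 * (n - 1) + 1) * x) with (IZR (2 * n) * x - x).
    2: { replace (2 * (n - 1) + 1)%Z with (2 * n - 1)%Z by lia. rewrite minus_IZR. ring. }
    rewrite sin_plus, sin_minus. field.
Qed.

Lemma cos_mult_cos_even M p :
  cos_even M p -> bounded_comb (cos_odd (S M)) 1 (fun x => cos x * p x).
Proof.
  intros [n [Hn Hp]].
  apply bcomb_half_sum with (p := fun x => cos (IZR (2 * n + 1) * x))
    (q := fun x => cos (IZR (2 * (n - 1) + 1) * x)) (s := 1 / 2) (t := 1 / 2).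
  - exists n. split; [lia|reflexivity].
  - exists (n - 1)%Z. split; [lia|reflexivity].
  - half_abs.
  - half_abs.
  - intros x. rewrite Hp.
    replace (IZR (2 * n + 1) * x) with (IZR (2 * n) * x + x) by (rewrite plus_IZR; ring).
    replace (IZR (2 * (n - 1) + 1) * x) with (IZR (2 * n) * x - x).
    2: { replace (2 * (n - 1) + 1)%Z with (2 * n - 1)%Z by lia. rewrite minus_IZR. ring. }
    rewrite cos_plus, cos_minus. field.
Qed.

(** ** Dirichlet kernels *)

(** For [sigma = 1] this is [sin ((2 n + 1) x) / sin x] and for [sigma = -1] it is
    [cos ((2 n + 1) x) / cos x]. *)
Fixpoint dirichlet (sigma : R) (n : nat) (x : R) : R :=
  match n with
  | O => 1
  | S m => 2 * cos (2 * INR (S m) * x) + sigma * dirichlet sigma m x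
  end.

Lemma sin_dirichlet (n : nat) (x : R) :
  sin ((2 * INR n + 1) * x) = sin x * dirichlet 1 n x.
Proof.
  induction n as [|n IH].
  - simpl. rewrite Rmult_0_r, Rplus_0_l, Rmult_1_l. ring.
  - cbn [dirichlet].
    replace (sin x * (2 * cos (2 * INR (S n) * x) + 1 * dirichlet 1 n x))
      with (2 * sin x * cos (2 * INR (S n) * x) + sin x * dirichlet 1 n x) by ring.
    rewrite <- IH.
    replace ((2 * INR (S n) + 1) * x) with (2 * INR (S n) * x + x) by ring.
    replace ((2 * INR n + 1) * x) with (2 * INR (S n) * x - x) by (rewrite S_INR; ring).
    rewrite sin_plus, sin_minus. ring.
Qed.

Lemma cos_dirichlet (n : nat) (x : R) :
  cos ((2 * INR n + 1) * x) = cos x * dirichlet (-1) n x.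
Proof.
  induction n as [|n IH].
  - simpl. rewrite Rmult_0_r, Rplus_0_l, Rmult_1_l. ring.
  - cbn [dirichlet].
    replace (cos x * (2 * cos (2 * INR (S n) * x) + -1 * dirichlet (-1) n x))
      with (2 * cos x * cos (2 * INR (S n) * x) - cos x * dirichlet (-1) n x) by ring.
    rewrite <- IH.
    replace ((2 * INR (S n) + 1) * x) with (2 * INR (S n) * x + x) by ring.
    replace ((2 * INR n + 1) * x) with (2 * INR (S n) * x - x) by (rewrite S_INR; ring).
    rewrite cos_plus, cos_minus. ring.
Qed.

Lemma dirichlet_at_0 (n : nat) : dirichlet 1 n 0 = 2 * INR n + 1.
Proof.
  induction n as [|n IH]; [simpl; ring|].
  cbn [dirichlet]. rewrite IH, Rmult_0_r, cos_0, S_INR. ring.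
Qed.

Lemma bcomb_dirichlet (sigma : R) (n : nat) : Rabs sigma = 1 ->
  bounded_comb (cos_even (2 * n)) (2 * INR n + 1) (dirichlet sigma n).
Proof.
  intros Hs. induction n as [|n IH].
  - apply bcomb_weaken with 1 (fun _ => 1); [|simpl; lra|reflexivity].
    apply bcomb_gen with (fun x => cos (IZR (2 * 0) * x)).
    + exists 0%Z. split; [lia|reflexivity].
    + intros x. rewrite Z.mul_0_r, Rmult_0_l, cos_0. reflexivity.
  - apply bcomb_weaken with (Rabs 2 + Rabs sigma * (2 * INR n + 1))
      (fun x => 2 * cos (2 * INR (S n) * x) + sigma * dirichlet sigma n x).
    + apply bcomb_plus.
      * apply (bcomb_atom _ 2 (fun x => cos (2 * INR (S n) * x))).
        exists (Z.of_nat (S n)). split; [lia|].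
        intros x. rewrite mult_IZR, <- INR_IZR_INZ. reflexivity.
      * apply bcomb_scal. apply bcomb_mono with (2 := IH).
        intros p [m [Hm Hp]]. exists m. split; [lia|exact Hp].
    + rewrite Hs, Rabs_pos_eq, S_INR by lra. lra.
    + reflexivity.
Qed.

Fixpoint sine_sum (n : nat) (x : R) : R :=
  match n with
  | O => 0
  | S m => sin ((2 * INR m + 1) * x) + sine_sum m x
  end.

Lemma cos_even_minus_1 (n : nat) (x : R) :
  cos (2 * INR n * x) - 1 = sin x * (-2 * sine_sum n x).
Proof.
  induction n as [|n IH].
  - simpl. rewrite Rmult_0_r, Rmult_0_l, cos_0. ring.
  - cbn [sine_sum].
    replace (sin x * (-2 * (sin ((2 * INR n + 1) * x) + sine_sum n x)))
      with (-2 * sin x * sin ((2 * INR n + 1) * x) + sin x * (-2 * sine_sum n x)) by ring.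
    rewrite <- IH.
    replace (2 * INR (S n) * x) with ((2 * INR n + 1) * x + x) by (rewrite S_INR; ring).
    replace (2 * INR n * x) with ((2 * INR n + 1) * x - x) by ring.
    rewrite cos_plus, cos_minus. ring.
Qed.

Lemma bcomb_sine_sum (M n : nat) : (1 <= M)%nat -> (2 * n <= M)%nat ->
  bounded_comb (sin_odd M) (INR n) (sine_sum n).
Proof.
  intros HM. induction n as [|n IH]; intros Hn.
  - apply bcomb_weaken with (Rabs 0) (fun x => 0 * sin (IZR (2 * 0 + 1) * x)).
    + apply bcomb_atom. exists 0%Z. split; [lia|reflexivity].
    + rewrite Rabs_R0. simpl. lra.
    + intros x. simpl. ring.
  - apply bcomb_weaken with (1 + INR n) (sine_sum (S n)).
    + apply (bcomb_plus _ _ _ (fun x => sin ((2 * INR n + 1) * x))); [|apply IH; lia].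
      apply bcomb_gen with (fun x => sin ((2 * INR n + 1) * x)); [|reflexivity].
      exists (Z.of_nat n). split; [lia|].
      intros x. rewrite plus_IZR, mult_IZR, <- INR_IZR_INZ. reflexivity.
    + rewrite S_INR. lra.
    + reflexivity.
Qed.

(** Division by [sin x] of an even trigonometric polynomial vanishing at [0]: the
    number of terms, hence the bound, grows linearly with the degree. *)
Lemma bcomb_quotient_sin (M : nat) (B : R) (h : R -> R) : (1 <= M)%nat ->
  bounded_comb (cos_even M) B h ->
  exists q, bounded_comb (sin_odd M) (B * INR M) q /\ forall x, h x - h 0 = sin x * q x.
Proof.
  intros HM. induction 1 as [d p [n [Hn Hp]]|B B' f g Hf [q [Hq Eq]] Hg [q' [Hq' Eq']]
                            |B B' f g Hf [q [Hq Eq]] Hle Heq].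
  - set (k := Z.to_nat (Z.abs n)).
    assert (Hk : forall x, p x = cos (2 * INR k * x)).
    { intros x. rewrite Hp. unfold k. rewrite INR_IZR_INZ, Z2Nat.id by lia.
      rewrite mult_IZR, abs_IZR. unfold Rabs. destruct Rcase_abs; [|reflexivity].
      rewrite <- cos_neg. f_equal. ring. }
    exists (fun x => (d * -2) * sine_sum k x). split.
    + apply bcomb_weaken with (Rabs (d * -2) * INR k) (fun x => (d * -2) * sine_sum k x).
      * apply bcomb_scal, bcomb_sine_sum; [exact HM|unfold k; lia].
      * rewrite Rabs_mult, Rmult_assoc. apply Rmult_le_compat_l; [apply Rabs_pos|].
        rewrite Rabs_left by lra.
        assert (HkM : INR (2 * k) <= INR M) by (apply le_INR; unfold k; lia).
        rewrite mult_INR in HkM. simpl in HkM. lra.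
      * reflexivity.
    + intros x. rewrite !Hk, Rmult_0_r, cos_0.
      transitivity (d * (cos (2 * INR k * x) - 1)); [ring|].
      rewrite cos_even_minus_1. ring.
  - exists (fun x => q x + q' x). split.
    + apply bcomb_weaken with (1 := bcomb_plus _ _ _ _ _ Hq Hq'); [lra|reflexivity].
    + intros x. rewrite Rmult_plus_distr_l, <- Eq, <- Eq'. ring.
  - exists q. split.
    + apply bcomb_weaken with (1 := Hq); [|reflexivity].
      apply Rmult_le_compat_r; [apply pos_INR|exact Hle].
    + intros x. rewrite <- !Heq. apply Eq.
Qed.

(** ** The eigenmodes as trigonometric polynomials *)

Definition deg (i : nat) : nat := 2 * i + 3.

Lemma omega_deg (i : nat) : omega i = INR (deg i).
Proof. unfold omega, deg. rewrite plus_INR, mult_INR. simpl. ring. Qed.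

Lemma omega_dirichlet (i : nat) : omega i = 2 * INR (S i) + 1.
Proof. unfold omega. rewrite S_INR. ring. Qed.

Lemma omega_ge_3 (i : nat) : 3 <= omega i.
Proof. unfold omega. assert (H := pos_INR i). lra. Qed.

(** On the open interval [tan_e i] is [tan * e i] and [tan_e' i] is
    [tan * e' i / omega i]; as trigonometric polynomials both are defined at the end
    points as well. *)
Definition tan_e (i : nat) (x : R) : R :=
  amp i * (omega i * sin (omega i * x) - sin x * dirichlet (-1) (S i) x).

Definition tan_e' (i : nat) (x : R) : R :=
  amp i * (omega i * cos (omega i * x) - cos x * dirichlet 1 (S i) x).

Definition mode_bound : R := 3 / EulerGamma (3 / 2).

Lemma mode_bound_pos : 0 < mode_bound.
Proof.
  destruct EulerGamma_half_integers as [G0 _].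
  apply Rdiv_lt_0_compat; lra.
Qed.

Lemma amp_omega_le (i : nat) : amp i * omega i * 2 <= mode_bound.
Proof.
  destruct EulerGamma_half_integers as [G0 _]. destruct (amp_bounds i) as [_ H].
  unfold mode_bound.
  replace (3 / EulerGamma (3 / 2)) with (3 / (2 * EulerGamma (3 / 2)) * 2)
    by (field; lra). lra.
Qed.

Lemma bcomb_mode (P : (R -> R) -> Prop) (i : nat) (p q : R -> R) :
  P p -> bounded_comb P (omega i) q ->
  bounded_comb P mode_bound (fun x => amp i * (omega i * p x - q x)).
Proof.
  intros Hp Hq. destruct (amp_bounds i) as [A0 _].
  assert (H3 := omega_ge_3 i). assert (HB := amp_omega_le i).
  apply bcomb_weaken with
    (Rabs (amp i) * (Rabs (omega i) + Rabs (-1) * omega i))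
    (fun x => amp i * (omega i * p x + -1 * q x)).
  - apply bcomb_scal, bcomb_plus; [apply bcomb_atom, Hp|apply bcomb_scal, Hq].
  - rewrite (Rabs_pos_eq (amp i)), (Rabs_pos_eq (omega i)), Rabs_left by lra. lra.
  - intros x. ring.
Qed.

(** The Dirichlet kernel contributes about [omega i] terms with coefficient [1], and
    [amp i = O(1 / omega i)] makes the total bounded independently of [i]. *)
Lemma bcomb_tan_e (i : nat) : bounded_comb (sin_odd (deg i)) mode_bound (tan_e i).
Proof.
  apply bcomb_mode with (p := fun x => sin (omega i * x)).
  - exists (Z.of_nat (S i)). split; [unfold deg; lia|].
    intros x. rewrite plus_IZR, mult_IZR, <- INR_IZR_INZ, omega_dirichlet. reflexivity.
  - rewrite omega_dirichlet. replace (deg i) with (S (2 * S i)) by (unfold deg; lia).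
    apply bcomb_mult_fun with (cos_even (2 * S i)).
    + apply sin_mult_cos_even.
    + apply bcomb_dirichlet. rewrite Rabs_left; lra.
Qed.

Lemma bcomb_tan_e' (i : nat) : bounded_comb (cos_odd (deg i)) mode_bound (tan_e' i).
Proof.
  apply bcomb_mode with (p := fun x => cos (omega i * x)).
  - exists (Z.of_nat (S i)). split; [unfold deg; lia|].
    intros x. rewrite plus_IZR, mult_IZR, <- INR_IZR_INZ, omega_dirichlet. reflexivity.
  - rewrite omega_dirichlet. replace (deg i) with (S (2 * S i)) by (unfold deg; lia).
    apply bcomb_mult_fun with (cos_even (2 * S i)).
    + apply cos_mult_cos_even.
    + apply bcomb_dirichlet. apply Rabs_R1.
Qed.

Lemma tan_e_at_0 (i : nat) : tan_e i 0 = 0.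
Proof. unfold tan_e. rewrite Rmult_0_r, sin_0. ring. Qed.

Lemma tan_e'_at_0 (i : nat) : tan_e' i 0 = 0.
Proof.
  unfold tan_e'. rewrite Rmult_0_r, cos_0, dirichlet_at_0, omega_dirichlet. ring.
Qed.

Lemma sin_cos_pos (x : R) : 0 < x < PI / 2 -> 0 < sin x /\ 0 < cos x.
Proof.
  intros Hx. split; [apply sin_gt_0; lra|apply cos_gt_0; lra].
Qed.

Lemma tan_e_spec (i : nat) (x : R) : 0 < x < PI / 2 -> tan x * e i x = tan_e i x.
Proof.
  intros Hx. destruct (sin_cos_pos x Hx) as [S0 C0].
  rewrite e_closed_form by lra. unfold tan_e, tan.
  transitivity (amp i * (omega i * sin (omega i * x) - sin x / cos x * cos (omega i * x)));
    [field; lra|].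
  rewrite omega_dirichlet, (cos_dirichlet (S i)), <- omega_dirichlet. field. lra.
Qed.

Lemma e'_closed_form (i : nat) (x : R) : 0 < x < PI / 2 ->
  e' i x / omega i
  = amp i * (cos x / sin x) * (omega i * cos (omega i * x) - cos x / sin x * sin (omega i * x)).
Proof.
  intros Hx. destruct (sin_cos_pos x Hx) as [S0 C0].
  assert (H3 := omega_ge_3 i).
  assert (H : is_derive (e i) x
    (omega i * (amp i * (cos x / sin x)
       * (omega i * cos (omega i * x) - cos x / sin x * sin (omega i * x))))).
  { apply is_derive_ext_loc with (fun x =>
      amp i * (omega i * (cos x / sin x) * sin (omega i * x) - cos (omega i * x))).
    - apply (locally_of_interval 0 (PI / 2)); [exact Hx|].
      intros y Hy. symmetry. apply e_closed_form. lra.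
    - auto_derive; [lra|].
      assert (E : sin x * sin x = 1 - cos x * cos x).
      { assert (E := sin2_cos2 x). unfold Rsqr in E. lra. }
      field_simplify; [|lra|lra].
      replace (sin x ^ 2) with (1 - cos x * cos x) by (rewrite <- E; ring).
      field. rewrite <- E. nra. }
  unfold e'. rewrite (is_derive_unique _ _ _ H). field. lra.
Qed.

Lemma tan_e'_spec (i : nat) (x : R) : 0 < x < PI / 2 ->
  tan x * (e' i x / omega i)
  = amp i * (omega i * cos (omega i * x) - cos x / sin x * sin (omega i * x)).
Proof.
  intros Hx. destruct (sin_cos_pos x Hx) as [S0 C0].
  rewrite e'_closed_form by exact Hx. unfold tan. field. lra.
Qed.

Lemma tan_e'_dirichlet (i : nat) (x : R) : 0 < x < PI / 2 ->
  amp i * (omega i * cos (omega i * x) - cos x / sin x * sin (omega i * x)) = tan_e' i x.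
Proof.
  intros Hx. destruct (sin_cos_pos x Hx) as [S0 C0]. unfold tan_e'.
  rewrite omega_dirichlet, (sin_dirichlet (S i)), <- omega_dirichlet. field. lra.
Qed.

(** * Weights *)

(** The derivatives of [G] of even order at [PI / 2] only see the part of [G] that is
    not odd about [PI / 2]. The two parts may be singular at [0], where the parity of
    the whole function is used instead. *)
Record parity_split (G Go Ge : R -> R) : Prop := {
  split_smooth : smooth (- PI) PI G;
  split_even : forall x, - PI < x < PI -> G (- x) = G x;
  split_smooth_odd : smooth 0 PI Go;
  split_smooth_even : smooth 0 PI Ge;
  split_sum : forall x, 0 < x < PI -> G x = Go x + Ge x;
  split_odd : forall x, 0 < x < PI -> Go (PI - x) = - Go x
}.

(** A weight of order [q] gives the decay exponent [p = q + 3]: the factor [cos x ^ 2]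
    of the integrands raises the order of vanishing of [Ge] to [q + 2]. *)
Definition weight (q : nat) (G : R -> R) : Prop :=
  exists Go Ge, parity_split G Go Ge /\ vanish q Ge (PI / 2).

(** The factor [s] accounts for the sign of [Ge]. *)
Definition exact_weight (q : nat) (G : R -> R) : Prop :=
  exists Go Ge s, parity_split G Go Ge /\ lead q (fun x => s * Ge x) (PI / 2).

Lemma exact_weight_weight (q : nat) (G : R -> R) : exact_weight q G -> weight q G.
Proof.
  intros [Go [Ge [s [HG HL]]]]. exists Go, Ge. split; [exact HG|].
  assert (Hpi := PI2_pos).
  assert (Hc : 0 < PI / 2 < PI) by lra.
  assert (Hs := split_smooth_even _ _ _ HG).
  assert (Hs' := smooth_scal _ _ s _ Hs).
  destruct (Req_dec s 0) as [->|Hs0].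
  - exfalso. apply (lead_Derive_n _ _ _ HL). clear.
    assert (H : vanish (S q) (fun x => 0 * Ge x) (PI / 2)).
    { apply (vanish_ext 0 PI) with (fun _ => 0); [assert (H := PI2_pos); lra| |apply vanish_zero].
      intros x _. ring. }
    apply (vanish_Derive_n (S q)); [exact H|lia].
  - apply (lead_vanish 0 PI (PI / 2) Hc q _ Hs') in HL.
    apply (vanish_ext 0 PI) with (fun x => / s * (s * Ge x)); [exact Hc| |].
    + intros x _. field. exact Hs0.
    + apply (vanish_mult 0 PI (PI / 2) Hc 0 q (fun _ => / s));
        [apply smooth_const|exact Hs'|exact I|exact HL].
Qed.

Section Weighted_derivatives.

Context (G Go Ge : R -> R) (q : nat).
Context (HG : parity_split G Go Ge) (HV : vanish q Ge (PI / 2)).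
Context (w : R -> R) (k : nat) (rho tau : R).
Context (Hw : smooth (- PI) PI w) (Hk : vanish k w (PI / 2)).
Context (Hrho : forall x, w (- x) = rho * w x).
Context (Htau : forall x, w (PI - x) = tau * w x).

Lemma Derive_n_weighted_split (l : nat) :
  Derive_n (fun x => G x * w x) l (PI / 2) =
  Derive_n (fun x => Go x * w x) l (PI / 2) + Derive_n (fun x => Ge x * w x) l (PI / 2).
Proof using HG Hw.
  assert (Hpi := PI2_pos).
  assert (Hw0 : smooth 0 PI w) by (apply (smooth_sub (- PI) PI); [lra|lra|exact Hw]).
  rewrite <- (Derive_n_plus_smooth 0 PI (fun x => Go x * w x) (fun x => Ge x * w x)).
  - apply (Derive_n_ext_interval 0 PI); [|lra].
    intros x Hx. rewrite (split_sum _ _ _ HG) by exact Hx. ring.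
  - apply smooth_mult; [apply (split_smooth_odd _ _ _ HG)|exact Hw0].
  - apply smooth_mult; [apply (split_smooth_even _ _ _ HG)|exact Hw0].
  - lra.
Qed.

Lemma Derive_n_weighted_odd_part (l : nat) :
  tau * (-1) ^ l = 1 -> Derive_n (fun x => Go x * w x) l (PI / 2) = 0.
Proof using HG Hw Htau.
  intros Hl. assert (Hpi := PI2_pos).
  assert (E0 : PI / 2 - PI / 2 = 0) by ring. assert (E1 : PI / 2 + PI / 2 = PI) by field.
  apply (Derive_n_parity (PI / 2) (PI / 2) (- tau)); [lra| | |lra].
  - rewrite E0, E1. apply smooth_mult; [apply (split_smooth_odd _ _ _ HG)|].
    apply (smooth_sub (- PI) PI); [lra|lra|exact Hw].
  - rewrite E0, E1. intros x Hx. replace (2 * (PI / 2) - x) with (PI - x) by field.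
    rewrite Htau, (split_odd _ _ _ HG) by exact Hx. ring.
Qed.

Lemma vanish_weighted_even_part : vanish (q + k) (fun x => Ge x * w x) (PI / 2).
Proof using HG HV Hw Hk.
  assert (Hpi := PI2_pos).
  apply (vanish_mult 0 PI); [lra|apply (split_smooth_even _ _ _ HG)| |exact HV|exact Hk].
  apply (smooth_sub (- PI) PI); [lra|lra|exact Hw].
Qed.

Lemma Derive_n_weighted_half_PI (l : nat) :
  (l < q + k)%nat -> tau * (-1) ^ l = 1 -> Derive_n (fun x => G x * w x) l (PI / 2) = 0.
Proof using HG HV Hw Hk Htau.
  intros Hl Ht. rewrite Derive_n_weighted_split, Derive_n_weighted_odd_part by exact Ht.
  rewrite (vanish_Derive_n (q + k)); [ring|apply vanish_weighted_even_part|exact Hl].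
Qed.

Lemma smooth_weighted : smooth (- PI) PI (fun x => G x * w x).
Proof using HG Hw. apply smooth_mult; [apply (split_smooth _ _ _ HG)|exact Hw]. Qed.

Lemma Derive_n_weighted_0 (l : nat) :
  rho * (-1) ^ l = -1 -> Derive_n (fun x => G x * w x) l 0 = 0.
Proof using HG Hw Hrho.
  intros Hl. assert (Hpi := PI2_pos).
  apply (Derive_n_parity 0 PI rho); [lra| | |exact Hl].
  - rewrite Rminus_0_l, Rplus_0_l. apply smooth_weighted.
  - rewrite Rminus_0_l, Rplus_0_l. intros x Hx.
    replace (2 * 0 - x) with (- x) by ring.
    rewrite Hrho, (split_even _ _ _ HG) by exact Hx. ring.
Qed.

(** In [osc_decay] a boundary term of order [l] is a derivative times a sine. At each end
    point the parities make one factor vanish for even [l] and the other for odd [l],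
    until [l] reaches the order of vanishing of the even part. *)
Lemma weighted_osc_decay :
  exists C, 0 <= C /\ forall A phi, 1 <= A ->
    (forall l, tau * (-1) ^ l = 1 \/ sin (A * (PI / 2) + phi + INR l * (PI / 2)) = 0) ->
    (forall l, rho * (-1) ^ l = -1 \/ sin (phi + INR l * (PI / 2)) = 0) ->
    Rabs (osc (fun x => G x * w x) A phi) <= C / A ^ S (q + k).
Proof using HG HV Hw Hk Hrho Htau.
  assert (Hpi := PI2_pos).
  destruct (osc_decay (- PI) PI ltac:(lra) ltac:(lra) (q + k) _ smooth_weighted)
    as [C [HC0 HC]].
  exists C. split; [exact HC0|]. intros A phi HA H1 H2. apply HC; [exact HA|].
  intros l Hl. split.
  - destruct (H1 l) as [H|H]; [|rewrite H; ring].
    rewrite Derive_n_weighted_half_PI by assumption. ring.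
  - destruct (H2 l) as [H|H]; [|rewrite H; ring].
    rewrite Derive_n_weighted_0 by assumption. ring.
Qed.

End Weighted_derivatives.

Lemma pow_neg_1_cases (l : nat) :
  (exists m, l = (2 * m)%nat /\ (-1) ^ l = 1) \/
  (exists m, l = (2 * m + 1)%nat /\ (-1) ^ l = -1).
Proof.
  destruct (Nat.Even_or_Odd l) as [[m ->]|[m ->]].
  - left. exists m. split; [reflexivity|]. apply pow_1_even.
  - right. exists m. split; [reflexivity|]. replace (2 * m + 1)%nat with (S (2 * m)) by lia.
    apply pow_1_odd.
Qed.

Lemma sin_PI_IZR (z : Z) (x : R) : x = IZR z * PI -> sin x = 0.
Proof. intros H. apply sin_eq_0_1. exists z. exact H. Qed.

Lemma smooth_cos_pow (k : nat) (a b : R) : smooth a b (fun x => cos x ^ k).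
Proof. apply smooth_pow, smooth_cos. Qed.

Lemma vanish_cos_pow (k : nat) : vanish k (fun x => cos x ^ k) (PI / 2).
Proof.
  assert (Hpi := PI2_pos). assert (Hc : 0 < PI / 2 < PI) by lra.
  apply (lead_vanish 0 PI (PI / 2) Hc); [apply smooth_cos_pow|].
  replace k with (k * 1)%nat at 1 by lia.
  apply (lead_pow 0 PI); [exact Hc|apply smooth_cos|apply lead_cos].
Qed.

Section Elementary_oscillations.

Context (q : nat) (G : R -> R) (HG : weight q G).

Lemma osc_cos2 : exists C, 0 <= C /\ forall a, 1 <= IZR (2 * a + 1) ->
  Rabs (osc (fun x => G x * cos x ^ 2) (IZR (2 * a + 1)) 0)
  <= C / IZR (2 * a + 1) ^ (q + 3).
Proof using HG.
  destruct HG as [Go [Ge [HS HV]]].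
  destruct (weighted_osc_decay G Go Ge q HS HV (fun x => cos x ^ 2) 2 1 1)
    as [C [HC0 HC]].
  - apply smooth_cos_pow.
  - apply vanish_cos_pow.
  - intros x. rewrite cos_neg. ring.
  - intros x. rewrite cos_minus, cos_PI, sin_PI. ring.
  - exists C. split; [exact HC0|]. intros a Ha.
    replace (q + 3)%nat with (S (q + 2)) by lia. apply HC; [exact Ha| |].
    + intros l. destruct (pow_neg_1_cases l) as [[m [Hl El]]|[m [Hl El]]].
      * left. lra.
      * right. apply (sin_PI_IZR (a + Z.of_nat m + 1)).
        rewrite Hl, plus_INR, mult_INR, !plus_IZR, mult_IZR, <- INR_IZR_INZ. simpl. field.
    + intros l. destruct (pow_neg_1_cases l) as [[m [Hl El]]|[m [Hl El]]].
      * right. apply (sin_PI_IZR (Z.of_nat m)).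
        rewrite Hl, mult_INR, <- INR_IZR_INZ. simpl. field.
      * left. lra.
Qed.

Lemma osc_sin_cos : exists C, 0 <= C /\ forall a, 1 <= IZR (2 * a + 1) ->
  Rabs (osc (fun x => G x * (sin x * cos x)) (IZR (2 * a + 1)) (- (PI / 2)))
  <= C / IZR (2 * a + 1) ^ (q + 2).
Proof using HG.
  assert (Hpi := PI2_pos).
  destruct HG as [Go [Ge [HS HV]]].
  destruct (weighted_osc_decay G Go Ge q HS HV (fun x => sin x * cos x) 1 (-1) (-1))
    as [C [HC0 HC]].
  - apply smooth_mult; [apply smooth_sin|apply smooth_cos].
  - apply (vanish_mult 0 PI (PI / 2) ltac:(lra) 0 1 sin cos);
      [apply smooth_sin|apply smooth_cos|exact I|].
    split; [apply cos_PI2|exact I].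
  - intros x. rewrite cos_neg, sin_neg. ring.
  - intros x. rewrite cos_minus, sin_minus, cos_PI, sin_PI. ring.
  - exists C. split; [exact HC0|]. intros a Ha.
    replace (q + 2)%nat with (S (q + 1)) by lia. apply HC; [exact Ha| |].
    + intros l. destruct (pow_neg_1_cases l) as [[m [Hl El]]|[m [Hl El]]].
      * right. apply (sin_PI_IZR (a + Z.of_nat m)).
        rewrite Hl, mult_INR, !plus_IZR, mult_IZR, <- INR_IZR_INZ. simpl. field.
      * left. lra.
    + intros l. destruct (pow_neg_1_cases l) as [[m [Hl El]]|[m [Hl El]]].
      * left. lra.
      * right. apply (sin_PI_IZR (Z.of_nat m)).
        rewrite Hl, plus_INR, mult_INR, <- INR_IZR_INZ. simpl. field.
Qed.

Lemma osc_cos_2x : exists C, 0 <= C /\ forall a, 1 <= IZR (2 * a + 1) ->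
  Rabs (osc (fun x => G x * cos (2 * x)) (IZR (2 * a + 1)) 0)
  <= C / IZR (2 * a + 1) ^ (q + 1).
Proof using HG.
  assert (Hpi := PI2_pos).
  destruct HG as [Go [Ge [HS HV]]].
  destruct (weighted_osc_decay G Go Ge q HS HV (fun x => cos (2 * x)) 0 1 1)
    as [C [HC0 HC]].
  - apply smooth_ext with (fun x => 2 * (cos x * cos x) - 1).
    + intros x _. rewrite cos_2a_cos. ring.
    + apply smooth_minus; [|apply smooth_const].
      apply smooth_scal, smooth_mult; apply smooth_cos.
  - exact I.
  - intros x. rewrite !cos_2a_cos, cos_neg. ring.
  - intros x. rewrite !cos_2a_cos, cos_minus, cos_PI, sin_PI. ring.
  - exists C. split; [exact HC0|]. intros a Ha.
    replace (q + 1)%nat with (S (q + 0)) by lia. apply HC; [exact Ha| |].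
    + intros l. destruct (pow_neg_1_cases l) as [[m [Hl El]]|[m [Hl El]]].
      * left. lra.
      * right. apply (sin_PI_IZR (a + Z.of_nat m + 1)).
        rewrite Hl, plus_INR, mult_INR, !plus_IZR, mult_IZR, <- INR_IZR_INZ. simpl. field.
    + intros l. destruct (pow_neg_1_cases l) as [[m [Hl El]]|[m [Hl El]]].
      * right. apply (sin_PI_IZR (Z.of_nat m)).
        rewrite Hl, mult_INR, <- INR_IZR_INZ. simpl. field.
      * left. lra.
Qed.

Lemma osc_cos3 : exists C, 0 <= C /\ forall a, 1 <= IZR (2 * a) ->
  Rabs (osc (fun x => G x * cos x ^ 3) (IZR (2 * a)) 0) <= C / IZR (2 * a) ^ (q + 4).
Proof using HG.
  destruct HG as [Go [Ge [HS HV]]].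
  destruct (weighted_osc_decay G Go Ge q HS HV (fun x => cos x ^ 3) 3 1 (-1))
    as [C [HC0 HC]].
  - apply smooth_cos_pow.
  - apply vanish_cos_pow.
  - intros x. rewrite cos_neg. ring.
  - intros x. rewrite cos_minus, cos_PI, sin_PI. ring.
  - exists C. split; [exact HC0|]. intros a Ha.
    replace (q + 4)%nat with (S (q + 3)) by lia. apply HC; [exact Ha| |].
    + intros l. destruct (pow_neg_1_cases l) as [[m [Hl El]]|[m [Hl El]]].
      * right. apply (sin_PI_IZR (a + Z.of_nat m)).
        rewrite Hl, mult_INR, !plus_IZR, mult_IZR, <- INR_IZR_INZ. simpl. field.
      * left. lra.
    + intros l. destruct (pow_neg_1_cases l) as [[m [Hl El]]|[m [Hl El]]].
      * right. apply (sin_PI_IZR (Z.of_nat m)).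
        rewrite Hl, mult_INR, <- INR_IZR_INZ. simpl. field.
      * left. lra.
Qed.

End Elementary_oscillations.

(** * Weighted triple products *)

(** [g i] divided by [amp i]. *)
Definition unit_g (i : nat) (x : R) : R :=
  cos x ^ 2 * cos (omega i * x)
  - 3 / 4 * (cos ((omega i + 2) * x) / (omega i + 2)
             - cos ((omega i - 2) * x) / (omega i - 2)).

Lemma unit_g_abs_le (i : nat) (x : R) : Rabs (unit_g i x) <= 3.
Proof.
  assert (H3 := omega_ge_3 i). unfold unit_g.
  assert (C1 := COS_bound (omega i * x)).
  assert (C2 := COS_bound ((omega i + 2) * x)).
  assert (C3 := COS_bound ((omega i - 2) * x)).
  assert (C4 := COS_bound x).
  assert (Hdiv : forall c d, -1 <= c <= 1 -> 1 <= d -> -1 <= c / d <= 1).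
  { intros c d Hc Hd. assert (D0 : 0 < / d) by (apply Rinv_0_lt_compat; lra).
    assert (D1 : / d <= 1) by (rewrite <- Rinv_1; apply Rinv_le_contravar; lra).
    unfold Rdiv. nra. }
  assert (D2 := Hdiv _ (omega i + 2) C2 ltac:(lra)).
  assert (D3 := Hdiv _ (omega i - 2) C3 ltac:(lra)).
  set (c := cos x) in *. set (d := cos (omega i * x)) in *.
  assert (0 <= c ^ 2 <= 1) by nra.
  apply Rabs_le. nra.
Qed.

Lemma continuous_unit_g (i : nat) (x : R) : continuous (unit_g i) x.
Proof.
  assert (H3 := omega_ge_3 i).
  apply (ex_derive_continuous (unit_g i)). unfold unit_g. auto_derive. auto.
Qed.

Lemma continuous_weighted (q : nat) (G w : R -> R) (x : R) :
  weight q G -> (forall y, continuous w y) -> 0 <= x <= PI / 2 ->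
  continuous (fun x => G x * w x) x.
Proof.
  intros [Go [Ge [HS _]]] Hw Hx. assert (Hpi := PI2_pos).
  apply (continuous_mult G); [|apply Hw].
  apply (smooth_continuous (- PI) PI); [apply (split_smooth _ _ _ HS)|lra].
Qed.

Lemma weighted_osc_integrable (q : nat) (G w : R -> R) (A phi : R) :
  weight q G -> (forall y, continuous w y) ->
  ex_RInt (fun x => G x * w x * cos (A * x + phi)) 0 (PI / 2).
Proof.
  intros HG Hw. assert (Hpi := PI2_pos).
  apply (ex_RInt_continuous (fun x => G x * w x * cos (A * x + phi))).
  intros z. rewrite Rmin_left, Rmax_right by lra. intros Hz.
  apply (continuous_mult (fun x => G x * w x));
    [apply (continuous_weighted q); assumption|apply continuous_cos_affine].
Qed.

Lemma decay_le (C A m : R) (n : nat) : 0 <= C -> 1 <= m -> m <= A -> C / A ^ n <= C / m ^ n.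
Proof.
  intros HC Hm HA. apply Rmult_le_compat_l; [exact HC|].
  apply Rinv_le_contravar; [apply pow_lt; lra|]. apply pow_incr. lra.
Qed.

Lemma RInt_lin2 (f1 f2 : R -> R) (c1 c2 : R) :
  ex_RInt f1 0 (PI / 2) -> ex_RInt f2 0 (PI / 2) ->
  RInt (fun x => c1 * f1 x + c2 * f2 x) 0 (PI / 2)
  = c1 * RInt f1 0 (PI / 2) + c2 * RInt f2 0 (PI / 2).
Proof.
  intros H1 H2. apply (is_RInt_unique (V := R_CompleteNormedModule)).
  apply (is_RInt_plus (V := R_NormedModule) (fun x => c1 * f1 x) (fun x => c2 * f2 x)).
  - apply (is_RInt_scal (V := R_NormedModule) f1), (RInt_correct f1), H1.
  - apply (is_RInt_scal (V := R_NormedModule) f2), (RInt_correct f2), H2.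
Qed.

Lemma RInt_lin3 (f1 f2 f3 : R -> R) (c1 c2 c3 : R) :
  ex_RInt f1 0 (PI / 2) -> ex_RInt f2 0 (PI / 2) -> ex_RInt f3 0 (PI / 2) ->
  RInt (fun x => c1 * f1 x + c2 * f2 x + c3 * f3 x) 0 (PI / 2)
  = c1 * RInt f1 0 (PI / 2) + c2 * RInt f2 0 (PI / 2) + c3 * RInt f3 0 (PI / 2).
Proof.
  intros H1 H2 H3. rewrite <- (RInt_lin2 f1 f2) by assumption.
  apply (is_RInt_unique (V := R_CompleteNormedModule)).
  apply (is_RInt_plus (V := R_NormedModule) (fun x => c1 * f1 x + c2 * f2 x)
           (fun x => c3 * f3 x)).
  - apply (RInt_correct (fun x => c1 * f1 x + c2 * f2 x)).
    apply (ex_RInt_plus (V := R_NormedModule) (fun x => c1 * f1 x) (fun x => c2 * f2 x)).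
    + apply (ex_RInt_scal (V := R_NormedModule) f1), H1.
    + apply (ex_RInt_scal (V := R_NormedModule) f2), H2.
  - apply (is_RInt_scal (V := R_NormedModule) f3), (RInt_correct f3), H3.
Qed.

Section Triple_products.

Context (q : nat) (G : R -> R) (HG : weight q G).

(** The integral of [G] against a single frequency of [unit_g i * cos (2 n x)], where
    [A = omega i + 2 n] or [A = omega i - 2 n]: the two fractions in [unit_g] are put
    over the common denominator [omega i ^ 2 - 4], which exhibits their cancellation. *)
Definition g_kernel (i : nat) (A : R) : R :=
  osc (fun x => G x * cos x ^ 2) A 0
  + 3 * omega i / (omega i ^ 2 - 4) * osc (fun x => G x * (sin x * cos x)) A (- (PI / 2))
  + 3 / (omega i ^ 2 - 4) * osc (fun x => G x * cos (2 * x)) A 0.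

Lemma g_kernel_RInt (i : nat) (A : R) :
  g_kernel i A = RInt (fun x => G x *
    (cos x ^ 2 * cos (A * x)
     - 3 / 4 * (cos ((A + 2) * x) / (omega i + 2) - cos ((A - 2) * x) / (omega i - 2))))
    0 (PI / 2).
Proof using HG.
  assert (H3 := omega_ge_3 i).
  unfold g_kernel, osc. set (w := omega i) in *.
  rewrite <- (Rmult_1_l (RInt (fun x => G x * cos x ^ 2 * cos (A * x + 0)) 0 (PI / 2))).
  rewrite <- (RInt_lin3 (fun x => G x * cos x ^ 2 * cos (A * x + 0))
                (fun x => G x * (sin x * cos x) * cos (A * x + - (PI / 2)))
                (fun x => G x * cos (2 * x) * cos (A * x + 0))).
  - apply RInt_ext_quarter. intros x _.
    rewrite Rplus_0_r.
    replace (cos (A * x + - (PI / 2))) with (sin (A * x)).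
    2: { rewrite <- cos_shift, <- cos_neg. f_equal. ring. }
    replace ((A + 2) * x) with (A * x + 2 * x) by ring.
    replace ((A - 2) * x) with (A * x - 2 * x) by ring.
    rewrite cos_plus, cos_minus, sin_2a. field. nra.
  - apply (weighted_osc_integrable q); [exact HG|].
    intros y. apply (ex_derive_continuous (fun x => cos x ^ 2)). auto_derive. auto.
  - apply (weighted_osc_integrable q); [exact HG|].
    intros y. apply (ex_derive_continuous (fun x => sin x * cos x)). auto_derive. auto.
  - apply (weighted_osc_integrable q); [exact HG|].
    intros y. apply (ex_derive_continuous (fun x => cos (2 * x))). auto_derive. auto.
Qed.

(** The second and third parts of [g_kernel] decay more slowly in [A], but carry
    factors [1 / omega i] and [1 / omega i ^ 2], and [A <= 2 omega i]. *)
Lemma g_kernel_decay : exists C, 0 <= C /\ forall i a,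
  1 <= IZR (2 * a + 1) -> IZR (2 * a + 1) <= 2 * omega i ->
  Rabs (g_kernel i (IZR (2 * a + 1))) <= C / IZR (2 * a + 1) ^ (q + 3).
Proof using HG.
  destruct (osc_cos2 q G HG) as [C1 [P1 B1]].
  destruct (osc_sin_cos q G HG) as [C2 [P2 B2]].
  destruct (osc_cos_2x q G HG) as [C3 [P3 B3]].
  exists (C1 + 12 * C2 + 24 * C3). split; [lra|].
  intros i a Ha1 Ha2. assert (H3 := omega_ge_3 i).
  specialize (B1 a Ha1). specialize (B2 a Ha1). specialize (B3 a Ha1).
  unfold g_kernel. set (A := IZR (2 * a + 1)) in *. set (w := omega i) in *.
  assert (Aq : 0 < A ^ q) by (apply pow_lt; lra).
  rewrite pow_add in B1, B2, B3 |- *.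
  assert (W : 0 < w ^ 2 - 4) by nra.
  assert (F2 : 3 * w / (w ^ 2 - 4) <= 12 / A).
  { apply Rmult_le_reg_r with ((w ^ 2 - 4) * A); [apply Rmult_lt_0_compat; lra|].
    replace (3 * w / (w ^ 2 - 4) * ((w ^ 2 - 4) * A)) with (3 * w * A) by (field; lra).
    replace (12 / A * ((w ^ 2 - 4) * A)) with (12 * (w ^ 2 - 4)) by (field; lra).
    nra. }
  assert (F3 : 3 / (w ^ 2 - 4) <= 24 / A ^ 2).
  { apply Rmult_le_reg_r with ((w ^ 2 - 4) * A ^ 2); [apply Rmult_lt_0_compat; nra|].
    replace (3 / (w ^ 2 - 4) * ((w ^ 2 - 4) * A ^ 2)) with (3 * A ^ 2) by (field; lra).
    replace (24 / A ^ 2 * ((w ^ 2 - 4) * A ^ 2)) with (24 * (w ^ 2 - 4)) by (field; lra).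
    nra. }
  assert (F2' : 0 <= 3 * w / (w ^ 2 - 4)) by (apply Rmult_le_pos; [lra|left; apply Rinv_0_lt_compat; lra]).
  assert (F3' : 0 <= 3 / (w ^ 2 - 4)) by (apply Rmult_le_pos; [lra|left; apply Rinv_0_lt_compat; lra]).
  apply Rle_trans with (1 := Rabs_triang _ _).
  apply Rle_trans with (1 := Rplus_le_compat_r _ _ _ (Rabs_triang _ _)).
  rewrite !Rabs_mult, (Rabs_pos_eq (3 * w / (w ^ 2 - 4))), (Rabs_pos_eq (3 / (w ^ 2 - 4)))
    by assumption.
  replace ((C1 + 12 * C2 + 24 * C3) / (A ^ q * A ^ 3)) with
    (C1 / (A ^ q * A ^ 3) + 12 / A * (C2 / (A ^ q * A ^ 2))
     + 24 / A ^ 2 * (C3 / (A ^ q * A ^ 1))) by (field; lra).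
  apply Rplus_le_compat; [apply Rplus_le_compat|].
  - exact B1.
  - apply Rmult_le_compat; [exact F2'|apply Rabs_pos|exact F2|exact B2].
  - apply Rmult_le_compat; [exact F3'|apply Rabs_pos|exact F3|exact B3].
Qed.

Lemma freq_bounds (i M : nat) (n : Z) :
  (Z.abs n <= Z.of_nat M)%Z -> (M < deg i)%nat ->
  1 <= omega i - INR M /\ omega i - INR M <= omega i + IZR n <= 2 * omega i.
Proof.
  intros Hn HM. rewrite omega_deg, !INR_IZR_INZ.
  rewrite <- minus_IZR, <- plus_IZR, <- mult_IZR.
  repeat split; apply IZR_le; lia.
Qed.

Lemma omega_odd (i : nat) (n : Z) :
  omega i + IZR (2 * n) = IZR (2 * (Z.of_nat i + 1 + n) + 1).
Proof.
  rewrite omega_deg, INR_IZR_INZ, <- plus_IZR. f_equal. unfold deg. lia.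
Qed.

Lemma triple_product_g : exists C, 0 <= C /\ forall M B h i,
  (M < deg i)%nat -> bounded_comb (cos_even M) B h ->
  Rabs (RInt (fun x => G x * unit_g i x * h x) 0 (PI / 2))
  <= B * (C / (omega i - INR M) ^ (q + 3)).
Proof using HG.
  destruct g_kernel_decay as [C [HC0 HC]]. exists C. split; [exact HC0|].
  intros M B h i HM Hh.
  apply (bcomb_RInt_le (cos_even M) B h (fun x => G x * unit_g i x)); [| | |exact Hh].
  - apply cos_even_continuous.
  - intros x Hx. apply (continuous_weighted q); [exact HG|apply continuous_unit_g|exact Hx].
  - intros p [n [Hn Hp]].
    (* the product of [cos (2 n x)] with [cos] of frequency [omega i + d] averages
       the frequencies [omega i + 2 n + d] and [omega i - 2 n + d] *)
    assert (E : RInt (fun x => G x * unit_g i x * p x) 0 (PI / 2)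
                = 1 / 2 * g_kernel i (omega i + IZR (2 * n))
                  + 1 / 2 * g_kernel i (omega i + IZR (2 * - n))).
    { rewrite !g_kernel_RInt.
      rewrite <- RInt_lin2.
      - apply RInt_ext_quarter. intros x _. rewrite Hp. unfold unit_g.
        replace (2 * - n)%Z with (- (2 * n))%Z by lia. rewrite opp_IZR.
        set (N := IZR (2 * n)). set (w := omega i).
        replace ((w + N) * x) with (w * x + N * x) by ring.
        replace ((w + - N) * x) with (w * x - N * x) by ring.
        replace ((w + N + 2) * x) with ((w + 2) * x + N * x) by ring.
        replace ((w + - N + 2) * x) with ((w + 2) * x - N * x) by ring.
        replace ((w + N - 2) * x) with ((w - 2) * x + N * x) by ring.
        replace ((w + - N - 2) * x) with ((w - 2) * x - N * x) by ring.
        rewrite !(cos_plus _ (N * x)), !(cos_minus _ (N * x)).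
        assert (H3 := omega_ge_3 i). fold w in H3. field. lra.
      - apply (ex_RInt_continuous (V := R_CompleteNormedModule)).
        assert (Hpi := PI2_pos).
        intros z. rewrite Rmin_left, Rmax_right by lra. intros Hz.
        apply (continuous_weighted q G (fun x => cos x ^ 2 * cos ((omega i + IZR (2 * n)) * x) - _));
          [exact HG| |exact Hz].
        intros y. assert (H3 := omega_ge_3 i).
        apply (ex_derive_continuous (K := R_AbsRing) (V := R_NormedModule)). auto_derive. auto.
      - apply (ex_RInt_continuous (V := R_CompleteNormedModule)).
        assert (Hpi := PI2_pos).
        intros z. rewrite Rmin_left, Rmax_right by lra. intros Hz.
        apply (continuous_weighted q G (fun x => cos x ^ 2 * cos ((omega i + IZR (2 * - n)) * x) - _));
          [exact HG| |exact Hz].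
        intros y. assert (H3 := omega_ge_3 i).
        apply (ex_derive_continuous (K := R_AbsRing) (V := R_NormedModule)). auto_derive. auto. }
    rewrite E.
    assert (Hb : forall z, (Z.abs (2 * z) <= Z.of_nat M)%Z ->
              Rabs (g_kernel i (omega i + IZR (2 * z))) <= C / (omega i - INR M) ^ (q + 3)).
    { intros z Hz. destruct (freq_bounds i M (2 * z) Hz HM) as [F1 [F2 F3]].
      rewrite (omega_odd i z) in F2, F3 |- *.
      apply Rle_trans with (1 := HC i (Z.of_nat i + 1 + z)%Z (Rle_trans _ _ _ F1 F2) F3). apply decay_le; lra. }
    assert (B1 := Hb n Hn). assert (B2 := Hb (- n)%Z ltac:(lia)).
    apply Rle_trans with (1 := Rabs_triang _ _).
    rewrite !Rabs_mult, (Rabs_pos_eq (1 / 2)) by lra. lra.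
Qed.

Lemma triple_product_g_trivial : exists C, 0 <= C /\ forall M B h i,
  bounded_comb (cos_even M) B h ->
  Rabs (RInt (fun x => G x * unit_g i x * h x) 0 (PI / 2)) <= B * C.
Proof using HG.
  destruct (bounded_on_quarter_period G) as [K [K0 HK]].
  { intros x Hx. destruct HG as [Go [Ge [HS _]]]. assert (Hpi := PI2_pos).
    apply (smooth_continuous (- PI) PI); [apply (split_smooth _ _ _ HS)|lra]. }
  exists (2 * (K * 3)). split; [lra|]. intros M B h i Hh.
  apply (bcomb_RInt_le (cos_even M) B h (fun x => G x * unit_g i x)); [| | |exact Hh].
  - apply cos_even_continuous.
  - intros x Hx. apply (continuous_weighted q); [exact HG|apply continuous_unit_g|exact Hx].
  - intros p Hp. apply abs_RInt_le_sup.
    + intros x Hx. apply (continuous_mult (fun x => G x * unit_g i x)).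
      * apply (continuous_weighted q); [exact HG|apply continuous_unit_g|exact Hx].
      * apply cos_even_continuous with (1 := Hp).
    + intros x Hx. rewrite !Rabs_mult.
      assert (H1 := HK x Hx). assert (H2 := unit_g_abs_le i x).
      assert (H3 := cos_even_abs_le M p Hp x).
      assert (P1 := Rabs_pos (G x)). assert (P2 := Rabs_pos (unit_g i x)).
      assert (P3 := Rabs_pos (p x)).
      apply Rle_trans with (K * 3 * 1); [|lra].
      apply Rmult_le_compat; try assumption; [apply Rmult_le_pos; assumption|].
      apply Rmult_le_compat; assumption.
Qed.

Lemma cos2_cos_decay : exists C, 0 <= C /\ forall M B h i,
  (M < deg i)%nat -> bounded_comb (cos_even M) B h ->
  Rabs (RInt (fun x => G x * (cos x ^ 2 * cos (omega i * x)) * h x) 0 (PI / 2))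
  <= B * (C / (omega i - INR M) ^ (q + 3)).
Proof using HG.
  destruct (osc_cos2 q G HG) as [C [HC0 HC]]. exists C. split; [exact HC0|].
  intros M B h i HM Hh.
  assert (Hc2 : forall y, continuous (fun x => cos x ^ 2) y).
  { intros y. apply (ex_derive_continuous (fun x => cos x ^ 2)). auto_derive. auto. }
  apply (bcomb_RInt_le (cos_even M) B h (fun x => G x * (cos x ^ 2 * cos (omega i * x))));
    [| | |exact Hh].
  - apply cos_even_continuous.
  - intros x Hx. apply (continuous_weighted q); [exact HG| |exact Hx].
    intros y. apply (ex_derive_continuous (fun x => cos x ^ 2 * cos (omega i * x))).
    auto_derive. auto.
  - intros p [n [Hn Hp]].
    assert (E : RInt (fun x => G x * (cos x ^ 2 * cos (omega i * x)) * p x) 0 (PI / 2)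
                = 1 / 2 * osc (fun x => G x * cos x ^ 2) (omega i + IZR (2 * n)) 0
                  + 1 / 2 * osc (fun x => G x * cos x ^ 2) (omega i + IZR (2 * - n)) 0).
    { unfold osc. rewrite <- RInt_lin2.
      - apply RInt_ext_quarter. intros x _. rewrite Hp.
        replace (2 * - n)%Z with (- (2 * n))%Z by lia. rewrite opp_IZR, !Rplus_0_r.
        set (N := IZR (2 * n)). set (w := omega i).
        replace ((w + N) * x) with (w * x + N * x) by ring.
        replace ((w + - N) * x) with (w * x - N * x) by ring.
        rewrite cos_plus, cos_minus. field.
      - apply (weighted_osc_integrable q); assumption.
      - apply (weighted_osc_integrable q); assumption. }
    rewrite E.
    assert (Hb : forall z, (Z.abs (2 * z) <= Z.of_nat M)%Z ->
              Rabs (osc (fun x => G x * cos x ^ 2) (omega i + IZR (2 * z)) 0)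
              <= C / (omega i - INR M) ^ (q + 3)).
    { intros z Hz. destruct (freq_bounds i M (2 * z) Hz HM) as [F1 [F2 F3]].
      rewrite (omega_odd i z) in F2, F3 |- *.
      apply Rle_trans with (1 := HC (Z.of_nat i + 1 + z)%Z (Rle_trans _ _ _ F1 F2)). apply decay_le; lra. }
    assert (B1 := Hb n Hn). assert (B2 := Hb (- n)%Z ltac:(lia)).
    apply Rle_trans with (1 := Rabs_triang _ _).
    rewrite !Rabs_mult, (Rabs_pos_eq (1 / 2)) by lra. lra.
Qed.

Lemma cos3_sin_decay : exists C, 0 <= C /\ forall M B h i,
  (M < deg i)%nat -> bounded_comb (sin_odd M) B h ->
  Rabs (RInt (fun x => G x * (cos x ^ 3 * sin (omega i * x)) * h x) 0 (PI / 2))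
  <= B * (C / (omega i - INR M) ^ (q + 3)).
Proof using HG.
  destruct (osc_cos3 q G HG) as [C [HC0 HC]]. exists C. split; [exact HC0|].
  intros M B h i HM Hh.
  assert (Hc3 : forall y, continuous (fun x => cos x ^ 3) y).
  { intros y. apply (ex_derive_continuous (fun x => cos x ^ 3)). auto_derive. auto. }
  apply (bcomb_RInt_le (sin_odd M) B h (fun x => G x * (cos x ^ 3 * sin (omega i * x))));
    [| | |exact Hh].
  - apply sin_odd_continuous.
  - intros x Hx. apply (continuous_weighted q); [exact HG| |exact Hx].
    intros y. apply (ex_derive_continuous (fun x => cos x ^ 3 * sin (omega i * x))).
    auto_derive. auto.
  - intros p [n [Hn Hp]].
    assert (E : RInt (fun x => G x * (cos x ^ 3 * sin (omega i * x)) * p x) 0 (PI / 2)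
                = - (1 / 2) * osc (fun x => G x * cos x ^ 3) (omega i + IZR (2 * n + 1)) 0
                  + 1 / 2 * osc (fun x => G x * cos x ^ 3) (omega i + IZR (- (2 * n + 1))) 0).
    { unfold osc. rewrite <- RInt_lin2.
      - apply RInt_ext_quarter. intros x _. rewrite Hp.
        rewrite opp_IZR, !Rplus_0_r.
        set (N := IZR (2 * n + 1)). set (w := omega i).
        replace ((w + N) * x) with (w * x + N * x) by ring.
        replace ((w + - N) * x) with (w * x - N * x) by ring.
        rewrite cos_plus, cos_minus. field.
      - apply (weighted_osc_integrable q); assumption.
      - apply (weighted_osc_integrable q); assumption. }
    rewrite E.
    assert (Hb : forall z, (Z.abs z <= Z.of_nat M)%Z -> (exists y, z = 2 * y + 1)%Z ->
              Rabs (osc (fun x => G x * cos x ^ 3) (omega i + IZR z) 0)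
              <= C / (omega i - INR M) ^ (q + 3)).
    { intros z Hz [y Hy]. destruct (freq_bounds i M z Hz HM) as [F1 [F2 F3]].
      assert (Hev : omega i + IZR z = IZR (2 * (Z.of_nat i + 2 + y))).
      { rewrite omega_deg, INR_IZR_INZ, <- plus_IZR. f_equal. unfold deg. lia. }
      rewrite Hev in F2, F3 |- *.
      apply Rle_trans with (1 := HC (Z.of_nat i + 2 + y)%Z (Rle_trans _ _ _ F1 F2)).
      apply Rle_trans with (C / (omega i - INR M) ^ (q + 4)); [apply decay_le; lra|].
      replace (q + 4)%nat with (S (q + 3)) by lia.
      apply Rmult_le_compat_l; [exact HC0|]. apply Rinv_le_contravar; [apply pow_lt; lra|].
      simpl pow. assert (0 < (omega i - INR M) ^ (q + 3)) by (apply pow_lt; lra). nra. }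
    assert (B1 := Hb (2 * n + 1)%Z Hn ltac:(exists n; reflexivity)).
    assert (B2 := Hb (- (2 * n + 1))%Z ltac:(lia) ltac:(exists (- n - 1)%Z; lia)).
    apply Rle_trans with (1 := Rabs_triang _ _).
    rewrite !Rabs_mult, Rabs_Ropp, (Rabs_pos_eq (1 / 2)) by lra. lra.
Qed.

(** The oscillating part of [tan_e'] is treated like [g]. In the other part
    [cos x / sin x * sin (omega i x)] the singular quotient is moved onto [h],
    at the cost of a factor [M] that is compensated by the missing [omega i]. *)
Lemma triple_product_e' : exists C, 0 <= C /\ forall M B h i,
  (1 <= M < deg i)%nat -> bounded_comb (cos_even M) B h -> h 0 = 0 ->
  Rabs (RInt (fun x => G x * (cos x ^ 2 * tan_e' i x) * h x) 0 (PI / 2))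
  <= B * (C / (omega i - INR M) ^ (q + 3)).
Proof using HG.
  destruct cos2_cos_decay as [C1 [P1 HC1]]. destruct cos3_sin_decay as [C2 [P2 HC2]].
  assert (K0 := mode_bound_pos).
  exists (mode_bound * (C1 + C2)). split; [apply Rmult_le_pos; lra|].
  intros M B h i [HM1 HM] Hh H0.
  destruct (bcomb_quotient_sin M B h HM1 Hh) as [r [Hr Er]].
  assert (Hpi := PI2_pos).
  destruct (amp_bounds i) as [A0 _]. assert (A1 := amp_omega_le i).
  assert (H3 := omega_ge_3 i).
  assert (Hch := bcomb_continuous _ _ _ (cos_even_continuous M) Hh).
  assert (Hcr := bcomb_continuous _ _ _ (sin_odd_continuous M) Hr).
  assert (E : RInt (fun x => G x * (cos x ^ 2 * tan_e' i x) * h x) 0 (PI / 2)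
    = amp i * omega i * RInt (fun x => G x * (cos x ^ 2 * cos (omega i * x)) * h x) 0 (PI / 2)
      + - amp i * RInt (fun x => G x * (cos x ^ 3 * sin (omega i * x)) * r x) 0 (PI / 2)).
  { rewrite <- RInt_lin2.
    - apply RInt_ext_quarter. intros x Hx.
      rewrite <- tan_e'_dirichlet by exact Hx.
      assert (Eh : h x = sin x * r x) by (rewrite <- Er, H0; ring). rewrite Eh.
      destruct (sin_cos_pos x Hx) as [S0 _]. field. lra.
    - apply (ex_RInt_continuous (fun x => G x * (cos x ^ 2 * cos (omega i * x)) * h x)).
      intros z. rewrite Rmin_left, Rmax_right by lra. intros Hz.
      apply (continuous_mult (fun x => G x * (cos x ^ 2 * cos (omega i * x)))); [|apply Hch].
      apply (continuous_weighted q); [exact HG| |exact Hz].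
      intros y. apply (ex_derive_continuous (fun x => cos x ^ 2 * cos (omega i * x))).
      auto_derive. auto.
    - apply (ex_RInt_continuous (fun x => G x * (cos x ^ 3 * sin (omega i * x)) * r x)).
      intros z. rewrite Rmin_left, Rmax_right by lra. intros Hz.
      apply (continuous_mult (fun x => G x * (cos x ^ 3 * sin (omega i * x)))); [|apply Hcr].
      apply (continuous_weighted q); [exact HG| |exact Hz].
      intros y. apply (ex_derive_continuous (fun x => cos x ^ 3 * sin (omega i * x))).
      auto_derive. auto. }
  rewrite E.
  assert (B1 := HC1 M B h i HM Hh). assert (B2 := HC2 M _ r i HM Hr).
  assert (HB := bcomb_nonneg _ _ _ Hh).
  assert (HMw : INR M <= omega i) by (rewrite omega_deg; apply le_INR; lia).
  destruct (freq_bounds i M 0 ltac:(lia) HM) as [F1 _].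
  assert (Dp : 0 < (omega i - INR M) ^ (q + 3)) by (apply pow_lt; lra).
  set (D := / (omega i - INR M) ^ (q + 3)).
  assert (D0 : 0 < D) by (apply Rinv_0_lt_compat, Dp).
  unfold Rdiv in *. fold D in B1, B2 |- *.
  apply Rle_trans with (1 := Rabs_triang _ _).
  rewrite !Rabs_mult, Rabs_Ropp, (Rabs_pos_eq (amp i)), (Rabs_pos_eq (omega i)) by lra.
  apply Rle_trans with
    (amp i * omega i * (B * (C1 * D)) + amp i * (B * INR M * (C2 * D))).
  - apply Rplus_le_compat; apply Rmult_le_compat_l; try assumption; [|lra].
    apply Rmult_le_pos; lra.
  - apply Rle_trans with (amp i * omega i * (B * ((C1 + C2) * D))).
    + assert (Q : 0 <= amp i * (B * (C2 * D))).
      { apply Rmult_le_pos; [lra|]. apply Rmult_le_pos; [exact HB|].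
        apply Rmult_le_pos; lra. }
      assert (amp i * (B * (C2 * D)) * INR M <= amp i * (B * (C2 * D)) * omega i)
        by (apply Rmult_le_compat_l; assumption).
      lra.
    + replace (B * (mode_bound * (C1 + C2) * D)) with (mode_bound * (B * ((C1 + C2) * D))) by ring.
      apply Rmult_le_compat_r; [|nra].
      apply Rmult_le_pos; [exact HB|]. apply Rmult_le_pos; lra.
Qed.

Lemma triple_product_e'_trivial : exists C, 0 <= C /\ forall M B h i,
  bounded_comb (cos_even M) B h ->
  Rabs (RInt (fun x => G x * (cos x ^ 2 * tan_e' i x) * h x) 0 (PI / 2)) <= B * C.
Proof using HG.
  destruct (bounded_on_quarter_period G) as [K [K0 HK]].
  { intros x Hx. destruct HG as [Go [Ge [HS _]]]. assert (Hpi := PI2_pos).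
    apply (smooth_continuous (- PI) PI); [apply (split_smooth _ _ _ HS)|lra]. }
  assert (B0 := mode_bound_pos).
  exists (2 * (K * mode_bound)). split; [assert (0 <= K * mode_bound) by (apply Rmult_le_pos; lra); lra|].
  intros M B h i Hh.
  assert (Hce := bcomb_continuous _ _ _ (cos_odd_continuous _) (bcomb_tan_e' i)).
  assert (Hbe := bcomb_abs_le _ _ _ (cos_odd_abs_le _) (bcomb_tan_e' i)).
  assert (Hcw : forall y, continuous (fun x => cos x ^ 2 * tan_e' i x) y).
  { intros y. apply (continuous_mult (fun x => cos x ^ 2)); [|apply Hce].
    apply (ex_derive_continuous (fun x => cos x ^ 2)). auto_derive. auto. }
  apply (bcomb_RInt_le (cos_even M) B h (fun x => G x * (cos x ^ 2 * tan_e' i x)));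
    [| | |exact Hh].
  - apply cos_even_continuous.
  - intros x Hx. apply (continuous_weighted q); assumption.
  - intros p Hp. apply abs_RInt_le_sup.
    + intros x Hx. apply (continuous_mult (fun x => G x * (cos x ^ 2 * tan_e' i x))).
      * apply (continuous_weighted q); assumption.
      * apply cos_even_continuous with (1 := Hp).
    + intros x Hx. rewrite !Rabs_mult.
      assert (H1 := HK x Hx). assert (H2 := Hbe x).
      assert (H3 := cos_even_abs_le M p Hp x).
      assert (H4 : Rabs (cos x ^ 2) <= 1).
      { apply Rabs_le. assert (Hc := COS_bound x). nra. }
      assert (P1 := Rabs_pos (G x)). assert (P2 := Rabs_pos (tan_e' i x)).
      assert (P3 := Rabs_pos (p x)). assert (P4 := Rabs_pos (cos x ^ 2)).
      apply Rle_trans with (K * (1 * mode_bound) * 1); [|lra].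
      apply Rmult_le_compat; try assumption.
      * apply Rmult_le_pos; [|apply Rmult_le_pos]; assumption.
      * apply Rmult_le_compat; try assumption; [apply Rmult_le_pos; assumption|].
        apply Rmult_le_compat; assumption.
Qed.

End Triple_products.

Lemma cos_odd_half_PI (m : nat) : cos ((2 * INR m + 1) * (PI / 2)) = 0.
Proof.
  replace ((2 * INR m + 1) * (PI / 2)) with (INR m * PI + PI / 2) by field.
  rewrite cos_plus, cos_PI2, sin_PI2, sin_PI_INR. ring.
Qed.

Lemma unit_g_half_PI (i : nat) : unit_g i (PI / 2) = 0.
Proof.
  unfold unit_g. rewrite cos_PI2.
  replace (omega i + 2) with (2 * INR (i + 2) + 1)
    by (unfold omega; rewrite plus_INR; simpl; ring).
  replace (omega i - 2) with (2 * INR i + 1) by (unfold omega; ring).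
  rewrite !cos_odd_half_PI. unfold Rdiv. ring.
Qed.

Lemma is_derive_unit_g (i : nat) (x : R) :
  is_derive (fun y => - amp i * unit_g i y) x
    (amp i * (omega i * cos x ^ 2 * sin (omega i * x) - sin x * cos x * cos (omega i * x))).
Proof.
  assert (H3 := omega_ge_3 i). unfold unit_g. auto_derive; [auto|].
  set (w := omega i) in *.
  replace ((w + 2) * x) with (w * x + 2 * x) by ring.
  replace ((w - 2) * x) with (w * x - 2 * x) by ring.
  rewrite sin_plus, sin_minus, sin_2a. field. lra.
Qed.

Lemma g_closed_form (i : nat) (x : R) : 0 < x < PI / 2 -> g i x = amp i * unit_g i x.
Proof.
  intros Hx. unfold g.
  assert (H : is_RInt (fun y => amp i * (omega i * cos y ^ 2 * sin (omega i * y)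
                               - sin y * cos y * cos (omega i * y))) x (PI / 2)
                (minus (- amp i * unit_g i (PI / 2)) (- amp i * unit_g i x))).
  { apply (is_RInt_derive (fun y => - amp i * unit_g i y)).
    - intros y _. apply is_derive_unit_g.
    - intros y _. apply (ex_derive_continuous (K := R_AbsRing) (V := R_NormedModule)).
      auto_derive. auto. }
  transitivity (RInt (fun y => amp i * (omega i * cos y ^ 2 * sin (omega i * y)
                               - sin y * cos y * cos (omega i * y))) x (PI / 2)).
  - apply RInt_ext. rewrite Rmin_left, Rmax_right by lra. intros y Hy.
    destruct (sin_cos_pos y ltac:(lra)) as [S0 C0].
    rewrite e_closed_form by lra.
    change (amp i * (omega i * (cos y / sin y) * sin (omega i * y) - cos (omega i * y))
       * sin y * cos y = amp i * (omega i * cos y ^ 2 * sin (omega i * y)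
                               - sin y * cos y * cos (omega i * y)) :> R).
    field. lra.
  - rewrite (is_RInt_unique (V := R_CompleteNormedModule) _ _ _ _ H).
    rewrite unit_g_half_PI. unfold minus, plus, opp; simpl. ring.
Qed.

(** ** The weights of the Fourier constants *)

Lemma weight_odd (G : R -> R) (q : nat) :
  smooth (- PI) PI G -> (forall x, G (- x) = G x) -> (forall x, G (PI - x) = - G x) ->
  weight q G.
Proof.
  intros HG He Ho. assert (Hpi := PI2_pos).
  exists G, (fun _ => 0). split; [|apply vanish_zero].
  split; auto.
  - apply (smooth_sub (- PI) PI); [lra|lra|exact HG].
  - apply smooth_const.
  - intros x _. ring.
Qed.

Lemma exact_weight_0 (G : R -> R) :
  smooth (- PI) PI G -> (forall x, G (- x) = G x) -> 0 < G (PI / 2) -> exact_weight 0 G.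
Proof.
  intros HG He H0. assert (Hpi := PI2_pos).
  exists (fun _ => 0), G, 1. split; [|simpl; lra].
  split; auto.
  - apply smooth_const.
  - apply (smooth_sub (- PI) PI); [lra|lra|exact HG].
  - intros x _. ring.
  - intros x _. ring.
Qed.

(** [Gamma1] and [Gamma2] have the form [cos ^ 3 / sin * Phi] where the primitive
    [Phi] contains a multiple of [x]. Writing [Phi] as [Phi (PI / 2)] minus an
    integral from [x] to [PI / 2] isolates a part that is odd about [PI / 2]. *)
Lemma exact_weight_primitive (a b : nat) (c : R) (Phi Q : R -> R) : 0 < c ->
  (forall x, is_derive Phi x (cos x ^ a * sin x ^ b)) ->
  smooth (- PI) PI Q -> (forall x, Q (- x) = Q x) ->
  (forall x, - PI < x < PI -> Phi x = sin x * Q x) ->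
  exact_weight (a + 4) (fun x => c * (cos x ^ 3 * Q x)).
Proof.
  intros Hc HPhi HQ He HPQ. assert (Hpi := PI2_pos).
  assert (Hm : 0 < PI / 2 < PI) by lra.
  assert (HQ0 : smooth 0 PI Q) by (apply (smooth_sub (- PI) PI); [lra|lra|exact HQ]).
  assert (HS : smooth 0 PI Phi).
  { apply smooth_ext with (fun x => sin x * Q x).
    - intros x Hx. symmetry. apply HPQ. lra.
    - apply smooth_mult; [apply smooth_sin|exact HQ0]. }
  set (L := Phi (PI / 2)).
  assert (Hcs : smooth 0 PI (fun x => cos x ^ 3 / sin x)).
  { apply smooth_div; [|apply smooth_cos_pow|apply smooth_sin].
    intros x Hx. assert (H := sin_gt_0 x ltac:(lra) ltac:(lra)). lra. }
  assert (HPsi : smooth 0 PI (fun x => L - Phi x))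
    by (apply smooth_minus; [apply smooth_const|exact HS]).
  exists (fun x => c * L * (cos x ^ 3 / sin x)),
    (fun x => - c * (cos x ^ 3 / sin x * (L - Phi x))), (- / c).
  split; [split|].
  - apply smooth_scal, smooth_mult; [apply smooth_cos_pow|exact HQ].
  - intros x _. rewrite cos_neg, He. reflexivity.
  - apply smooth_scal, Hcs.
  - apply smooth_scal, smooth_mult; assumption.
  - intros x Hx. assert (H := sin_gt_0 x ltac:(lra) ltac:(lra)).
    rewrite (HPQ x) by lra. field. lra.
  - intros x Hx. assert (H := sin_gt_0 x ltac:(lra) ltac:(lra)).
    rewrite cos_minus, sin_minus, cos_PI, sin_PI. field. lra.
  - apply (lead_ext 0 PI) with (fun x => cos x ^ 3 * / sin x * (L - Phi x)); [exact Hm| |].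
    { intros x Hx. assert (H := sin_gt_0 x ltac:(lra) ltac:(lra)). field. lra. }
    replace (a + 4)%nat with (3 + 0 + (a + 1))%nat by lia.
    assert (Hinv : smooth 0 PI (fun x => / sin x)).
    { apply smooth_inv; [|apply smooth_sin].
      intros x Hx. assert (H := sin_gt_0 x ltac:(lra) ltac:(lra)). lra. }
    apply (lead_mult 0 PI (PI / 2) Hm); [exact Hcs|exact HPsi| |].
    + apply (lead_mult 0 PI (PI / 2) Hm); [apply smooth_cos_pow|exact Hinv| |].
      * apply (lead_pow 0 PI (PI / 2) 1 3 cos); [exact Hm|apply smooth_cos|apply lead_cos].
      * simpl. rewrite sin_PI2. lra.
    + replace (a + 1)%nat with (S a) by lia. split; [unfold L; ring|].
      apply (lead_ext 0 PI) with (fun x => cos x ^ a * sin x ^ b); [exact Hm| |].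
      * intros x _.
        assert (HD : is_derive (fun x => L - Phi x) x (0 - cos x ^ a * sin x ^ b)).
        { apply (is_derive_minus (fun _ => L) Phi); [apply (is_derive_const L)|apply HPhi]. }
        apply is_derive_unique in HD. simpl in HD |- *. rewrite HD. ring.
      * replace a with (a * 1 + 0)%nat at 1 by lia.
        apply (lead_mult 0 PI (PI / 2) Hm);
          [apply smooth_cos_pow|apply smooth_pow, smooth_sin| |].
        -- apply (lead_pow 0 PI); [exact Hm|apply smooth_cos|apply lead_cos].
        -- simpl. rewrite sin_PI2, pow1. lra.
Qed.

Definition e0_amp : R := 2 * (sqrt 2 / EulerGamma (3 / 2)).

Lemma e0_amp_pos : 0 < e0_amp.
Proof.
  destruct EulerGamma_half_integers as [G0 _]. unfold e0_amp.
  assert (H : 0 < sqrt 2) by (apply sqrt_lt_R0; lra).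
  apply Rmult_lt_0_compat; [lra|]. apply Rdiv_lt_0_compat; assumption.
Qed.

Lemma e_0 (x : R) : e 0 x = e0_amp * cos x ^ 3.
Proof.
  unfold e, e0_amp. replace (INR 0 + 3 / 2) with (3 / 2) by (simpl; ring).
  replace (INR (fact 0) * INR (fact (0 + 2))) with 2 by (simpl; ring).
  unfold jacobi. simpl. ring.
Qed.

Lemma e'_0 (x : R) : e' 0 x = -3 * e0_amp * (cos x ^ 2 * sin x).
Proof.
  unfold e'. rewrite (Derive_ext _ _ x e_0). apply is_derive_unique.
  auto_derive; [auto|]. simpl. ring.
Qed.

Lemma omega_0 : omega 0 = 3.
Proof. unfold omega. simpl. ring. Qed.

(** [quotient1] and [quotient2] are the integrals in [Gamma1] and [Gamma2], up to the
    constant, divided by [sin x]; the term [1 / sinc] comes from the mean values of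
    [cos ^ 2 sin ^ 4] and [cos ^ 4 sin ^ 2], which both equal [1 / 16]. *)
Definition quotient1 (x : R) : R :=
  / 16 * / sinc x - cos x * (2 * cos x ^ 2 - 1) / 16 - sin x ^ 2 * cos x ^ 3 / 6.

Definition quotient2 (x : R) : R :=
  / 16 * / sinc x - cos x * (2 * cos x ^ 2 - 1) / 16 + sin x ^ 2 * cos x ^ 3 / 6.

Definition primitive1 (x : R) : R :=
  / 16 * x - sin x * (cos x * (2 * cos x ^ 2 - 1) / 16 + sin x ^ 2 * cos x ^ 3 / 6).

Definition primitive2 (x : R) : R :=
  / 16 * x - sin x * (cos x * (2 * cos x ^ 2 - 1) / 16 - sin x ^ 2 * cos x ^ 3 / 6).

Lemma sin2_eq (x : R) : sin x ^ 2 = 1 - cos x ^ 2.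
Proof. assert (H := sin2_cos2 x). unfold Rsqr in H. simpl. lra. Qed.

Lemma is_derive_primitive1 (x : R) : is_derive primitive1 x (cos x ^ 2 * sin x ^ 4).
Proof.
  unfold primitive1. auto_derive; [auto|].
  assert (H := sin2_eq x). set (s := sin x) in *. set (c := cos x) in *.
  replace (s ^ 4) with (s ^ 2 * s ^ 2) by ring.
  ring_simplify.
  replace (s ^ 4) with (s ^ 2 * s ^ 2) by ring. rewrite H. field.
Qed.

Lemma is_derive_primitive2 (x : R) : is_derive primitive2 x (cos x ^ 4 * sin x ^ 2).
Proof.
  unfold primitive2. auto_derive; [auto|].
  assert (H := sin2_eq x). set (s := sin x) in *. set (c := cos x) in *.
  ring_simplify.
  replace (s ^ 4) with (s ^ 2 * s ^ 2) by ring. rewrite H. field.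
Qed.

Lemma smooth_quotients (a b : R) : - PI <= a -> b <= PI ->
  smooth a b (fun x => / 16 * / sinc x - cos x * (2 * cos x ^ 2 - 1) / 16) /\
  smooth a b (fun x => sin x ^ 2 * cos x ^ 3 / 6).
Proof.
  intros Ha Hb. split.
  - apply smooth_minus.
    + apply smooth_scal, smooth_inv; [intros x Hx; apply sinc_neq_0; lra|apply smooth_sinc].
    + apply smooth_div; [intros; lra| |apply smooth_const].
      apply smooth_mult; [apply smooth_cos|]. apply smooth_minus; [|apply smooth_const].
      apply smooth_scal, smooth_cos_pow.
  - apply smooth_div; [intros; lra| |apply smooth_const].
    apply smooth_mult; [apply smooth_pow, smooth_sin|apply smooth_cos_pow].
Qed.

Lemma sinc_neg (x : R) : sinc (- x) = sinc x.
Proof. unfold sinc. f_equal. ring. Qed.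

Lemma exact_weight_Gamma1 :
  exact_weight 6 (fun x => 9 * e0_amp ^ 2 * (cos x ^ 3 * quotient1 x)).
Proof.
  assert (H0 := e0_amp_pos).
  apply (exact_weight_primitive 2 4 _ primitive1).
  - assert (0 < e0_amp ^ 2) by (apply pow_lt; exact H0). lra.
  - apply is_derive_primitive1.
  - destruct (smooth_quotients (- PI) PI) as [H1 H2]; [lra|lra|].
    apply smooth_minus; assumption.
  - intros x. unfold quotient1. rewrite sinc_neg, cos_neg, sin_neg.
    replace ((- sin x) ^ 2) with (sin x ^ 2) by ring. reflexivity.
  - intros x Hx. unfold primitive1, quotient1.
    assert (H := sinc_neq_0 x Hx). assert (Hs := sin_sinc x).
    replace (/ 16 * x) with (sin x * (/ 16 * / sinc x)) by (rewrite Hs; field; exact H).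
    field. exact H.
Qed.

Lemma exact_weight_Gamma2 :
  exact_weight 8 (fun x => 9 * e0_amp ^ 2 * (cos x ^ 3 * quotient2 x)).
Proof.
  assert (H0 := e0_amp_pos).
  apply (exact_weight_primitive 4 2 _ primitive2).
  - assert (0 < e0_amp ^ 2) by (apply pow_lt; exact H0). lra.
  - apply is_derive_primitive2.
  - destruct (smooth_quotients (- PI) PI) as [H1 H2]; [lra|lra|].
    apply smooth_plus; assumption.
  - intros x. unfold quotient2. rewrite sinc_neg, cos_neg, sin_neg.
    replace ((- sin x) ^ 2) with (sin x ^ 2) by ring. reflexivity.
  - intros x Hx. unfold primitive2, quotient2.
    assert (H := sinc_neq_0 x Hx). assert (Hs := sin_sinc x).
    replace (/ 16 * x) with (sin x * (/ 16 * / sinc x)) by (rewrite Hs; field; exact H).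
    field. exact H.
Qed.

Lemma RInt_primitive (f F : R -> R) (c x : R) :
  (forall y, is_derive F y (f y)) -> (forall y, continuous f y) -> F 0 = 0 ->
  RInt (fun y => c * f y) 0 x = c * F x.
Proof.
  intros HF Hf F0. apply (is_RInt_unique (V := R_CompleteNormedModule)).
  replace (c * F x) with (c * (F x - F 0)) by (rewrite F0; ring).
  apply (is_RInt_scal (V := R_NormedModule) f 0 x c (F x - F 0)).
  apply (is_RInt_derive F f); intros; auto.
Qed.

Lemma RInt_ext_from_0 (f g : R -> R) (x : R) : 0 < x < PI / 2 ->
  (forall y, 0 < cos y -> f y = g y) -> RInt f 0 x = RInt g 0 x.
Proof.
  intros Hx H. apply RInt_ext. rewrite Rmin_left, Rmax_right by lra. intros y Hy.
  apply H, cos_gt_0; lra.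
Qed.

Lemma Gamma1_eq (x : R) : 0 < x < PI / 2 ->
  Gamma1 x = 9 * e0_amp ^ 2 * (cos x ^ 3 * quotient1 x).
Proof.
  intros Hx. destruct (sin_cos_pos x Hx) as [S0 C0]. unfold Gamma1.
  rewrite (RInt_ext_from_0 _ (fun y => 9 * e0_amp ^ 2 * (cos y ^ 2 * sin y ^ 4)) x Hx).
  - rewrite (RInt_primitive (fun y => cos y ^ 2 * sin y ^ 4) primitive1).
    + unfold primitive1, quotient1.
      assert (H := sinc_neq_0 x ltac:(lra)). assert (Hs := sin_sinc x).
      replace (/ 16 * x) with (sin x * (/ 16 * / sinc x)) by (rewrite Hs; field; exact H).
      field. lra.
    + apply is_derive_primitive1.
    + intros y. apply (ex_derive_continuous (fun y => cos y ^ 2 * sin y ^ 4)).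
      auto_derive. auto.
    + unfold primitive1. rewrite sin_0. ring.
  - intros y Cy.
    rewrite e'_0. unfold tan. field. lra.
Qed.

Lemma Gamma2_eq (x : R) : 0 < x < PI / 2 ->
  Gamma2 x = 9 * e0_amp ^ 2 * (cos x ^ 3 * quotient2 x).
Proof.
  intros Hx. destruct (sin_cos_pos x Hx) as [S0 C0]. unfold Gamma2.
  rewrite (RInt_ext_from_0 _ (fun y => e0_amp ^ 2 * (cos y ^ 4 * sin y ^ 2)) x Hx).
  - rewrite (RInt_primitive (fun y => cos y ^ 4 * sin y ^ 2) primitive2).
    + unfold primitive2, quotient2. rewrite omega_0.
      assert (H := sinc_neq_0 x ltac:(lra)). assert (Hs := sin_sinc x).
      replace (/ 16 * x) with (sin x * (/ 16 * / sinc x)) by (rewrite Hs; field; exact H).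
      field. lra.
    + apply is_derive_primitive2.
    + intros y. apply (ex_derive_continuous (fun y => cos y ^ 4 * sin y ^ 2)).
      auto_derive. auto.
    + unfold primitive2. rewrite sin_0. ring.
  - intros y Cy.
    rewrite e_0. unfold tan. field. lra.
Qed.

Definition gamma3 (x : R) : R :=
  9 * e0_amp ^ 2 * (sin x ^ 4 / 4 - sin x ^ 6 / 3 + sin x ^ 8 / 8).

Definition gamma4 (x : R) : R := 9 * e0_amp ^ 2 * ((1 - cos x ^ 8) / 8).

Lemma Gamma3_eq (x : R) : 0 < x < PI / 2 -> Gamma3 x = gamma3 x.
Proof.
  intros Hx.
  unfold Gamma3, gamma3.
  rewrite (RInt_ext_from_0 _ (fun y => 9 * e0_amp ^ 2 * (cos y ^ 5 * sin y ^ 3)) x Hx)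
    by (intros y _; rewrite e'_0; ring).
  rewrite (RInt_primitive (fun y => cos y ^ 5 * sin y ^ 3)
             (fun x => sin x ^ 4 / 4 - sin x ^ 6 / 3 + sin x ^ 8 / 8)).
  - reflexivity.
  - intros y. auto_derive; [auto|].
    replace (cos y ^ 5) with (cos y * (cos y ^ 2 * cos y ^ 2)) by ring.
    replace (cos y ^ 2) with (1 - sin y ^ 2) by (rewrite sin2_eq; ring).
    simpl. field.
  - intros y. apply (ex_derive_continuous (fun y => cos y ^ 5 * sin y ^ 3)).
    auto_derive. auto.
  - rewrite sin_0. simpl. field.
Qed.

Lemma Gamma4_eq (x : R) : 0 < x < PI / 2 -> Gamma4 x = gamma4 x.
Proof.
  intros Hx.
  unfold Gamma4, gamma4. rewrite omega_0.
  rewrite (RInt_ext_from_0 _ (fun y => e0_amp ^ 2 * (cos y ^ 7 * sin y)) x Hx)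
    by (intros y _; rewrite e_0; ring).
  rewrite (RInt_primitive (fun y => cos y ^ 7 * sin y) (fun x => (1 - cos x ^ 8) / 8)).
  - ring.
  - intros y. auto_derive; [auto|]. simpl. field.
  - intros y. apply (ex_derive_continuous (fun y => cos y ^ 7 * sin y)).
    auto_derive. auto.
  - rewrite cos_0. simpl. field.
Qed.

Lemma exact_weight_1 : exact_weight 0 (fun _ => 1).
Proof. apply exact_weight_0; [apply smooth_const|reflexivity|lra]. Qed.

Lemma exact_weight_gamma3 : exact_weight 0 gamma3.
Proof.
  assert (H0 := e0_amp_pos). apply exact_weight_0.
  - unfold gamma3. apply smooth_scal, smooth_plus; [apply smooth_minus|];
      (apply smooth_div; [intros; lra|apply smooth_pow, smooth_sin|apply smooth_const]).
  - intros x. unfold gamma3. rewrite sin_neg. field.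
  - unfold gamma3. rewrite sin_PI2, !pow1.
    assert (0 < e0_amp ^ 2) by (apply pow_lt; exact H0). lra.
Qed.

Lemma exact_weight_gamma4 : exact_weight 0 gamma4.
Proof.
  assert (H0 := e0_amp_pos). apply exact_weight_0.
  - unfold gamma4. apply smooth_scal, smooth_div; [intros; lra| |apply smooth_const].
    apply smooth_minus; [apply smooth_const|apply smooth_cos_pow].
  - intros x. unfold gamma4. rewrite cos_neg. reflexivity.
  - unfold gamma4. rewrite cos_PI2, pow_i by lia.
    assert (0 < e0_amp ^ 2) by (apply pow_lt; exact H0). lra.
Qed.

Lemma weight_e0 (q : nat) : weight q (fun x => e0_amp * cos x ^ 3).
Proof.
  apply weight_odd.
  - apply smooth_scal, smooth_cos_pow.
  - intros x. rewrite cos_neg. reflexivity.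
  - intros x. rewrite cos_minus, cos_PI, sin_PI. ring.
Qed.

Lemma weight_cos (q : nat) (c : R) : weight q (fun x => c * cos x).
Proof.
  apply weight_odd.
  - apply smooth_scal, smooth_cos.
  - intros x. rewrite cos_neg. reflexivity.
  - intros x. rewrite cos_minus, cos_PI, sin_PI. ring.
Qed.

(** ** Derivatives of the weights at the end points *)

Lemma one_sided_limits (F H : R -> R) (n : nat) :
  smooth (- PI) PI H -> (forall x, 0 < x < PI / 2 -> F x = H x) ->
  derive_n_at_0 F n (Derive_n H n 0) /\
  derive_n_at_half_PI F n (Derive_n H n (PI / 2)).
Proof.
  intros HH E. assert (Hpi := PI2_pos).
  assert (ED : forall x, 0 < x < PI / 2 -> Derive_n H n x = Derive_n F n x).
  { intros x Hx. symmetry. apply (Derive_n_ext_interval 0 (PI / 2)); assumption. }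
  assert (HC : forall x, - PI < x < PI -> continuous (Derive_n H n) x).
  { intros x Hx. apply (smooth_continuous (- PI) PI); [apply smooth_Derive_n, HH|exact Hx]. }
  assert (Hd : 0 < PI / 2) by exact Hpi.
  split.
  - intros P HP. destruct (HC 0 ltac:(lra) P HP) as [d HdP].
    exists (mkposreal (Rmin d (PI / 2)) (Rmin_stable_in_posreal d (mkposreal _ Hd))).
    intros y Hy Hy0. apply Rabs_lt_between' in Hy. simpl in Hy.
    assert (M1 := Rmin_l d (PI / 2)). assert (M2 := Rmin_r d (PI / 2)).
    rewrite <- ED by lra. apply HdP. apply Rabs_lt_between'. lra.
  - intros P HP. destruct (HC (PI / 2) ltac:(lra) P HP) as [d HdP].
    exists (mkposreal (Rmin d (PI / 2)) (Rmin_stable_in_posreal d (mkposreal _ Hd))).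
    intros y Hy Hy0. apply Rabs_lt_between' in Hy. simpl in Hy.
    assert (M1 := Rmin_l d (PI / 2)). assert (M2 := Rmin_r d (PI / 2)).
    rewrite <- ED by lra. apply HdP. apply Rabs_lt_between'. lra.
Qed.

Lemma smooth_inside_of_smooth (F H : R -> R) :
  smooth (- PI) PI H -> (forall x, 0 < x < PI / 2 -> F x = H x) -> smooth_inside F.
Proof.
  intros HH E m x Hx. assert (Hpi := PI2_pos).
  apply (smooth_ex_derive_n 0 (PI / 2)); [|exact Hx].
  apply smooth_ext with H.
  - intros y Hy. symmetry. apply E, Hy.
  - apply (smooth_sub (- PI) PI); [lra|lra|exact HH].
Qed.

Lemma weight_vanishing_at_order (q l : nat) (G F : R -> R) :
  weight q G -> (forall x, 0 < x < PI / 2 -> F x = G x * cos x ^ 2) ->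
  (2 * l < q + 2)%nat -> vanishing_at_order F l.
Proof.
  intros [Go [Ge [HS HV]]] E Hl.
  assert (Hsm : smooth (- PI) PI (fun x => G x * cos x ^ 2)).
  { apply smooth_mult; [apply (split_smooth _ _ _ HS)|apply smooth_cos_pow]. }
  destruct (one_sided_limits F _ (2 * l) Hsm E) as [_ H1].
  destruct (one_sided_limits F _ (2 * l + 1) Hsm E) as [H0 _].
  rewrite (Derive_n_weighted_half_PI G Go Ge q HS HV (fun x => cos x ^ 2) 2 1) in H1.
  - rewrite (Derive_n_weighted_0 G Go Ge HS (fun x => cos x ^ 2) 1) in H0.
    + split; assumption.
    + apply smooth_cos_pow.
    + intros x. rewrite cos_neg. ring.
    + rewrite Nat.add_1_r, pow_1_odd. ring.
  - apply smooth_cos_pow.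
  - apply vanish_cos_pow.
  - intros x. rewrite cos_minus, cos_PI, sin_PI. ring.
  - exact Hl.
  - rewrite pow_1_even. ring.
Qed.

Lemma exact_weight_first_nonvanishing (r : nat) (G F : R -> R) :
  exact_weight (2 * r) G -> (forall x, 0 < x < PI / 2 -> F x = G x * cos x ^ 2) ->
  first_nonvanishing_derivative F (2 * r + 2).
Proof.
  intros HG E. assert (HW := exact_weight_weight _ _ HG).
  destruct HG as [Go [Ge [s [HS HL]]]]. assert (Hpi := PI2_pos).
  assert (Hsm : smooth (- PI) PI (fun x => G x * cos x ^ 2)).
  { apply smooth_mult; [apply (split_smooth _ _ _ HS)|apply smooth_cos_pow]. }
  split; [apply (smooth_inside_of_smooth F _ Hsm E)|].
  exists (S r). split; [lia|]. split.
  - intros l Hl. apply (weight_vanishing_at_order (2 * r) l G); [exact HW|exact E|lia].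
  - exists (Derive_n (fun x => G x * cos x ^ 2) (2 * r + 2) (PI / 2)).
    split; [|apply (one_sided_limits F _ _ Hsm E)].
    rewrite (Derive_n_weighted_split G Go Ge HS (fun x => cos x ^ 2))
      by apply smooth_cos_pow.
    rewrite (Derive_n_weighted_odd_part G Go Ge HS (fun x => cos x ^ 2) 1).
    + rewrite Rplus_0_l. intros H0.
      assert (Hlead : lead (2 * r + 2) (fun x => s * Ge x * cos x ^ 2) (PI / 2)).
      { apply (lead_mult 0 PI (PI / 2) ltac:(lra)).
        - apply smooth_scal, (split_smooth_even _ _ _ HS).
        - apply smooth_cos_pow.
        - exact HL.
        - apply (lead_pow 0 PI (PI / 2) 1 2 cos); [lra|apply smooth_cos|apply lead_cos]. }
      apply (lead_Derive_n _ _ _ Hlead).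
      rewrite (Derive_n_ext _ (fun x => s * (Ge x * cos x ^ 2))) by (intros; ring).
      rewrite Derive_n_scal_l, H0. ring.
    + apply smooth_cos_pow.
    + intros x. rewrite cos_minus, cos_PI, sin_PI. ring.
    + replace (2 * r + 2)%nat with (2 * (r + 1))%nat by lia. rewrite pow_1_even. ring.
Qed.

Lemma weight_no_nonvanishing (G F : R -> R) :
  (forall q, weight q G) -> (forall x, 0 < x < PI / 2 -> F x = G x * cos x ^ 2) ->
  no_nonvanishing_derivative F.
Proof.
  intros HG E. split.
  - destruct (HG 0%nat) as [Go [Ge [HS _]]].
    apply (smooth_inside_of_smooth F (fun x => G x * cos x ^ 2)); [|exact E].
    apply smooth_mult; [apply (split_smooth _ _ _ HS)|apply smooth_cos_pow].
  - intros l. apply (weight_vanishing_at_order (2 * l) l G); [apply HG|exact E|lia].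
Qed.

(** * From bounds on triples to estimates along sequences *)

Lemma comb_ff (j k i : nat) : comb false false j k i = omega i - INR (deg j + deg k).
Proof. unfold comb, pm. rewrite plus_INR, <- !omega_deg. ring. Qed.

(** The least combination is [omega i - omega j - omega k]. If all four diverge then it is
    eventually positive, and no further information on the sequence is needed. *)
Lemma two_regime_of_bounds (X B B' : nat -> nat -> nat -> R) (C : R) :
  (forall j k i, Rabs (X j k i) <= C * B j k i) ->
  (forall j k i, (deg j + deg k < deg i)%nat -> Rabs (X j k i) <= C * B' j k i) ->
  two_regime_estimate X B B'.
Proof.
  intros HB HB'. split; exists C; intros j k i _ _ _ HA.
  - apply filter_forall. intros n. apply HB.
  - specialize (HA false false). apply is_lim_seq_spec in HA. specialize (HA 0).
    apply filter_imp with (2 := HA). intros n Hn. apply HB'.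
    rewrite comb_ff, omega_deg in Hn. apply INR_lt. lra.
Qed.

Lemma sum_pm_ge (f : R -> R) (j k i : nat) :
  (forall x, 0 <= f x) -> f (omega i - INR (deg j + deg k)) <= sum_pm f j k i.
Proof.
  intros Hf. rewrite <- comb_ff. unfold sum_pm.
  assert (H1 := Hf (comb true true j k i)). assert (H2 := Hf (comb true false j k i)).
  assert (H3 := Hf (comb false true j k i)). lra.
Qed.

Lemma Rabs_inv_pow (m : R) (p n : nat) : 1 <= m -> (p <= n)%nat ->
  / m ^ n <= Rabs (1 / m ^ p).
Proof.
  intros Hm Hp. assert (H0 : 0 < m ^ p) by (apply pow_lt; lra).
  unfold Rdiv. rewrite Rmult_1_l, Rabs_pos_eq by (left; apply Rinv_0_lt_compat, H0).
  apply Rinv_le_contravar; [exact H0|]. apply Rle_pow; assumption.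
Qed.

Lemma gap_ge_1 (j k i : nat) : (deg j + deg k < deg i)%nat ->
  1 <= omega i - INR (deg j + deg k).
Proof.
  intros H. rewrite omega_deg. apply lt_INR in H as H1.
  rewrite <- minus_INR by lia. replace 1 with (INR 1) by reflexivity.
  apply le_INR. lia.
Qed.

Lemma decay_of_bounds (p n : nat) (X : nat -> nat -> nat -> R) (C : R) : 0 <= C ->
  (p <= n)%nat ->
  (forall j k i, Rabs (X j k i) <= C / omega i) ->
  (forall j k i, (deg j + deg k < deg i)%nat ->
     Rabs (X j k i) <= C / omega i * / (omega i - INR (deg j + deg k)) ^ n) ->
  decay p X.
Proof.
  intros HC Hp H1 H2. apply two_regime_of_bounds with C; [exact H1|].
  intros j k i Hd. assert (Hw := omega_ge_3 i).
  apply Rle_trans with (1 := H2 j k i Hd).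
  unfold Rdiv. rewrite Rmult_assoc. apply Rmult_le_compat_l; [exact HC|].
  apply Rmult_le_compat_l; [left; apply Rinv_0_lt_compat; lra|].
  apply Rle_trans with (1 := Rabs_inv_pow _ p n (gap_ge_1 j k i Hd) Hp).
  apply (sum_pm_ge (fun W => Rabs (1 / W ^ p))). intros x. apply Rabs_pos.
Qed.

(** * The Fourier constants *)

(** All estimates depend on the indices [j] and [k] through the product of two modes
    only, and use nothing about it but the following. *)
Record mode_pair (h : nat -> nat -> R -> R) : Prop := {
  mode_pair_comb : forall j k,
    bounded_comb (cos_even (deg j + deg k)) (mode_bound * mode_bound) (h j k);
  mode_pair_0 : forall j k, h j k 0 = 0
}.

Lemma mode_pair_e : mode_pair (fun j k x => tan_e j x * tan_e k x).
Proof.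
  split; intros j k.
  - apply bcomb_mult with (sin_odd (deg j)) (sin_odd (deg k)).
    + apply sin_odd_mult.
    + apply bcomb_tan_e.
    + apply bcomb_tan_e.
  - rewrite tan_e_at_0. ring.
Qed.

Lemma mode_pair_e' : mode_pair (fun j k x => tan_e' j x * tan_e' k x).
Proof.
  split; intros j k.
  - apply bcomb_mult with (cos_odd (deg j)) (cos_odd (deg k)).
    + apply cos_odd_mult.
    + apply bcomb_tan_e'.
    + apply bcomb_tan_e'.
  - rewrite tan_e'_at_0. ring.
Qed.

Lemma deg_sum_pos (j k : nat) : (1 <= deg j + deg k)%nat.
Proof. unfold deg. lia. Qed.

Lemma unbarred_bounds (q : nat) (G : R -> R) (h : nat -> nat -> R -> R) :
  weight q G -> mode_pair h ->
  exists C, 0 <= C /\ forall j k i,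
    Rabs (RInt (fun x => G x * (cos x ^ 2 * tan_e' i x) * h j k x) 0 (PI / 2)) <= C /\
    ((deg j + deg k < deg i)%nat ->
     Rabs (RInt (fun x => G x * (cos x ^ 2 * tan_e' i x) * h j k x) 0 (PI / 2))
     <= C * / (omega i - INR (deg j + deg k)) ^ (q + 3)).
Proof.
  intros HG [Hh H0].
  destruct (triple_product_e' q G HG) as [C1 [P1 HC1]].
  destruct (triple_product_e'_trivial q G HG) as [C2 [P2 HC2]].
  assert (K0 := mode_bound_pos).
  assert (K2 : 0 < mode_bound * mode_bound) by (apply Rmult_lt_0_compat; assumption).
  exists (mode_bound * mode_bound * (C1 + C2)). split; [apply Rmult_le_pos; lra|].
  intros j k i. split.
  - apply Rle_trans with (1 := HC2 _ _ _ i (Hh j k)). apply Rmult_le_compat_l; lra.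
  - intros Hd. assert (Hp := deg_sum_pos j k).
    apply Rle_trans with (1 := HC1 _ _ _ i (conj Hp Hd) (Hh j k) (H0 j k)).
    rewrite (Rmult_assoc (mode_bound * mode_bound)).
    apply Rmult_le_compat_l; [lra|]. apply Rmult_le_compat_r; [|lra].
    left. apply Rinv_0_lt_compat, pow_lt. assert (H := gap_ge_1 j k i Hd). lra.
Qed.

Lemma decay_unbarred (p q : nat) (G : R -> R) (h : nat -> nat -> R -> R)
    (X : nat -> nat -> nat -> R) :
  weight q G -> mode_pair h -> (p <= q + 3)%nat ->
  (forall j k i,
     X j k i = RInt (fun x => G x * (cos x ^ 2 * tan_e' i x) * h j k x) 0 (PI / 2)) ->
  decay p (div_omega X).
Proof.
  intros HG Hh Hp HX. destruct (unbarred_bounds q G h HG Hh) as [C [HC0 HC]].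
  apply (decay_of_bounds p (q + 3) _ C HC0 Hp); intros j k i;
    unfold div_omega; rewrite HX; destruct (HC j k i) as [H1 H2];
    assert (Hw := omega_ge_3 i); assert (Hi : 0 < / omega i) by (apply Rinv_0_lt_compat; lra);
    unfold Rdiv; rewrite Rabs_mult, (Rabs_pos_eq (/ omega i)) by lra.
  - apply Rmult_le_compat_r; lra.
  - intros Hd. rewrite Rmult_assoc, (Rmult_comm (/ omega i)), <- Rmult_assoc.
    apply Rmult_le_compat_r; [lra|]. apply H2, Hd.
Qed.

Lemma decay_barred (p q : nat) (G : R -> R) (h : nat -> nat -> R -> R)
    (X : nat -> nat -> nat -> R) :
  weight q G -> mode_pair h -> (p <= q + 3)%nat ->
  (forall j k i,
     X j k i = amp i * RInt (fun x => G x * unit_g i x * h j k x) 0 (PI / 2)) ->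
  decay p X.
Proof.
  intros HG [Hh _] Hp HX.
  destruct (triple_product_g q G HG) as [C1 [P1 HC1]].
  destruct (triple_product_g_trivial q G HG) as [C2 [P2 HC2]].
  assert (K0 := mode_bound_pos).
  set (K := mode_bound) in *.
  assert (K2 : 0 < K * K) by (apply Rmult_lt_0_compat; assumption).
  assert (Hamp : forall i, 0 < amp i <= K / omega i).
  { intros i. destruct (amp_bounds i) as [A0 _]. assert (A1 := amp_omega_le i).
    assert (Hw := omega_ge_3 i). split; [exact A0|].
    apply Rmult_le_reg_r with (omega i); [lra|].
    replace (K / omega i * omega i) with K by (field; lra). fold K in A1.
    assert (0 < amp i * omega i) by (apply Rmult_lt_0_compat; lra). lra. }
  apply (decay_of_bounds p (q + 3) X (K * (K * K * (C1 + C2))));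
    [apply Rmult_le_pos; [lra|apply Rmult_le_pos; lra]|exact Hp| |]; intros j k i; rewrite HX;
    destruct (Hamp i) as [A0 A1]; rewrite Rabs_mult, (Rabs_pos_eq (amp i)) by lra;
    assert (Hw := omega_ge_3 i).
  - replace (K * (K * K * (C1 + C2)) / omega i) with (K / omega i * (K * K * (C1 + C2)))
      by (field; lra).
    apply Rmult_le_compat; [lra|apply Rabs_pos|exact A1|].
    apply Rle_trans with (1 := HC2 _ _ _ i (Hh j k)). apply Rmult_le_compat_l; lra.
  - intros Hd.
    assert (Dp : 0 < / (omega i - INR (deg j + deg k)) ^ (q + 3)).
    { apply Rinv_0_lt_compat, pow_lt. assert (H := gap_ge_1 j k i Hd). lra. }
    assert (B := HC1 _ _ _ i Hd (Hh j k)). unfold Rdiv in B.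
    set (D := / (omega i - INR (deg j + deg k)) ^ (q + 3)) in *.
    replace (K * (K * K * (C1 + C2)) / omega i * D)
      with (K / omega i * (K * K * ((C1 + C2) * D))) by (field; lra).
    apply Rmult_le_compat; [lra|apply Rabs_pos|exact A1|].
    apply Rle_trans with (1 := B). fold K. apply Rmult_le_compat_l; [lra|].
    apply Rmult_le_compat_r; lra.
Qed.

(** ** Integrands in terms of [tan_e], [tan_e'] and [unit_g] *)

Lemma unbarred_integrand (i : nat) (u v x : R) : 0 < x < PI / 2 ->
  u * v * (e' i x / omega i) * (sin x ^ 3 / cos x)
  = cos x ^ 2 * tan_e' i x * (tan x * u * (tan x * v)).
Proof.
  intros Hx. destruct (sin_cos_pos x Hx) as [S0 C0].
  rewrite <- tan_e'_dirichlet, <- tan_e'_spec by exact Hx. unfold tan.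
  assert (Hw := omega_ge_3 i). field. lra.
Qed.

Lemma barred_integrand (i : nat) (u v x : R) : 0 < x < PI / 2 ->
  u * v * g i x * tan x ^ 2 = amp i * (unit_g i x * (tan x * u * (tan x * v))).
Proof. intros Hx. rewrite g_closed_form by exact Hx. ring. Qed.

Lemma barred_RInt (q i : nat) (G h f : R -> R) (M : nat) (B : R) :
  weight q G -> bounded_comb (cos_even M) B h ->
  (forall x, 0 < x < PI / 2 -> f x = amp i * (G x * unit_g i x * h x)) ->
  RInt f 0 (PI / 2) = amp i * RInt (fun x => G x * unit_g i x * h x) 0 (PI / 2).
Proof.
  intros HG Hh E. assert (Hpi := PI2_pos).
  rewrite (RInt_ext_quarter f (fun x => amp i * (G x * unit_g i x * h x))) by exact E.
  apply (RInt_scal (V := R_CompleteNormedModule) (fun x => G x * unit_g i x * h x)).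
  apply (ex_RInt_continuous (fun x => G x * unit_g i x * h x)).
  intros z. rewrite Rmin_left, Rmax_right by lra. intros Hz.
  apply (continuous_mult (fun x => G x * unit_g i x)).
  - apply (continuous_weighted q); [exact HG|apply continuous_unit_g|exact Hz].
  - apply (bcomb_continuous _ _ _ (cos_even_continuous M) Hh).
Qed.

Section Weighted_constants.

Context (p q : nat) (G G' : R -> R) (HG' : weight q G') (Hp : (p <= q + 3)%nat).
Context (HG : forall x, 0 < x < PI / 2 -> G x = G' x).

Lemma decay_FQ : decay p (div_omega (FQ G)).
Proof using HG' Hp HG.
  apply (decay_unbarred p q G' _ _ HG' mode_pair_e Hp).
  intros j k i. unfold FQ. apply RInt_ext_quarter. intros x Hx.
  rewrite <- !tan_e_spec by exact Hx.
  rewrite (Rmult_assoc (G' x)), <- unbarred_integrand, <- HG by exact Hx. ring.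
Qed.

Lemma decay_FP : decay p (div_omega (FP G)).
Proof using HG' Hp HG.
  apply (decay_unbarred p q G' _ _ HG' mode_pair_e' Hp).
  intros j k i. unfold FP. apply RInt_ext_quarter. intros x Hx.
  rewrite <- (tan_e'_dirichlet j), <- (tan_e'_dirichlet k), <- !tan_e'_spec by exact Hx.
  rewrite (Rmult_assoc (G' x)), <- unbarred_integrand, <- HG by exact Hx. ring.
Qed.

Lemma decay_FQbar : decay p (FQbar G).
Proof using HG' Hp HG.
  apply (decay_barred p q G' _ _ HG' mode_pair_e Hp).
  intros j k i. unfold FQbar.
  apply (barred_RInt q i G' _ _ _ _ HG' (mode_pair_comb _ mode_pair_e j k)).
  intros x Hx. rewrite <- !tan_e_spec by exact Hx.
  transitivity (G x * (e j x * e k x * g i x * tan x ^ 2)); [ring|].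
  rewrite barred_integrand, HG by exact Hx. ring.
Qed.

Lemma decay_FPbar : decay p (FPbar G).
Proof using HG' Hp HG.
  apply (decay_barred p q G' _ _ HG' mode_pair_e' Hp).
  intros j k i. unfold FPbar.
  apply (barred_RInt q i G' _ _ _ _ HG' (mode_pair_comb _ mode_pair_e' j k)).
  intros x Hx.
  rewrite <- (tan_e'_dirichlet j), <- (tan_e'_dirichlet k), <- !tan_e'_spec by exact Hx.
  transitivity (G x * (e' j x / omega j * (e' k x / omega k) * g i x * tan x ^ 2)); [ring|].
  rewrite barred_integrand, HG by exact Hx. ring.
Qed.

End Weighted_constants.

Lemma two_regime_ext (X Y B B' : nat -> nat -> nat -> R) :
  (forall j k i, X j k i = Y j k i) ->
  two_regime_estimate X B B' -> two_regime_estimate Y B B'.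
Proof.
  intros E [[C HC] [C' HC']]. split.
  - exists C. intros j k i Hj Hk Hi HA. apply filter_imp with (2 := HC j k i Hj Hk Hi HA).
    intros n Hn. rewrite <- E. exact Hn.
  - exists C'. intros j k i Hj Hk Hi HA. apply filter_imp with (2 := HC' j k i Hj Hk Hi HA).
    intros n Hn. rewrite <- E. exact Hn.
Qed.

Lemma decay_ext (p : nat) (X Y : nat -> nat -> nat -> R) :
  (forall j k i, X j k i = Y j k i) -> decay p X -> decay p Y.
Proof. apply two_regime_ext. Qed.

Lemma FI_eq (j k i : nat) : FQ (fun _ => 1) j k i = FI j k i.
Proof. unfold FQ, FI. apply RInt_ext_quarter. intros x _. ring. Qed.

Lemma FIbar_eq (j k i : nat) : FQbar (fun _ => 1) j k i = FIbar j k i.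
Proof. unfold FQbar, FIbar. apply RInt_ext_quarter. intros x _. ring. Qed.

Lemma FJ_eq (j k i : nat) : FP (fun _ => 1) j k i = FJ j k i.
Proof. unfold FP, FJ. apply RInt_ext_quarter. intros x _. ring. Qed.

Lemma FJbar_eq (j k i : nat) : FPbar (fun _ => 1) j k i = FJbar j k i.
Proof. unfold FPbar, FJbar. apply RInt_ext_quarter. intros x _. ring. Qed.

(** [e' 0 / omega 0] contributes [- e0_amp cos ^ 2 sin], so the integrand is of the
    unbarred form with the weight [- e0_amp cos], odd about [PI / 2]. *)
Lemma FH0bar_eq (j k i : nat) :
  FH0bar j k i = RInt (fun x => (- e0_amp * cos x) * (cos x ^ 2 * tan_e' i x)
                                * (tan_e j x * tan_e k x)) 0 (PI / 2).
Proof.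
  unfold FH0bar. apply RInt_ext_quarter. intros x Hx.
  destruct (sin_cos_pos x Hx) as [S0 C0].
  rewrite <- !tan_e_spec, (Rmult_assoc (- e0_amp * cos x)), <- unbarred_integrand by exact Hx.
  rewrite e'_0, omega_0. unfold tan. field.
  assert (Hw := omega_ge_3 i). lra.
Qed.

Lemma FH0bar_estimate (N : nat) :
  two_regime_estimate
    (fun j k i => omega 0 * omega i * FH0bar j k i)
    (fun j k i => omega i * omega k)
    (fun j k i => sum_pm (fun W => Rabs (omega i / W ^ N)) j k i).
Proof.
  destruct (unbarred_bounds N (fun x => - e0_amp * cos x) _ (weight_cos N _) mode_pair_e)
    as [C [HC0 HC]].
  apply two_regime_of_bounds with (3 * C); intros j k i; rewrite FH0bar_eq, omega_0;
    destruct (HC j k i) as [H1 H2]; assert (Hi := omega_ge_3 i); assert (Hk := omega_ge_3 k);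
    rewrite Rabs_mult, (Rabs_pos_eq (3 * omega i)) by lra.
  - apply Rle_trans with (3 * omega i * C); [apply Rmult_le_compat_l; lra|].
    assert (0 <= omega i * C) by (apply Rmult_le_pos; lra). nra.
  - intros Hd. assert (Hg := gap_ge_1 j k i Hd). specialize (H2 Hd).
    apply Rle_trans with (3 * C * Rabs (omega i / (omega i - INR (deg j + deg k)) ^ N)).
    + set (m := omega i - INR (deg j + deg k)) in *.
      apply Rle_trans with (3 * omega i * (C * / m ^ (N + 3)));
        [apply Rmult_le_compat_l; [lra|exact H2]|].
      replace (omega i / m ^ N) with (omega i * (1 / m ^ N)) by (unfold Rdiv; ring).
      rewrite Rabs_mult, (Rabs_pos_eq (omega i)) by lra.
      replace (3 * omega i * (C * / m ^ (N + 3))) with (3 * C * (omega i * / m ^ (N + 3))) by ring.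
      apply Rmult_le_compat_l; [lra|]. apply Rmult_le_compat_l; [lra|].
      apply Rabs_inv_pow; [exact Hg|lia].
    + apply Rmult_le_compat_l; [lra|].
      apply (sum_pm_ge (fun W => Rabs (omega i / W ^ N))). intros x. apply Rabs_pos.
Qed.

Theorem proposition4p4 (N : nat) :
  (* (a) *)
  ( (decay 3 FIbar /\ decay 3 (div_omega FI) /\
     decay 3 FJbar /\ decay 3 (div_omega FJ)) /\
    (decay 9 (FPbar Gamma1) /\ decay 9 (div_omega (FP Gamma1)) /\
     decay 9 (FQbar Gamma1) /\ decay 9 (div_omega (FQ Gamma1))) /\
    (decay 11 (FPbar Gamma2) /\ decay 11 (div_omega (FP Gamma2)) /\
     decay 11 (FQbar Gamma2) /\ decay 11 (div_omega (FQ Gamma2))) /\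
    (decay 3 (FPbar Gamma3) /\ decay 3 (div_omega (FP Gamma3)) /\
     decay 3 (FQbar Gamma3) /\ decay 3 (div_omega (FQ Gamma3))) /\
    (decay 3 (FPbar Gamma4) /\ decay 3 (div_omega (FP Gamma4)) /\
     decay 3 (FQbar Gamma4) /\ decay 3 (div_omega (FQ Gamma4))) /\
    (decay N FS0bar /\ decay N (div_omega FS0)) ) /\
  (* (b) *)
  two_regime_estimate
    (fun j k i => omega 0 * omega i * FH0bar j k i)
    (fun j k i => omega i * omega k)
    (fun j k i => sum_pm (fun W => Rabs (omega i / W ^ N)) j k i) /\
  (* (c) *)
  ( first_nonvanishing_derivative (fun x => cos x ^ 2) 2 /\
    first_nonvanishing_derivative (fun x => Gamma1 x * cos x ^ 2) 8 /\
    first_nonvanishing_derivative (fun x => Gamma2 x * cos x ^ 2) 10 /\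
    first_nonvanishing_derivative (fun x => Gamma3 x * cos x ^ 2) 2 /\
    first_nonvanishing_derivative (fun x => Gamma4 x * cos x ^ 2) 2 /\
    no_nonvanishing_derivative (fun x => e 0 x * cos x ^ 2) /\
    no_nonvanishing_derivative (fun x => e' 0 x / tan x) ).
Proof.
  assert (W0 := exact_weight_weight _ _ exact_weight_1).
  assert (W1 := exact_weight_weight _ _ exact_weight_Gamma1).
  assert (W2 := exact_weight_weight _ _ exact_weight_Gamma2).
  assert (W3 := exact_weight_weight _ _ exact_weight_gamma3).
  assert (W4 := exact_weight_weight _ _ exact_weight_gamma4).
  assert (Hconst : forall x, 0 < x < PI / 2 -> (fun _ : R => 1) x = (fun _ : R => 1) x)
    by reflexivity.
  assert (He0 : forall x, 0 < x < PI / 2 -> e 0 x = e0_amp * cos x ^ 3)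
    by (intros x _; apply e_0).
  assert (Ediv : forall X Y, (forall j k i, X j k i = Y j k i) ->
            forall j k i, div_omega X j k i = div_omega Y j k i).
  { intros X Y E j k i. unfold div_omega. rewrite E. reflexivity. }
  split; [|split; [apply FH0bar_estimate|]].
  - split; [|split; [|split; [|split; [|split]]]].
    + split; [|split; [|split]].
      * apply (decay_ext 3 _ _ FIbar_eq), (decay_FQbar 3 0 _ _ W0); auto.
      * apply (decay_ext 3 _ _ (Ediv _ _ FI_eq)), (decay_FQ 3 0 _ _ W0); auto.
      * apply (decay_ext 3 _ _ FJbar_eq), (decay_FPbar 3 0 _ _ W0); auto.
      * apply (decay_ext 3 _ _ (Ediv _ _ FJ_eq)), (decay_FP 3 0 _ _ W0); auto.
    + assert (E := Gamma1_eq). split; [|split; [|split]].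
      * apply (decay_FPbar 9 6 _ _ W1); auto.
      * apply (decay_FP 9 6 _ _ W1); auto.
      * apply (decay_FQbar 9 6 _ _ W1); auto.
      * apply (decay_FQ 9 6 _ _ W1); auto.
    + assert (E := Gamma2_eq). split; [|split; [|split]].
      * apply (decay_FPbar 11 8 _ _ W2); auto.
      * apply (decay_FP 11 8 _ _ W2); auto.
      * apply (decay_FQbar 11 8 _ _ W2); auto.
      * apply (decay_FQ 11 8 _ _ W2); auto.
    + assert (E := Gamma3_eq). split; [|split; [|split]].
      * apply (decay_FPbar 3 0 _ _ W3); auto.
      * apply (decay_FP 3 0 _ _ W3); auto.
      * apply (decay_FQbar 3 0 _ _ W3); auto.
      * apply (decay_FQ 3 0 _ _ W3); auto.
    + assert (E := Gamma4_eq). split; [|split; [|split]].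
      * apply (decay_FPbar 3 0 _ _ W4); auto.
      * apply (decay_FP 3 0 _ _ W4); auto.
      * apply (decay_FQbar 3 0 _ _ W4); auto.
      * apply (decay_FQ 3 0 _ _ W4); auto.
    + split.
      * apply (decay_FQbar N N (e 0) _ (weight_e0 N)); [lia|exact He0].
      * apply (decay_FQ N N (e 0) _ (weight_e0 N)); [lia|exact He0].
  - split; [|split; [|split; [|split; [|split; [|split]]]]].
    + apply (exact_weight_first_nonvanishing 0 _ _ exact_weight_1). intros x _. ring.
    + apply (exact_weight_first_nonvanishing 3 _ _ exact_weight_Gamma1).
      intros x Hx. rewrite Gamma1_eq by exact Hx. reflexivity.
    + apply (exact_weight_first_nonvanishing 4 _ _ exact_weight_Gamma2).
      intros x Hx. rewrite Gamma2_eq by exact Hx. reflexivity.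
    + apply (exact_weight_first_nonvanishing 0 _ _ exact_weight_gamma3).
      intros x Hx. rewrite Gamma3_eq by exact Hx. reflexivity.
    + apply (exact_weight_first_nonvanishing 0 _ _ exact_weight_gamma4).
      intros x Hx. rewrite Gamma4_eq by exact Hx. reflexivity.
    + apply (weight_no_nonvanishing _ _ weight_e0). intros x _. rewrite e_0. reflexivity.
    + apply (weight_no_nonvanishing _ _ (fun q => weight_cos q (-3 * e0_amp))).
      intros x Hx. destruct (sin_cos_pos x Hx) as [S0 C0].
      rewrite e'_0. unfold tan. field. lra.
Qed.
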